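(* Let $A$ be a gentle algebra such that $\mathsf{K}^b(A)$ has full exceptional sequences, and let $\mathbb{S}$ be the Serre functor in $\mathsf{K}^b(A)$. Then for any full exceptional sequence $\mathbf{X}=(X_1,\dots,X_n)$ in $\mathsf{K}^b(A)$ one has $$\mathbb{S}(\mathbf{X})=\mathbf{L}^2(\mathbf{X}),$$ where $\mathbb S(\mathbf X)=(\mathbb S X_1,\dots,\mathbb S X_n)$ and $\mathbf L$ is the left dual operation on full exceptional sequences (equality meaning termwise isomorphism).
   Context: Algebras are basic, connected and finite dimensional over a field $k$. $\mathsf{K}^b(A)$ is the homotopy category of bounded complexes of finitely generated projective $A$-modules. Gentle algebra. $A=kQ/I$ with $Q$ finite and $I$ an admissible ideal generated by paths of length two, every vertex being the source of at most two and the target of at most two arrows, and for every arrow $a$ there being at most one arrow $b'$ with $ab'$ a path not in $I$, at most one $c'$ with $c'a$ a path not in $I$, at most one $b$ with $ab$ a path in $I$, and at most one $c$ with $ca$ a path in $I$. Paths are composed from left to right. Exceptional sequences. An object $X$ of a $k$-linear triangulated category $\mathcal T$ is exceptional if $\mathrm{Hom}(X,X[m])=0$ for $m\ne 0$ and $\mathrm{End}(X)$ is a division algebra. A sequence $(X_1,\dots,X_n)$ of exceptional objects is an exceptional sequence if $\mathrm{Hom}(X_i,X_j[m])=0$ for all $j<i$, $m\in\mathbb Z$; it is full if the smallest thick subcategory containing $X_1\oplus\dots\oplus X_n$ is $\mathcal T$. Left dual. For an exceptional pair $(X,Y)$, the left mutation $L_XY$ is defined by the distinguished triangle $Y[-1]\to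 L_XY[-1]\to\coprod_{\ell\in\mathbb Z}\mathrm{Hom}(X[\ell],Y)\otimes_kX[\ell]\to Y$ with last map the evaluation map. Put $L^{i-k}X_i=L_{X_k}\cdots L_{X_{i-1}}X_i$ for $k\le i$ (so $L^0X_i=X_i$). The left dual of $\mathbf X$ is the full exceptional sequence $\mathbf{LX}=(L^{n-1}X_n,L^{n-2}X_{n-1},\dots,X_1)$, and $\mathbf L^2(\mathbf X)=\mathbf L(\mathbf L\mathbf X)$. *)

(* Defs.v *)
From HB Require Import structures.
From mathcomp Require Import all_boot all_order all_algebra all_field.
From mathcomp Require Import ring_quotient generic_quotient.
From mathcomp Require Import boolp classical_sets functions.
From mathcomp Require Import zify.

Set Implicit Arguments.
Unset Strict Implicit.
Unset Printing Implicit Defensive.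

Import Order.TTheory GRing.Theory Num.Theory.
Local Open Scope ring_scope.
Local Obligation Tactic := idtac.

Record quiver := Quiver {
  vertex : finType;
  arrow : finType;
  src : arrow -> vertex;
  tgt : arrow -> vertex }.
Arguments src {q}.
Arguments tgt {q}.

Fixpoint walk (Q : quiver) (v : vertex Q) (s : seq (arrow Q)) : bool :=
  if s is a :: s' then (src a == v) && walk (tgt a) s' else true.

(* A path is a starting vertex with a list of composable arrows, read from left
   to right; the trivial path at v is (v, [::]). *)
Definition qpath (Q : quiver) :=
  {p : vertex Q * seq (arrow Q) | walk p.1 p.2}.

Section Paths.
Variable Q : quiver.
Implicit Types p : qpath Q.

Definition plen p : nat := size (val p).2.

Definition wend (v : vertex Q) (s : seq (arrow Q)) := last v (map tgt s).

Lemma walk_cat (v : vertex Q) (s t : seq (arrow Q)) :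
  walk v (s ++ t) = walk v s && walk (wend v s) t.
Proof. by elim: s v => //= a s IHs v; rewrite IHs andbA. Qed.

Lemma ptake_subproof i p : walk (val p).1 (take i (val p).2).
Proof.
by case: p => [[v s] /= hs]; move: hs; rewrite -{1}(cat_take_drop i s) walk_cat => /andP[].
Qed.

Lemma pdrop_subproof i p :
  walk (wend (val p).1 (take i (val p).2)) (drop i (val p).2).
Proof.
by case: p => [[v s] /= hs]; move: hs; rewrite -{1}(cat_take_drop i s) walk_cat => /andP[].
Qed.

Definition ptake i p : qpath Q :=
  exist _ ((val p).1, take i (val p).2) (ptake_subproof i p).
Definition pdrop i p : qpath Q :=
  exist _ (wend (val p).1 (take i (val p).2), drop i (val p).2)
    (pdrop_subproof i p).

Lemma ptake_take i j p : (j <= i)%N -> ptake j (ptake i p) = ptake j p.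
Proof. by move=> h; apply: val_inj; rewrite /= take_takel. Qed.

Lemma pdrop_drop i j p : pdrop j (pdrop i p) = pdrop (j + i) p.
Proof.
apply: val_inj; rewrite /= drop_drop; congr (_, _).
by rewrite /wend -last_cat -map_cat -takeD addnC.
Qed.

Lemma ptake_drop i j p : ptake j (pdrop i p) = pdrop i (ptake (i + j) p).
Proof.
by apply: val_inj; rewrite /= take_takel ?leq_addr // take_drop addnC.
Qed.

Lemma pdrop0 p : pdrop 0 p = p.
Proof. by case: p => [[v s] h]; apply: val_inj; rewrite /= take0 drop0. Qed.

Lemma ptake_plen p : ptake (plen p) p = p.
Proof. by case: p => [[v s] h]; apply: val_inj; rewrite /= take_size. Qed.

Lemma plen_take i p : plen (ptake i p) = minn i (plen p).
Proof. by rewrite /plen /= size_take_min. Qed.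

Lemma plen_drop i p : plen (pdrop i p) = (plen p - i)%N.
Proof. by rewrite /plen /= size_drop. Qed.

End Paths.

Section PathAlgebra.
Variables (k : fieldType) (Q : quiver).

(* A finite quiver has finitely many paths of each length, so a function on
   paths has finite support iff it vanishes on all long enough paths. *)
Definition fsupp (f : qpath Q -> k) : Prop :=
  exists N : nat, forall p, (N <= plen p)%N -> f p = 0.
Definition fsuppb : {pred qpath Q -> k^o} := fun f => `[< fsupp f >].

Lemma fsuppb_submod : submod_closed fsuppb.
Proof.
split=> [|c f g /asboolP[N hN] /asboolP[M hM]]; apply/asboolP; first by exists 0%N.
exists (maxn N M) => p; rewrite geq_max => /andP[h1 h2].
by rewrite -[LHS]/(c * f p + g p) hN // hM // mulr0 addr0.
Qed.
HB.instance Definition _ := GRing.isSubmodClosed.Build k _ fsuppb fsuppb_submod.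

(* The path algebra kQ: finite linear combinations of paths, given by their
   coefficient functions. *)
Record pathalg := PathAlg { pcoef :> qpath Q -> k^o; _ : pcoef \in fsuppb }.

HB.instance Definition _ := [isSub for pcoef].
HB.instance Definition _ := [Choice of pathalg by <:].
HB.instance Definition _ := [SubChoice_isSubLmodule of pathalg by <:].

Implicit Types x y z : pathalg.

Lemma pathalgP x y : x =1 y -> x = y.
Proof. by move=> h; apply: val_inj; apply: funext. Qed.

(* Coefficientwise form of concatenation: the coefficient of p in x * y is the
   sum over the decompositions p = q r of the products x_q y_r. *)
Definition pmul_fun x y (p : qpath Q) : k :=
  \sum_(i < (plen p).+1) x (ptake i p) * y (pdrop i p).

Lemma pmul_subproof x y : pmul_fun x y \in fsuppb.
Proof.
have /asboolP[N hN] := valP x; have /asboolP[M hM] := valP y; apply/asboolP.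
exists (N + M)%N => p hp; apply: big1 => i _ /=.
have hi : (i <= plen p)%N by rewrite -ltnS.
case: (leqP N i) => h; first by rewrite hN ?mul0r // plen_take; lia.
by rewrite hM ?mulr0 // plen_drop; lia.
Qed.
Definition pmul x y := PathAlg (pmul_subproof x y).

Lemma pone_subproof : (fun p : qpath Q => (plen p == 0%N)%:R : k) \in fsuppb.
Proof. by apply/asboolP; exists 1%N => p; case: (plen p). Qed.
Definition pone := PathAlg pone_subproof.

Lemma pmulA : associative pmul.
Proof.
move=> x y z; apply: pathalgP => p /=; rewrite /pmul_fun /=.
pose n := plen p.
pose F i j := x (ptake i p) * (y (pdrop i (ptake j p)) * z (pdrop j p)).
transitivity (\sum_(i < n.+1) \sum_(j < n.+1 | (i <= j)%N) F i j).
  apply: eq_bigr => i _; rewrite /pmul_fun plen_drop -/n.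
  rewrite -[RHS](big_geq_mkord i n.+1 xpredT (F i)).
  have -> : \sum_(i <= j < n.+1) F i j = \sum_(0 + i <= j < n.+1) F i j by rewrite add0n.
  rewrite big_addn subSn -1?ltnS // big_mkord mulr_sumr.
  by apply: eq_bigr => j _; rewrite /F pdrop_drop ptake_drop addnC.
rewrite (exchange_big_dep xpredT) //=; apply: eq_bigr => j _.
have hj : (j <= n)%N by rewrite -ltnS.
rewrite mulr_suml plen_take (minn_idPl hj).
rewrite (big_ord_widen n.+1 (fun i => x (ptake i (ptake j p)) *
  y (pdrop i (ptake j p)) * z (pdrop j p))) ?ltnS //.
by apply: eq_big => // i hij; rewrite /F ptake_take // mulrA.
Qed.

Lemma pmul1l : left_id pone pmul.
Proof.
move=> x; apply: pathalgP => p /=; rewrite /pmul_fun /= big_ord_recl /= pdrop0.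
rewrite plen_take min0n eqxx mul1r big1 ?addr0 // => i _.
by rewrite plen_take /bump /=; case: eqP (ltn_ord i) => [|_]; [lia|rewrite mul0r].
Qed.

Lemma pmul1r : right_id pone pmul.
Proof.
move=> x; apply: pathalgP => p /=; rewrite /pmul_fun /= big_ord_recr /=.
rewrite plen_drop subnn eqxx mulr1 ptake_plen big1 ?add0r // => i _.
rewrite plen_drop; case: eqP (ltn_ord i) => [|_]; [lia|by rewrite mulr0].
Qed.

Lemma pmulDl : left_distributive pmul +%R.
Proof.
move=> x y z; apply: pathalgP => p.
rewrite -[RHS]/(pmul_fun x z p + pmul_fun y z p) -big_split /=.
by apply: eq_bigr => i _; rewrite -mulrDl.
Qed.

Lemma pmulDr : right_distributive pmul +%R.
Proof.
move=> x y z; apply: pathalgP => p.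
rewrite -[RHS]/(pmul_fun x y p + pmul_fun x z p) -big_split /=.
by apply: eq_bigr => i _; rewrite -mulrDr.
Qed.

HB.instance Definition _ := GRing.Zmodule_isPzRing.Build pathalg
  pmulA pmul1l pmul1r pmulDl pmulDr.

Lemma arr_elt_subproof (a : arrow Q) :
  (fun p : qpath Q => (val p == (src a, [:: a]))%:R : k) \in fsuppb.
Proof.
apply/asboolP; exists 2%N => p hp; case: eqP => // h.
by move: hp; rewrite /plen h.
Qed.
Definition arr_elt a : pathalg := PathAlg (arr_elt_subproof a).

Record two_sided_ideal (I : pathalg -> Prop) : Prop := TwoSidedIdeal {
  ideal0 : I 0;
  idealD : forall x y, I x -> I y -> I (x + y);
  idealMl : forall x y, I y -> I (x * y);
  idealMr : forall x y, I x -> I (x * y) }.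

Definition generated_ideal (G : pathalg -> Prop) : pathalg -> Prop :=
  fun x => forall I, two_sided_ideal I -> (forall g, G g -> I g) -> I x.

(* The m-th power of the arrow ideal of kQ: combinations of paths of length at
   least m. *)
Definition arrow_ideal_pow (m : nat) : pathalg -> Prop :=
  fun x => forall p : qpath Q, (plen p < m)%N -> x p = 0.

Definition admissible (I : pathalg -> Prop) : Prop :=
  two_sided_ideal I /\
  exists2 m : nat, (2 <= m)%N &
    (forall x, arrow_ideal_pow m x -> I x) /\
    (forall x, I x -> arrow_ideal_pow 2 x).

Definition composable (a b : arrow Q) : bool := tgt a == src b.

Definition generated_by_length2_paths (I : pathalg -> Prop) : Prop :=
  exists2 G : pathalg -> Prop,
    (forall g, G g -> exists a b, composable a b /\ g = arr_elt a * arr_elt b) &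
    (forall x, I x <-> generated_ideal G x).

Definition at_most_one (P : arrow Q -> Prop) : Prop :=
  forall b b', P b -> P b' -> b = b'.

Record gentle_bound_quiver (I : pathalg -> Prop) : Prop := GentleBoundQuiver {
  gentle_admissible : admissible I;
  gentle_quadratic : generated_by_length2_paths I;
  gentle_src : forall v : vertex Q, (#|[set a : arrow Q | src a == v]| <= 2)%N;
  gentle_tgt : forall v : vertex Q, (#|[set a : arrow Q | tgt a == v]| <= 2)%N;
  gentle_post_nonzero : forall a, at_most_one (fun b =>
    composable a b /\ ~ I (arr_elt a * arr_elt b));
  gentle_pre_nonzero : forall a, at_most_one (fun c =>
    composable c a /\ ~ I (arr_elt c * arr_elt a));
  gentle_post_zero : forall a, at_most_one (fun b =>
    composable a b /\ I (arr_elt a * arr_elt b));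
  gentle_pre_zero : forall a, at_most_one (fun c =>
    composable c a /\ I (arr_elt c * arr_elt a)) }.

(* A is isomorphic to kQ/I. *)
Definition presented_by (A : algType k) (I : pathalg -> Prop) : Prop :=
  exists phi : {linear pathalg -> A},
    [/\ phi 1 = 1,
        forall x y, phi (x * y) = phi x * phi y,
        forall a : A, exists x, phi x = a &
        forall x, phi x = 0 <-> I x].

End PathAlgebra.

Definition connected_algebra (k : fieldType) (A : algType k) : Prop :=
  forall e : A, e * e = e -> (forall a, a * e = e * a) -> e = 0 \/ e = 1.

(* An algebra kQ/I with I admissible is automatically basic. *)
Definition gentle (k : fieldType) (A : falgType k) : Prop :=
  connected_algebra A /\
  exists (Q : quiver) (I : pathalg k Q -> Prop),
    gentle_bound_quiver I /\ presented_by A I.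

(* The data of a k-linear triangulated category; [tdist u v w] means that
   X -u-> Y -v-> Z -w-> X[1] is a distinguished triangle. The axioms are not
   part of the record, which is only used to state definitions. *)
Record tricat (k : fieldType) := Tricat {
  tob :> Type;
  thom : tob -> tob -> lmodType k;
  tid : forall X, thom X X;
  tcomp : forall X Y Z, thom Y Z -> thom X Y -> thom X Z;
  tshift : int -> tob -> tob;
  tdist : forall X Y Z, thom X Y -> thom Y Z -> thom Z (tshift 1 X) -> Prop }.
Arguments thom {k t}.
Arguments tid {k t}.
Arguments tcomp {k t X Y Z}.
Arguments tshift {k t}.
Arguments tdist {k t X Y Z}.

Notation "g \c f" := (tcomp g f) (at level 40, left associativity).

Section Triangulated.
Variables (k : fieldType) (T : tricat k).
Implicit Types X Y Z : T.

Definition is_iso X Y (f : thom X Y) : Prop :=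
  exists g : thom Y X, g \c f = tid X /\ f \c g = tid Y.

Definition isomorphic X Y : Prop := exists f : thom X Y, is_iso f.

Definition exceptional X : Prop :=
  [/\ forall m : int, m != 0 -> forall f : thom X (tshift m X), f = 0,
      tid X <> 0 &
      forall f : thom X X, f <> 0 -> is_iso f].

Definition exceptional_seq n (X : 'I_n -> T) : Prop :=
  (forall i, exceptional (X i)) /\
  (forall i j : 'I_n, (j < i)%N ->
     forall (m : int) (f : thom (X i) (tshift m (X j))), f = 0).

Definition is_direct_sum n (X : 'I_n -> T) (S : T) : Prop :=
  exists (inj : forall i, thom (X i) S) (prj : forall i, thom S (X i)),
    [/\ forall i, prj i \c inj i = tid (X i),
        forall i j, i != j -> prj j \c inj i = 0 &
        \sum_i (inj i \c prj i) = tid S].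

(* Closure under direct summands includes closure under isomorphism, as the case
   n = 1. *)
Record thick (P : T -> Prop) : Prop := Thick {
  thick_shift : forall X (m : int), P X -> P (tshift m X);
  thick_cone : forall X Y Z (u : thom X Y) (v : thom Y Z) (w : thom Z (tshift 1 X)),
    tdist u v w -> P X -> P Y -> P Z;
  thick_summand : forall n (X : 'I_n -> T) S,
    is_direct_sum X S -> P S -> forall i, P (X i) }.

Definition full_seq n (X : 'I_n -> T) : Prop :=
  exists2 S, is_direct_sum X S &
    forall P, thick P -> P S -> forall Y, P Y.

Definition full_exceptional_seq n (X : 'I_n -> T) : Prop :=
  exceptional_seq X /\ full_seq X.

(* E, with the maps iota, is the coproduct over l of the tensor products
   Hom(X[l], Y) (x)_k X[l], i.e. maps E -> Z are naturally the families of linear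
   maps Hom(X[l], Y) -> Hom(X[l], Z); ev : E -> Y is the evaluation map,
   corresponding to the family of identities. *)
Definition is_evaluation X Y (E : T)
    (iota : forall l : int, {linear thom (tshift l X) Y -> thom (tshift l X) E})
    (ev : thom E Y) : Prop :=
  (forall Z (phi : forall l : int, {linear thom (tshift l X) Y -> thom (tshift l X) Z}),
     exists! g : thom E Z, forall l h, g \c iota l h = phi l h) /\
  (forall l h, ev \c iota l h = h).

(* The rotation E -> Y -> L -> E[1] of the triangle Y[-1] -> L[-1] -> E -> Y. *)
Definition is_left_mutation X Y (L : T) : Prop :=
  exists E iota ev, @is_evaluation X Y E iota ev /\
    exists (v : thom Y L) (w : thom L (tshift 1 E)), tdist ev v w.

(* A choice of L_X Y, which is determined up to isomorphism; the default value
   Y is only used if no L exists. *)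
Definition left_mutation X Y : T :=
  if pselect (exists L, is_left_mutation X Y L) is left e
  then projT1 (cid e) else Y.

(* With indices starting from 0, the j-th term of LX is
   L_(X_0) ... L_(X_(i-1)) X_i for i = n - 1 - j. *)
Definition left_dual n (X : 'I_n -> T) : 'I_n -> T := fun j =>
  foldr left_mutation (X (rev_ord j))
    [seq X m | m : 'I_n <- enum 'I_n & (m < rev_ord j)%N].

Record linear_endofunctor := LinearEndofunctor {
  fob :> T -> T;
  fmap : forall X Y, {linear thom X Y -> thom (fob X) (fob Y)};
  fmap_id : forall X, fmap X X (tid X) = tid (fob X);
  fmap_comp : forall X Y Z (g : thom Y Z) (f : thom X Y),
    fmap X Z (g \c f) = fmap Y Z g \c fmap X Y f }.
Arguments fmap l {X Y}.

(* An autoequivalence with isomorphisms Hom(X, Y) ~ Hom_k(Hom(Y, S X), k) natural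
   in X and Y. *)
Record serre_functor := SerreFunctor {
  serre :> linear_endofunctor;
  serre_ff : forall X Y, bijective (@fmap serre X Y);
  serre_ess_surj : forall Y, exists X, isomorphic (serre X) Y;
  serre_dual : forall X Y, thom X Y -> {linear thom Y (serre X) -> k^o};
  serre_dual_linear : forall X Y (c : k) (f f' : thom X Y) g,
    serre_dual (c *: f + f') g = c * serre_dual f g + serre_dual f' g;
  serre_dual_inj : forall X Y (f f' : thom X Y),
    serre_dual f =1 serre_dual f' -> f = f';
  serre_dual_surj : forall X Y (phi : {linear thom Y (serre X) -> k^o}),
    exists f : thom X Y, serre_dual f =1 phi;
  serre_dual_natural : forall X X' Y Y'
      (a : thom X' X) (b : thom Y Y') (f : thom X Y) (g : thom Y' (serre X')),
    serre_dual (b \c f \c a) g = serre_dual f (fmap serre a \c (g \c b)) }.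

End Triangulated.

Section Modules.
Variables (k : fieldType) (A : algType k).

Definition finitely_generated (M : lmodType A) : Prop :=
  exists (n : nat) (g : 'I_n -> M), forall x, exists c : 'I_n -> A,
    x = \sum_i c i *: g i.

Definition projective (P : lmodType A) : Prop :=
  forall (M N : lmodType A) (p : {linear M -> N}) (f : {linear P -> N}),
    (forall y, exists x, p x = y) ->
    exists g : {linear P -> M}, forall x, p (g x) = f x.

Lemma linear_ext (U V : lmodType A) (f g : {linear U -> V}) : f =1 g -> f = g.
Proof.
case: f => f [[a0] [b0]]; case: g => g [[a1] [b1]] /= /funext e.
by subst g; rewrite (Prop_irrelevance a1 a0) (Prop_irrelevance b1 b0).
Qed.

(* A-linear maps are scaled by k through the central elements c%:A. *)
Definition kscale_fun (c : k) (U V : lmodType A) (f : {linear U -> V}) :=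
  fun x => c%:A *: f x.
Lemma kscale_is_linear c (U V : lmodType A) (f : {linear U -> V}) : linear (kscale_fun c f).
Proof.
move=> a u v; rewrite /kscale_fun linearP scalerDr !scalerA.
by rewrite mulr_algl mulr_algr.
Qed.
HB.instance Definition _ c (U V : lmodType A) (f : {linear U -> V}) :=
  GRing.isLinear.Build A U V _ (kscale_fun c f) (kscale_is_linear c f).
Definition kscale c (U V : lmodType A) (f : {linear U -> V}) : {linear U -> V} := kscale_fun c f.

(* The identity C i -> C j if i = j, and zero otherwise. *)
Definition gcast_fun (C : int -> lmodType A) (i j : int) (x : C i) : C j :=
  if i =P j is ReflectT e then eq_rect i (fun m => C m : Type) x j e else 0.
Lemma gcast_is_linear (C : int -> lmodType A) i j : linear (@gcast_fun C i j).
Proof.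
move=> a u v; rewrite /gcast_fun; case: eqP => [e|_]; first by case: _ / e.
by rewrite scaler0 addr0.
Qed.
HB.instance Definition _ (C : int -> lmodType A) i j :=
  GRing.isLinear.Build A (C i) (C j) _ (@gcast_fun C i j) (@gcast_is_linear C i j).
Definition gcast (C : int -> lmodType A) i j : {linear C i -> C j} := @gcast_fun C i j.

Lemma gcast_id (C : int -> lmodType A) i (x : C i) : gcast C i i x = x.
Proof. by rewrite /gcast /= /gcast_fun; case: eqP => // e; rewrite eq_axiomK. Qed.
Lemma gcast_neq (C : int -> lmodType A) i j (x : C i) : i <> j -> gcast C i j x = 0.
Proof. by rewrite /gcast /= /gcast_fun; case: eqP. Qed.

Lemma fg_pair (M N : lmodType A) : finitely_generated M -> finitely_generated N ->
  finitely_generated (M * N)%type.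
Proof.
move=> [m [g hg]] [n [h hh]]; exists (m + n)%N.
exists (fun i => match fintype.split i with inl j => (g j, 0) | inr j => (0, h j) end).
move=> [x y]; have [c ->] := hg x; have [d ->] := hh y.
exists (fun i => match fintype.split i with inl j => c j | inr j => d j end).
have el (i : 'I_m) : fintype.split (lshift n i) = inl i := unsplitK (inl i).
have er (i : 'I_n) : fintype.split (rshift m i) = inr i := unsplitK (inr i).
rewrite big_split_ord /=.
under [X in _ = X + _]eq_bigr => i _ do rewrite el.
under [X in _ = _ + X]eq_bigr => i _ do rewrite er.
rewrite [RHS]surjective_pairing /= !raddf_sum /=; congr (_, _).
  by rewrite [X in _ + X]big1 ?addr0 // => i _; exact: scaler0.
by rewrite [X in X + _]big1 ?add0r // => i _; exact: scaler0.
Qed.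

Lemma projective_pair (P P' : lmodType A) : projective P -> projective P' ->
  projective (P * P')%type.
Proof.
move=> hP hP' M N p f hp.
pose i1 x : (P * P')%type := (x, 0); pose i2 x : (P * P')%type := (0, x).
have l1 : linear i1.
  by move=> a u v; congr (_, _); rewrite /= scaler0 addr0.
have l2 : linear i2.
  by move=> a u v; congr (_, _); rewrite /= scaler0 addr0.
pose L1 := HB.pack_for {linear P -> (P * P')%type} i1
  (GRing.isLinear.Build A P _ _ i1 l1).
pose L2 := HB.pack_for {linear P' -> (P * P')%type} i2
  (GRing.isLinear.Build A P' _ _ i2 l2).
have [g1 h1] := hP M N p (f \o L1 : {linear _ -> _}) hp.
have [g2 h2] := hP' M N p (f \o L2 : {linear _ -> _}) hp.
exists ((g1 \o fst) \+ (g2 \o snd) : {linear _ -> _}) => -[x y] /=.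
rewrite linearD h1 h2 /= -linearD; congr (f _).
by congr (_, _); rewrite /= ?addr0 ?add0r.
Qed.

(* Differentials are indexed by pairs of degrees and vanish except from degree i
   to degree i + 1, so that shifts need no transport between degrees. *)
Record bcomplex := BComplex {
  cob :> int -> lmodType A;
  dif : forall i j, {linear cob i -> cob j};
  dif_shape : forall i j x, j != i + 1 -> dif i j x = 0;
  dif_dif : forall i j l x, dif j l (dif i j x) = 0;
  cob_bounded : exists b : nat, forall i, (b < `|i|)%N -> forall x : cob i, x = 0;
  cob_fg : forall i, finitely_generated (cob i);
  cob_proj : forall i, projective (cob i) }.

Implicit Types X Y Z : bcomplex.

Record chain X Y := Chain {
  cmap :> forall i, {linear X i -> Y i};
  cmap_comm : forall i j x, cmap j (dif X i j x) = dif Y i j (cmap i x) }.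

Lemma chain_ext X Y (f g : chain X Y) : (forall i, f i =1 g i) -> f = g.
Proof.
case: f g => [f hf] [g hg] /= h.
have e : f = g by apply: functional_extensionality_dep => i; exact/linear_ext/h.
by subst g; congr Chain; apply: Prop_irrelevance.
Qed.

HB.instance Definition _ X Y := gen_eqMixin (chain X Y).
HB.instance Definition _ X Y := gen_choiceMixin (chain X Y).

Program Definition chain_zero X Y : chain X Y := @Chain X Y (fun i => \0) _.
Next Obligation. by move=> X Y i j x /=; rewrite linear0. Qed.
Program Definition chain_opp X Y (f : chain X Y) : chain X Y :=
  @Chain X Y (fun i => \- f i) _.
Next Obligation. by move=> X Y f i j x /=; rewrite linearN cmap_comm. Qed.
Program Definition chain_add X Y (f g : chain X Y) : chain X Y :=
  @Chain X Y (fun i => f i \+ g i) _.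
Next Obligation. by move=> X Y f g i j x /=; rewrite linearD !cmap_comm. Qed.
Program Definition chain_scale X Y (c : k) (f : chain X Y) : chain X Y :=
  @Chain X Y (fun i => kscale c (f i)) _.
Next Obligation.
by move=> X Y c f i j x; rewrite /= /kscale_fun linearZ cmap_comm.
Qed.

Lemma chain_addA X Y : associative (@chain_add X Y).
Proof. by move=> f g h; apply: chain_ext => i x /=; rewrite addrA. Qed.
Lemma chain_addC X Y : commutative (@chain_add X Y).
Proof. by move=> f g; apply: chain_ext => i x /=; rewrite addrC. Qed.
Lemma chain_add0 X Y : left_id (@chain_zero X Y) (@chain_add X Y).
Proof. by move=> f; apply: chain_ext => i x /=; rewrite add0r. Qed.
Lemma chain_addN X Y :
  left_inverse (@chain_zero X Y) (@chain_opp X Y) (@chain_add X Y).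
Proof. by move=> f; apply: chain_ext => i x /=; rewrite addNr. Qed.
HB.instance Definition _ X Y := GRing.isZmodule.Build (chain X Y)
  (@chain_addA X Y) (@chain_addC X Y) (@chain_add0 X Y) (@chain_addN X Y).

Lemma chain_scaleA X Y a b (f : chain X Y) :
  chain_scale a (chain_scale b f) = chain_scale (a * b) f.
Proof.
apply: chain_ext => i x; rewrite /= /kscale_fun /= scalerA.
by rewrite mulr_algl scalerA.
Qed.
Lemma chain_scale1 X Y : left_id 1 (@chain_scale X Y).
Proof. by move=> f; apply: chain_ext => i x; rewrite /= /kscale_fun !scale1r. Qed.
Lemma chain_scaleDr X Y : right_distributive (@chain_scale X Y) +%R.
Proof.
by move=> c f g; apply: chain_ext => i x; rewrite /= /kscale_fun -scalerDr.
Qed.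
Lemma chain_scaleDl X Y (f : chain X Y) :
  {morph (@chain_scale X Y)^~ f : a b / a + b}.
Proof.
by move=> a b; apply: chain_ext => i x; rewrite /= /kscale_fun !scalerDl.
Qed.
HB.instance Definition _ X Y := GRing.Zmodule_isLmodule.Build k (chain X Y)
  (@chain_scaleA X Y) (@chain_scale1 X Y) (@chain_scaleDr X Y)
  (@chain_scaleDl X Y).

Definition chain_id X : chain X X := @Chain X X (fun i => idfun) (fun i j x => erefl).
Program Definition chain_comp X Y Z (g : chain Y Z) (f : chain X Y) : chain X Z :=
  @Chain X Z (fun i => g i \o f i) _.
Next Obligation. by move=> X Y Z g f i j x; rewrite /= !cmap_comm. Qed.

Definition nullhomotopic X Y (f : chain X Y) : Prop :=
  exists s : forall i j, {linear X i -> Y j}, forall i x,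
    f i x = dif Y (i - 1) i (s i (i - 1) x) + s (i + 1) i (dif X i (i + 1) x).
Definition nullhomotopicb X Y : {pred chain X Y} := fun f => `[< nullhomotopic f >].

Lemma nullhomotopicb_submod X Y : submod_closed (@nullhomotopicb X Y).
Proof.
split=> [|c f g /asboolP[s hs] /asboolP[t ht]]; apply/asboolP.
  by exists (fun i j => \0) => i x; rewrite /= linear0 addr0.
exists (fun i j => kscale c (s i j) \+ t i j) => i x.
rewrite /= /kscale_fun hs ht linearD linearZ scalerDr /=.
by rewrite -!addrA; congr (_ + _); rewrite addrCA.
Qed.
HB.instance Definition _ X Y :=
  GRing.isSubmodClosed.Build k _ (@nullhomotopicb X Y) (@nullhomotopicb_submod X Y).

(* Chain maps modulo null-homotopic ones. *)
Definition khom X Y := Quotient.quot (@nullhomotopicb X Y).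
HB.instance Definition _ X Y := GRing.Zmodule.on (khom X Y).

Definition kclass X Y (f : chain X Y) : khom X Y := (\pi_(khom X Y) f)%qT.
Definition krepr X Y (q : khom X Y) : chain X Y := repr q.

Lemma kreprK X Y (q : khom X Y) : kclass (krepr q) = q.
Proof. exact: reprK. Qed.
Lemma kclass_eq X Y (f g : chain X Y) : kclass f = kclass g <-> nullhomotopic (f - g).
Proof.
split=> [h|h]; last by apply/eqP; rewrite -Quotient.idealrBE; apply/asboolP.
by apply/asboolP; move/eqP: h; rewrite -Quotient.idealrBE.
Qed.
Lemma kclassD X Y (f g : chain X Y) : kclass (f + g) = kclass f + kclass g.
Proof. by rewrite /kclass !piE. Qed.

Definition kscaleq X Y (c : k) (q : khom X Y) : khom X Y := kclass (c *: krepr q).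

Lemma kclassZ X Y c (f : chain X Y) : kclass (c *: f) = kscaleq c (kclass f).
Proof.
apply/kclass_eq; rewrite -scalerBr; apply/asboolP.
have /kclass_eq/asboolP h : kclass f = kclass (krepr (kclass f)) by rewrite kreprK.
exact: (@rpredZ _ _ (@nullhomotopicb X Y)).
Qed.

Lemma kscaleqA X Y a b (q : khom X Y) : kscaleq a (kscaleq b q) = kscaleq (a * b) q.
Proof. by rewrite -[q]kreprK -!kclassZ scalerA. Qed.
Lemma kscaleq1 X Y : left_id 1 (@kscaleq X Y).
Proof. by move=> q; rewrite -[q]kreprK -kclassZ scale1r. Qed.
Lemma kscaleqDr X Y : right_distributive (@kscaleq X Y) +%R.
Proof.
by move=> c q r; rewrite -[q]kreprK -[r]kreprK -kclassD -!kclassZ scalerDr kclassD.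
Qed.
Lemma kscaleqDl X Y (q : khom X Y) : {morph (@kscaleq X Y)^~ q : a b / a + b}.
Proof. by move=> a b; rewrite -[q]kreprK -!kclassZ scalerDl kclassD. Qed.
HB.instance Definition _ X Y := GRing.Zmodule_isLmodule.Build k (khom X Y)
  (@kscaleqA X Y) (@kscaleq1 X Y) (@kscaleqDr X Y) (@kscaleqDl X Y).

Definition kcomp X Y Z (q : khom Y Z) (r : khom X Y) : khom X Z :=
  kclass (chain_comp (krepr q) (krepr r)).

Lemma kcompE X Y Z (g : chain Y Z) (f : chain X Y) :
  kcomp (kclass g) (kclass f) = kclass (chain_comp g f).
Proof.
apply/kclass_eq.
have /kclass_eq[s hs] : kclass (krepr (kclass g)) = kclass g by rewrite kreprK.
have /kclass_eq[t ht] : kclass (krepr (kclass f)) = kclass f by rewrite kreprK.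
set g' := krepr _ in hs *; set f' := krepr _ in ht *.
exists (fun i j => (s i j \o f' i) \+ (g j \o t i j)) => i x /=.
have -> : g' i (f' i x) - g i (f i x) = (g' - g) i (f' i x) + g i ((f' - f) i x).
  by rewrite /= linearB addrA subrK.
rewrite hs ht !linearD /= !cmap_comm.
by rewrite -!addrA; congr (_ + _); rewrite addrCA.
Qed.

Program Definition cshift (m : int) X : bcomplex :=
  @BComplex (fun i => X (i + m))
    (fun i j => kscale ((-1) ^+ `|m|%N) (dif X (i + m) (j + m))) _ _ _ _ _.
Next Obligation.
move=> m X i j x hj; rewrite /= /kscale_fun dif_shape ?scaler0 //.
by apply: contra_neq hj => h; lia.
Qed.
Next Obligation.
by move=> m X i j l x; rewrite /= /kscale_fun linearZZ dif_dif !scaler0.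
Qed.
Next Obligation.
move=> m X; have [b hb] := cob_bounded X; exists (b + `|m|)%N => i hi.
by apply: hb; lia.
Qed.
Next Obligation. by move=> m X i; apply: cob_fg. Qed.
Next Obligation. by move=> m X i; apply: cob_proj. Qed.

Program Definition chain_shift (m : int) X Y (f : chain X Y) :
    chain (cshift m X) (cshift m Y) :=
  @Chain (cshift m X) (cshift m Y) (fun i => f (i + m)) _.
Next Obligation.
by move=> m X Y f i j x; rewrite /= /kscale_fun linearZ cmap_comm.
Qed.

Section Cone.
Variables (X Y : bcomplex) (f : chain X Y).

Definition cone_ob (i : int) : lmodType A := (X (i + 1)%R * Y i)%type.

Definition cone_dif_fun i j (z : cone_ob i) : cone_ob j :=
  (- dif X (i + 1) (j + 1) z.1, gcast Y (i + 1) j (f (i + 1) z.1) + dif Y i j z.2).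
Lemma cone_dif_is_linear i j : linear (@cone_dif_fun i j).
Proof.
move=> a u v; rewrite /cone_dif_fun; congr (_, _) => /=.
  by rewrite linearP opprD scalerN.
by rewrite !linearP scalerDr addrACA.
Qed.
HB.instance Definition _ i j :=
  GRing.isLinear.Build A (cone_ob i) (cone_ob j) _ (@cone_dif_fun i j)
    (@cone_dif_is_linear i j).

Program Definition cone : bcomplex :=
  @BComplex cone_ob (fun i j => @cone_dif_fun i j) _ _ _ _ _.
Next Obligation.
move=> i j [x y] hj; rewrite /= /cone_dif_fun /=; congr (_, _).
  by rewrite dif_shape ?oppr0 //; apply: contra_neq hj => h; lia.
by rewrite gcast_neq ?dif_shape ?addr0 //; apply/eqP; rewrite eq_sym.
Qed.
Next Obligation.
move=> i j l [x y]; rewrite /= /cone_dif_fun /=; congr (_, _).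
  by rewrite linearN dif_dif !oppr0.
rewrite linearD dif_dif addr0 !linearN cmap_comm.
have [<-|nij] := eqVneq (i + 1) j; last first.
  rewrite (@gcast_neq Y (i + 1) j); last exact/eqP.
  rewrite linear0 addr0 dif_shape ?linear0 ?oppr0 //.
  by apply: contra_neq nij => h; lia.
rewrite gcast_id.
have [<-|njl] := eqVneq (i + 1 + 1) l; first by rewrite gcast_id addNr.
by rewrite gcast_neq ?dif_shape ?oppr0 ?addr0 // 1?eq_sym //; apply/eqP.
Qed.
Next Obligation.
have [b hb] := cob_bounded X; have [c hc] := cob_bounded Y.
exists (b + c + 1)%N => i hi [x y]; congr (_, _).
  by apply: hb; lia.
by apply: hc; lia.
Qed.
Next Obligation. by move=> i; apply: fg_pair; apply: cob_fg. Qed.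
Next Obligation. by move=> i; apply: projective_pair; apply: cob_proj. Qed.

Definition cone_inj_fun i (y : Y i) : cone_ob i := (0, y).
Lemma cone_inj_is_linear i : linear (@cone_inj_fun i).
Proof. by move=> a u v; congr (_, _); rewrite /= scaler0 addr0. Qed.
HB.instance Definition _ i := GRing.isLinear.Build A (Y i) (cone_ob i) _
  (@cone_inj_fun i) (@cone_inj_is_linear i).
Program Definition cone_inj : chain Y cone :=
  @Chain Y cone (fun i => @cone_inj_fun i) _.
Next Obligation.
move=> i j x; rewrite /= /cone_dif_fun /cone_inj_fun /=.
by rewrite !linear0 add0r; congr (_, _); rewrite /= ?linear0 ?oppr0.
Qed.

Program Definition cone_prj : chain cone (cshift 1 X) :=
  @Chain cone (cshift 1 X) (fun i => fst) _.
Next Obligation.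
move=> i j x; rewrite /= /kscale_fun /= expr1.
by rewrite scaleN1r scaleNr scale1r.
Qed.

End Cone.

(* The triangles isomorphic in the homotopy category to a standard triangle
   X' -> Y' -> cone f -> X'[1]. *)
Definition kdist X Y Z (u : khom X Y) (v : khom Y Z) (w : khom Z (cshift 1 X)) :
    Prop :=
  exists (X' Y' : bcomplex) (f : chain X' Y')
      (a : chain X X') (a' : chain X' X) (b : khom Y Y') (b' : khom Y' Y)
      (c : khom Z (cone f)) (c' : khom (cone f) Z),
    [/\ kcomp (kclass a') (kclass a) = kclass (chain_id X) /\
        kcomp (kclass a) (kclass a') = kclass (chain_id X'),
        kcomp b' b = kclass (chain_id Y) /\ kcomp b b' = kclass (chain_id Y'),
        kcomp c' c = kclass (chain_id Z) /\
        kcomp c c' = kclass (chain_id (cone f)) &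
        [/\ kcomp b u = kcomp (kclass f) (kclass a),
            kcomp c v = kcomp (kclass (cone_inj f)) b &
            kcomp (kclass (chain_shift 1 a)) w = kcomp (kclass (cone_prj f)) c]].

Definition Kb : tricat k :=
  @Tricat k bcomplex (fun X Y => khom X Y : lmodType k)
    (fun X => kclass (chain_id X)) kcomp cshift kdist.

End Modules.

(* Main.v *)
Require Import Defs.
From HB Require Import structures.
From mathcomp Require Import all_boot all_order all_algebra all_field.
From mathcomp Require Import boolp classical_sets functions.
From mathcomp Require Import zify.

Set Implicit Arguments.
Unset Strict Implicit.
Unset Printing Implicit Defensive.

Import Order.TTheory GRing.Theory Num.Theory.
Local Open Scope ring_scope.
Local Obligation Tactic := idtac.

(**
The left dual of an exceptional sequence X_0, ..., X_(n-1) consists, in reverse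
order, of the objects Y_i = L_(X_0) ... L_(X_(i-1)) X_i, and Y_i is the object with
graded Hom(X_j, Y_i) equal to k in degree 0 for j = i and to zero for j <> i:
mutation through X makes an object right orthogonal to X, and changes neither the
maps from objects left orthogonal to X nor the maps to objects right orthogonal to X
([left_mutation_map]).  The Y_i form again an exceptional sequence which generates,
so the second dual Z_i has the same characterization with respect to the Y_j.  By
Serre duality Hom(Y_j, S X_i) is dual to Hom(X_i, Y_j), hence S X_i has the graded
Hom's of Z_i.  To compare the two objects, extend a nonzero map Y_i -> S X_i along
the canonical map Y_i -> Z_i; the resulting map Z_i -> S X_i induces bijections on
graded Hom(Y_j, -) for all j, so its cone is orthogonal to a generating family and
vanishes ([serre_left_dual2]).

The mutation triangle uses tensor products over k, so this argument needs the
endomorphism algebra D of an exceptional object to be k, and not only a division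
algebra.  That holds over an algebra A = kQ/I with I admissible, for a numerical
reason ([exceptional_hom1]).  Let d = dim D, let S_l be the simple module and e_l the
idempotent of the vertex l, and put p_l = sum_i (-1)^i dim Hom(X^i, S_l) and
q_l = sum_i (-1)^i dim e_l X^i.  A composition series of X^j gives
dim Hom(X^i, X^j) = sum_l dim Hom(X^i, S_l) dim e_l X^j ([hom_dim]), so the Euler
characteristic of the complex of graded maps X -> X is sum_l p_l q_l; it is also d,
since X is exceptional.  But p_l and q_l are Euler characteristics of complexes whose
cohomology is a vector space over D, hence they are divisible by d
([division_dvd]).  Therefore d^2 divides d, and d = 1.

What remains is that the homotopy category has finite dimensional and bounded
graded Hom's, finite direct sums, cones, and long exact Hom sequences
([kb_triangulated]).
*)

(** * Dimensions of subspaces *)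

Section Dimension.
Variable k : fieldType.
Implicit Types V W : lmodType k.

Definition mk_linear (R : pzRingType) (U U' : lmodType R) (f : U -> U') (h : linear f) :
  {linear U -> U'} := HB.pack_for {linear U -> U'} f (GRing.isLinear.Build R U U' _ f h).

Definition subspace V (P : V -> Prop) : Prop :=
  P 0 /\ forall c x y, P x -> P y -> P (c *: x + y).

(** A subspace is a predicate and its dimension a relation, so that subspaces of function
    spaces and of spaces of chain maps need no structure of their own. *)
Definition has_dim V (P : V -> Prop) (n : nat) : Prop :=
  exists2 f : {linear 'rV[k]_n -> V}, injective f & forall x, P x <-> exists u, x = f u.

Lemma subspaceD V (P : V -> Prop) x y : subspace P -> P x -> P y -> P (x + y).
Proof. by move=> [_ h] hx hy; rewrite -[x]scale1r; apply: h. Qed.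
Lemma subspaceZ V (P : V -> Prop) c x : subspace P -> P x -> P (c *: x).
Proof. by move=> [h0 h] hx; rewrite -[_ *: _]addr0; apply: h. Qed.
Lemma subspaceB V (P : V -> Prop) x y : subspace P -> P x -> P y -> P (x - y).
Proof.
by move=> hP hx hy; rewrite -scaleN1r; apply: subspaceD => //; apply: subspaceZ.
Qed.
Lemma subspace_sum V (P : V -> Prop) (I : finType) (F : I -> V) :
  subspace P -> (forall i, P (F i)) -> P (\sum_i F i).
Proof.
move=> hP hF; apply: (big_ind P) => //; first by case: hP.
by move=> x y; apply: subspaceD.
Qed.

Lemma has_dim_subspace V (P : V -> Prop) n : has_dim P n -> subspace P.
Proof.
move=> [f _ hf]; split=> [|c x y /hf[u ->] /hf[v ->]]; apply/hf.
  by exists 0; rewrite linear0.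
by exists (c *: u + v); rewrite linearP.
Qed.

Lemma has_dim_ext V (P Q : V -> Prop) n :
  (forall x, P x <-> Q x) -> has_dim P n -> has_dim Q n.
Proof. by move=> h [f fI hf]; exists f => // x; rewrite -h. Qed.

(** Comparing coordinates turns the injection into a matrix of full row rank. *)
Lemma free_le_dim V (Q : V -> Prop) r m (f : {linear 'rV[k]_r -> V}) :
  injective f -> (forall u, Q (f u)) -> has_dim Q m -> (r <= m)%N.
Proof.
move=> fI fQ [g gI hg].
have /choice[h hh] : forall u, exists v, f u = g v by move=> u; apply/hg.
have hl : linear h by move=> c x y; apply: gI; rewrite -hh !linearP !hh.
pose H := mk_linear hl; pose M := lin1_mx H.
have free : row_free M.
  rewrite -kermx_eq0; apply/eqP/row_matrixP => i; rewrite row0.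
  have : row i (kermx M) *m M = 0 by rewrite -row_mul mulmx_ker row0.
  rewrite mul_rV_lin1 => e; apply: fI; rewrite hh -[h _]/(H _) e.
  by rewrite !linear0.
by rewrite -(eqP free) rank_leq_col.
Qed.

Lemma has_dim_le V (P Q : V -> Prop) n m :
  (forall x, P x -> Q x) -> has_dim P n -> has_dim Q m -> (n <= m)%N.
Proof.
move=> h [f fI hf]; apply: (free_le_dim fI) => u.
by apply/h/hf; exists u.
Qed.

Lemma has_dim_uniq V (P : V -> Prop) n m : has_dim P n -> has_dim P m -> n = m.
Proof.
by move=> h1 h2; apply/eqP; rewrite eqn_leq !(has_dim_le (P := P) (Q := P)).
Qed.

Lemma has_dim0 V (P : V -> Prop) : (forall x, P x <-> x = 0) -> has_dim P 0.
Proof.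
move=> h; exists \0 => [u v _|x]; first by apply/rowP => -[].
by rewrite h; split=> [->|[]//]; exists 0.
Qed.

Section LinearCombination.
Variables (V : lmodType k) (n : nat) (b : 'I_n -> V).
Definition lincomb_fun (u : 'rV[k]_n) : V := \sum_i u 0 i *: b i.
Lemma lincomb_is_linear : linear lincomb_fun.
Proof.
move=> c u v; rewrite /lincomb_fun scaler_sumr -big_split /=.
by apply: eq_bigr => i _; rewrite !mxE scalerDl scalerA.
Qed.
Definition lincomb : {linear 'rV[k]_n -> V} := mk_linear lincomb_is_linear.
Lemma lincombE u : lincomb u = \sum_i u 0 i *: b i. Proof. by []. Qed.
End LinearCombination.

Lemma linear_lincomb V n (f : {linear 'rV[k]_n -> V}) u :
  f u = lincomb (fun i => f (delta_mx 0 i)) u.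
Proof.
rewrite lincombE {1}(row_sum_delta u) linear_sum.
by apply: eq_bigr => i _; rewrite linearZ.
Qed.

Lemma has_dim_add V (P : V -> Prop) a b (g : {linear 'rV[k]_b -> V}) :
  has_dim P a -> (forall v, P (g v) -> v = 0) ->
  has_dim (fun x => exists p v, P p /\ x = p + g v) (a + b).
Proof.
move=> dP hg; have [f fI hf] := dP; have sP := has_dim_subspace dP.
pose F (u : 'rV[k]_(a + b)) := f (lsubmx u) + g (rsubmx u).
have Fl : linear F.
  by move=> c u v; rewrite /F !linearP scalerDr addrACA.
exists (mk_linear Fl) => [|x] /=.
  move=> u v; rewrite /= /F => e.
  have e' : f (lsubmx (u - v)) + g (rsubmx (u - v)) = 0.
    by rewrite ![_ (u - v)]linearB !linearB addrACA e -opprD subrr.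
  have r0 : rsubmx (u - v) = 0.
    apply: hg; apply/hf; exists (- lsubmx (u - v)).
    by rewrite linearN; apply/eqP; rewrite -addr_eq0 addrC e'.
  have l0 : lsubmx (u - v) = 0.
    by apply: fI; move: e'; rewrite r0 !linear0 addr0.
  apply/eqP; rewrite -subr_eq0 -(hsubmxK (u - v)) r0 l0.
  by rewrite row_mx0.
split=> [[p [v [/hf[u ->] ->]]]|[u ->]].
  by exists (row_mx u v); rewrite /F row_mxKl row_mxKr.
by exists (f (lsubmx u)), (rsubmx u); split => //; apply/hf; exists (lsubmx u).
Qed.

Lemma has_dim_add1 V (P : V -> Prop) a x :
  has_dim P a -> ~ P x -> has_dim (fun y => exists p c, P p /\ y = p + c *: x) (a + 1).
Proof.
move=> dP Px; have sP := has_dim_subspace dP.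
have e (v : 'rV[k]_1) : lincomb (fun=> x) v = v 0 0 *: x by rewrite lincombE big_ord1.
apply: (has_dim_ext _ (@has_dim_add V P a 1 (lincomb (fun=> x)) dP _)) => [y|v].
  split=> [[p [v [hp ->]]]|[p [c [hp ->]]]].
    by exists p, (v 0 0); rewrite e.
  by exists p, (const_mx c); rewrite e mxE.
rewrite e => h; apply/rowP => i; rewrite ord1 mxE; apply/eqP/negPn/negP => v0.
by apply: Px; rewrite -(scalerK v0 x); apply: subspaceZ.
Qed.

(** A maximal free family is a basis, since any further vector would extend it. *)
Lemma bounded_has_dim V (P : V -> Prop) N : subspace P ->
  (forall r (f : {linear 'rV[k]_r -> V}), injective f -> (forall u, P (f u)) -> (r <= N)%N) ->
  exists n, has_dim P n.
Proof.
move=> sP hN.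
pose A r := `[< exists2 f : {linear 'rV[k]_r -> V}, injective f & forall u, P (f u) >].
have exA : exists r, A r.
  exists 0%N; apply/asboolP; exists \0 => [u v _|u]; first by apply/rowP => -[].
  by case: sP.
have bA r : A r -> (r <= N)%N by move=> /asboolP[f fI fP]; apply: (hN r f).
have [r /asboolP[f fI fP] rmax] := ex_maxnP exA bA.
exists r, f => // x; split=> [Px|[u ->]//]; apply: contrapT => hx.
have di : has_dim (fun y => exists u, y = f u) r by exists f.
have [g gI hg] := has_dim_add1 di hx.
suff : A (r + 1)%N by move=> /rmax; rewrite addn1 ltnn.
apply/asboolP; exists g => // u.
have /hg[p [c [[v ->] ->]]] : exists v, g u = g v by exists u.
by rewrite addrC; apply: sP.2.
Qed.

Lemma sub_has_dim V (P Q : V -> Prop) m : subspace P -> (forall x, P x -> Q x) ->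
  has_dim Q m -> exists n, has_dim P n.
Proof.
move=> sP h dQ; apply: (bounded_has_dim (N := m) sP) => r f fI fP.
by apply: (free_le_dim fI _ dQ) => u; apply: h.
Qed.

Definition image_of V W (f : V -> W) (P : V -> Prop) (y : W) : Prop :=
  exists2 x, P x & y = f x.

Lemma subspace_image V W (f : {linear V -> W}) P : subspace P -> subspace (image_of f P).
Proof.
move=> sP; split; first by exists 0; [case: sP|rewrite linear0].
by move=> c _ _ [x hx ->] [y hy ->]; exists (c *: x + y); [apply: sP.2|rewrite linearP].
Qed.

Lemma subspace_ker V W (f : {linear V -> W}) P :
  subspace P -> subspace (fun x => P x /\ f x = 0).
Proof.
move=> sP; split; first by split; [case: sP|rewrite linear0].
move=> c x y [hx ex] [hy ey]; split; first exact: sP.2.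
by rewrite linearP ex ey scaler0 addr0.
Qed.

Lemma lift_lincomb V W (f : {linear V -> W}) P r (h : {linear 'rV[k]_r -> W}) :
  subspace P -> (forall u, image_of f P (h u)) ->
  exists g : {linear 'rV[k]_r -> V}, (forall u, P (g u)) /\ (forall u, f (g u) = h u).
Proof.
move=> sP hP.
have /choice[v hv] : forall i, exists x, P x /\ h (delta_mx 0 i) = f x.
  by move=> i; have [x hx e] := hP (delta_mx 0 i); exists x.
exists (lincomb v); split=> u.
  by rewrite lincombE; apply: subspace_sum => // i; apply: subspaceZ => //; case: (hv i).
rewrite (linear_lincomb h) !lincombE linear_sum; apply: eq_bigr => i _.
by rewrite linearZ /= (hv i).2.
Qed.

(** A lift of a basis of the image spans a complement of the kernel. *)
Lemma rank_nullity V W (f : {linear V -> W}) P n : has_dim P n ->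
  exists a b, [/\ has_dim (fun x => P x /\ f x = 0) a, has_dim (image_of f P) b & n = (a + b)%N].
Proof.
move=> dP; have sP := has_dim_subspace dP.
have [a da] : exists a, has_dim (fun x => P x /\ f x = 0) a.
  by apply: (sub_has_dim (subspace_ker f sP) _ dP) => x [].
have [b db] : exists b, has_dim (image_of f P) b.
  apply: (bounded_has_dim (N := n) (subspace_image f sP)) => r h hI hP.
  have [g [gP fg]] := lift_lincomb sP hP.
  by apply: (free_le_dim (f := g) _ gP dP) => u v e; apply: hI; rewrite -!fg e.
exists a, b; split => //; apply: (has_dim_uniq dP).
have [h hI hb] := db.
have [|g [gP fg]] := @lift_lincomb V W f P b h sP; first by move=> u; apply/hb; exists u.
apply: (has_dim_ext _ (has_dim_add (g := g) da _)) => [x|v [_]].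
  split=> [[p [v [[hp _] ->]]]|hx]; first by apply: subspaceD.
  have /hb[u e] : image_of f P (f x) by exists x.
  exists (x - g u), u; rewrite subrK; split => //; split; first exact: subspaceB.
  by rewrite linearB fg e subrr.
by rewrite fg => e; apply: hI; rewrite e linear0.
Qed.

Lemma separating_functional V n (x : V) : has_dim (fun _ : V => True) n -> x <> 0 ->
  exists phi : {linear V -> k^o}, phi x <> 0.
Proof.
move=> [f fI hf] x0.
have /choice[g hg] : forall y, exists u, y = f u by move=> y; apply/hf.
have gl : linear g by move=> c y z; apply: fI; rewrite -hg linearP -!hg.
have [i hi] : exists i, g x 0 i != 0.
  apply: contrapT => h; apply: x0; rewrite (hg x) (_ : g x = 0) ?linear0 //.
  by apply/rowP => i; rewrite mxE; apply/eqP/negPn/negP => hi; apply: h; exists i.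
have pl : linear (fun y => g y 0 i : k^o).
  by move=> c y z; rewrite gl !mxE.
by exists (mk_linear pl); apply/eqP.
Qed.

End Dimension.

(** * Hom-finite triangulated categories *)

(** The part of the axioms of a triangulated category that long exact Hom sequences and
    mutations use. The shift of morphisms is data; rotation and the octahedral axiom are
    replaced by the exactness of Hom sequences at the terms where it is needed. *)
Record hom_finite_triangulated (k : fieldType) (T : tricat k) := HomFiniteTriangulated {
  shm : forall (m : int) (X Y : T), {linear thom X Y -> thom (tshift m X) (tshift m Y)};
  tcompA : forall (X Y Z W : T) (h : thom Z W) (g : thom Y Z) (f : thom X Y),
    h \c (g \c f) = h \c g \c f;
  tcomp1l : forall (X Y : T) (f : thom X Y), tid Y \c f = f;
  tcomp1r : forall (X Y : T) (f : thom X Y), f \c tid X = f;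
  tcompPl : forall (X Y Z : T) c (g g' : thom Y Z) (f : thom X Y),
    (c *: g + g') \c f = c *: (g \c f) + g' \c f;
  tcompPr : forall (X Y Z : T) c (g : thom Y Z) (f f' : thom X Y),
    g \c (c *: f + f') = c *: (g \c f) + g \c f';
  shm_id : forall m (X : T), shm m X X (tid X) = tid (tshift m X);
  shm_comp : forall m (X Y Z : T) (g : thom Y Z) (f : thom X Y),
    shm m X Z (g \c f) = shm m Y Z g \c shm m X Y f;
  shm_inj : forall m (X Y : T), injective (shm m X Y);
  shm_surj : forall m (X Y : T) g, exists f, g = shm m X Y f;
  tshift0 : forall X : T, isomorphic (tshift 0 X) X;
  tshiftD : forall m l (X : T), isomorphic (tshift l (tshift m X)) (tshift (m + l) X);
  hom_findim : forall X Y : T, exists n, has_dim (fun _ : thom X Y => True) n;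
  hom_bounded : forall X Y : T, exists N : nat, forall l : int, (N < `|l|)%N ->
    forall f : thom (tshift l X) Y, f = 0;
  zero_object : exists O : T, tid O = 0;
  biproduct : forall X Y : T, exists (S : T) (i1 : thom X S) (i2 : thom Y S)
      (p1 : thom S X) (p2 : thom S Y),
    [/\ p1 \c i1 = tid X, p2 \c i2 = tid Y, p1 \c i2 = 0, p2 \c i1 = 0 &
        i1 \c p1 + i2 \c p2 = tid S];
  cone_exists : forall (X Y : T) (u : thom X Y), exists Z v w, @tdist k T X Y Z u v w;
  dist_vu : forall (X Y Z : T) u v w, @tdist k T X Y Z u v w -> v \c u = 0;
  dist_uw : forall (X Y Z : T) u v w, @tdist k T X Y Z u v w -> shm 1 X Y u \c w = 0;
  dist_exact_Y : forall (X Y Z : T) u v w, @tdist k T X Y Z u v w ->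
    forall W (h : thom W Y), v \c h = 0 -> exists h', h = u \c h';
  dist_exact_Z : forall (X Y Z : T) u v w, @tdist k T X Y Z u v w ->
    forall W (h : thom W Z), w \c h = 0 -> exists h', h = v \c h';
  dist_exact_X1 : forall (X Y Z : T) u v w, @tdist k T X Y Z u v w ->
    forall W (h : thom W (tshift 1 X)), shm 1 X Y u \c h = 0 -> exists h', h = w \c h';
  dist_coexact_Y : forall (X Y Z : T) u v w, @tdist k T X Y Z u v w ->
    forall W (h : thom Y W), h \c u = 0 -> exists h', h = h' \c v;
  dist_coexact_Z : forall (X Y Z : T) u v w, @tdist k T X Y Z u v w ->
    forall W (h : thom Z W), h \c v = 0 -> exists h', h = h' \c w }.

Lemma dependent_choice_fun (I : Type) (B : I -> Type) (P : forall i, B i -> Prop) :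
  (forall i, exists y, P i y) -> exists f : forall i, B i, forall i, P i (f i).
Proof. by move=> h; exists (fun i => projT1 (cid (h i))) => i; case: (cid _). Qed.

Section Orthogonality.
Variables (k : fieldType) (T : tricat k) (tT : hom_finite_triangulated T).
Implicit Types (X Y Z V W : T).

Definition postc X Y Z (g : thom Y Z) : {linear thom X Y -> thom X Z} :=
  mk_linear (fun c f f' => tcompPr tT c g f f').
Definition prec X Y Z (f : thom X Y) : {linear thom Y Z -> thom X Z} :=
  mk_linear (fun c g g' => tcompPl tT c g g' f).

Lemma comp0r X Y Z (g : thom Y Z) : g \c (0 : thom X Y) = 0.
Proof. exact: (linear0 (postc X g)). Qed.
Lemma comp0l X Y Z (f : thom X Y) : (0 : thom Y Z) \c f = 0.
Proof. exact: (linear0 (prec Z f)). Qed.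
Lemma compBr X Y Z (g : thom Y Z) (f f' : thom X Y) : g \c (f - f') = g \c f - g \c f'.
Proof. exact: (linearB (postc X g)). Qed.
Lemma compZr X Y Z c (g : thom Y Z) (f : thom X Y) : g \c (c *: f) = c *: (g \c f).
Proof. exact: (linearZ_LR (postc X g)). Qed.
Lemma compZl X Y Z c (g : thom Y Z) (f : thom X Y) : (c *: g) \c f = c *: (g \c f).
Proof. exact: (linearZ_LR (prec Z f)). Qed.
Lemma comp_sumr X Y Z (g : thom Y Z) (I : Type) (r : seq I) (P : pred I) (F : I -> thom X Y) :
  g \c (\sum_(i <- r | P i) F i) = \sum_(i <- r | P i) g \c F i.
Proof. exact: (linear_sum (postc X g)). Qed.
Lemma comp_suml X Y Z (f : thom X Y) (I : Type) (r : seq I) (P : pred I) (F : I -> thom Y Z) :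
  (\sum_(i <- r | P i) F i) \c f = \sum_(i <- r | P i) F i \c f.
Proof. exact: (linear_sum (prec Z f)). Qed.

Definition hom0 V W : Prop := forall f : thom V W, f = 0.
Definition hom1 V W : Prop :=
  exists2 f : thom V W, f <> 0 & forall g : thom V W, exists c, g = c *: f.

Lemma iso_sym X Y : isomorphic X Y -> isomorphic Y X.
Proof. by move=> [f [g [h1 h2]]]; exists g, f. Qed.
Lemma iso_trans X Y Z : isomorphic X Y -> isomorphic Y Z -> isomorphic X Z.
Proof.
move=> [f [f' [h1 h2]]] [g [g' [h3 h4]]]; exists (g \c f), (f' \c g'); split.
  by rewrite -(tcompA tT) (tcompA tT g') h3 (tcomp1l tT).
by rewrite -(tcompA tT) (tcompA tT f) h2 (tcomp1l tT).
Qed.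
Lemma tshiftK m X : isomorphic (tshift (- m) (tshift m X)) X.
Proof.
apply: (iso_trans (tshiftD tT m (- m) X)); rewrite subrr; exact: (tshift0 tT).
Qed.
Lemma tshiftNK m X : isomorphic (tshift m (tshift (- m) X)) X.
Proof.
apply: (iso_trans (tshiftD tT (- m) m X)); rewrite addNr; exact: (tshift0 tT).
Qed.

(** Injectivity is stated on the kernel, since phi is a linear map in every use. *)
Definition hom_bij V W V' W' (phi : thom V W -> thom V' W') : Prop :=
  (forall f, phi f = 0 -> f = 0) /\ (forall g, exists f, g = phi f).

Lemma hom_bij0 V W V' W' (phi : {linear thom V W -> thom V' W'}) :
  hom_bij phi -> hom0 V W <-> hom0 V' W'.
Proof.
move=> [hi hs]; split=> h f; last by apply: hi; apply: h.
by have [g ->] := hs f; rewrite (h g) linear0.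
Qed.
Lemma hom_bij1 V W V' W' (phi : {linear thom V W -> thom V' W'}) :
  hom_bij phi -> hom1 V W <-> hom1 V' W'.
Proof.
move=> [hi hs]; split=> [[f f0 hf]|[f f0 hf]].
  exists (phi f) => [/hi//|g]; have [g' ->] := hs g; have [c ->] := hf g'.
  by exists c; rewrite linearZ.
have [f' e] := hs f; exists f' => [h|g]; first by apply: f0; rewrite e h linear0.
have [c hc] := hf (phi g); exists c; apply/eqP; rewrite -subr_eq0; apply/eqP/hi.
by rewrite linearB linearZ /= hc e subrr.
Qed.

Lemma iso_pre V V' W : isomorphic V V' ->
  exists phi : {linear thom V' W -> thom V W}, hom_bij phi.
Proof.
move=> [f [g [h1 h2]]]; exists (prec W f); split=> [h /= e|h].
  by rewrite -[h](tcomp1r tT) -h2 (tcompA tT) e comp0l.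
by exists (h \c g); rewrite /= -(tcompA tT) h1 (tcomp1r tT).
Qed.
Lemma iso_post V W W' : isomorphic W W' ->
  exists phi : {linear thom V W -> thom V W'}, hom_bij phi.
Proof.
move=> [f [g [h1 h2]]]; exists (postc V f); split=> [h /= e|h].
  by rewrite -[h](tcomp1l tT) -h1 -(tcompA tT) e comp0r.
by exists (g \c h); rewrite /= (tcompA tT) h2 (tcomp1l tT).
Qed.
Lemma hom_bij_comp V W V' W' V'' W'' (phi : {linear thom V W -> thom V' W'})
    (psi : {linear thom V' W' -> thom V'' W''}) : hom_bij phi -> hom_bij psi ->
  hom_bij (psi \o phi).
Proof.
move=> [i1 s1] [i2 s2]; split=> [f /i2/i1//|g].
by have [f ->] := s2 g; have [f' ->] := s1 f; exists f'.
Qed.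

(** Apply the shift by -m and cancel V[m][-m]. *)
Lemma hom_shift m V W :
  exists phi : {linear thom (tshift m V) W -> thom V (tshift (- m) W)}, hom_bij phi.
Proof.
have [phi hphi] := iso_pre (tshift (- m) W) (iso_sym (tshiftK m V)).
exists (phi \o shm tT (- m) (tshift m V) W : {linear _ -> _}).
apply: (hom_bij_comp (psi := phi) _ hphi); split; last exact: shm_surj.
by move=> f e; apply: (@shm_inj _ _ tT (- m)); rewrite e linear0.
Qed.

Definition orth V W : Prop := forall m : int, hom0 V (tshift m W).
(** RHom(V, W) is k. *)
Definition ghom1 V W : Prop := hom1 V W /\ forall m : int, m != 0 -> hom0 V (tshift m W).

Lemma hom0_shift m V W : hom0 (tshift m V) W = hom0 V (tshift (- m) W).
Proof. by apply: propext; have [phi /hom_bij0] := hom_shift m V W. Qed.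
Lemma hom0_iso_r V W W' : isomorphic W W' -> hom0 V W = hom0 V W'.
Proof. by move=> e; apply: propext; move: e; move=> /(iso_post V)[phi /hom_bij0]. Qed.

Lemma orthE V W : orth V W -> hom0 V W.
Proof. by move=> /(_ 0); rewrite (hom0_iso_r V (tshift0 tT W)). Qed.
Lemma orth_shiftr l V W : orth V W -> orth V (tshift l W).
Proof. by move=> h m; rewrite (hom0_iso_r V (tshiftD tT l m W)). Qed.
Lemma orth_shiftl l V W : orth V W -> orth (tshift l V) W.
Proof.
move=> h m; rewrite hom0_shift (hom0_iso_r V (tshiftD tT m (- l) W)); exact: h.
Qed.
Lemma orth_homl V W : orth V W <-> forall m, hom0 (tshift m V) W.
Proof.
split=> h m; first by apply: orthE; apply: orth_shiftl.
by rewrite -[m]opprK -hom0_shift.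
Qed.

Lemma ghom1_homl V W :
  ghom1 V W <-> hom1 V W /\ forall m : int, m != 0 -> hom0 (tshift m V) W.
Proof.
split=> -[h1 h]; split => // m m0; first by rewrite hom0_shift; apply: h; rewrite oppr_eq0.
by rewrite -[m]opprK -hom0_shift; apply: h; rewrite oppr_eq0.
Qed.

Definition post_bij V W W' (u : thom W W') : Prop :=
  hom_bij (fun f : thom V W => u \c f).
Definition pre_bij V V' W (u : thom V V') : Prop :=
  hom_bij (fun f : thom V' W => f \c u).

(** Long exact sequence of Hom(V, -): an element of Hom(V[m], Z) comes from Y, because its
    image in X[1] is killed by u, and then from X, so it vanishes. *)
Lemma cone_orth V X Y Z u v w : @tdist k T X Y Z u v w ->
  (forall m, post_bij (tshift m V) u) -> orth V Z.
Proof.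
move=> d hu; apply/orth_homl => m h.
(* w h is the shift of a map a, and u a = 0 because u[1] w = 0. *)
have wh0 : w \c h = 0.
  have [f [f' [h1 h2]]] := tshiftNK 1 (tshift m V).
  have [a ha] := shm_surj tT (w \c h \c f).
  suff a0 : a = 0.
    have : w \c h \c f = 0 by rewrite ha a0 linear0.
    move=> /(congr1 (fun x => x \c f')); rewrite -!(tcompA tT) h2 comp0l (tcomp1r tT) //.
  have [psi [psi' [e1 e2]]] := tshiftD tT m (-1) V.
  have ua0 : u \c (a \c psi') = 0.
    rewrite (tcompA tT) [u \c a](_ : _ = 0) ?comp0l //.
    apply: (@shm_inj _ _ tT (1)); rewrite (shm_comp tT) -ha linear0.
    by rewrite !(tcompA tT) (dist_uw tT d) !comp0l.
  by have := (hu (m + -1)).1 _ ua0; move=> /(congr1 (fun x => x \c psi));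
    rewrite -(tcompA tT) e1 (tcomp1r tT) comp0l.
have [h' e] := dist_exact_Z tT d wh0.
have [g e'] := (hu m).2 h'.
by rewrite e e' (tcompA tT) (dist_vu tT d) comp0l.
Qed.

(** Long exact sequences of Hom(-, Z) = 0: u is surjective and, after a shift, injective
    on Hom(W, -) for all W. *)
Lemma iso_of_zero_cone X Y Z u v w : @tdist k T X Y Z u v w -> tid Z = 0 ->
  isomorphic X Y.
Proof.
move=> d Z0.
have zl W (f : thom W Z) : f = 0 by rewrite -[f](tcomp1l tT) Z0 comp0l.
have ui W (h : thom W X) : u \c h = 0 -> h = 0.
  move=> e; apply: (@shm_inj _ _ tT (1)); rewrite linear0.
  have : shm tT 1 X Y u \c shm tT 1 W X h = 0 by rewrite -(shm_comp tT) e linear0.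
  by move=> /(dist_exact_X1 d)[h' ->]; rewrite (zl _ h') comp0r.
have [g hg] : exists g, tid Y = u \c g by apply: (dist_exact_Y tT d); apply: zl.
exists u, g; split => //; apply/eqP; rewrite -subr_eq0; apply/eqP/ui.
by rewrite compBr (tcompA tT) -hg (tcomp1l tT) (tcomp1r tT) subrr.
Qed.

(** Right orthogonality to all X_i is thus inherited by the whole thick closure, which is
    how generation is used below. *)
Lemma thick_left_orth C : thick (fun V => orth V C).
Proof.
split=> [X m h|X Y Z u v w d hX hY m f|n X S [inj [prj [h1 _ _]]] hS i m f].
- exact: orth_shiftl.
- have e : f \c v = 0 by apply: hY.
  have [g ->] := dist_coexact_Z tT d e.
  by rewrite (orth_shiftl hX g) comp0l.
- by rewrite -[f](tcomp1r tT) -h1 (tcompA tT) (hS m (f \c prj i)) comp0l.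
Qed.

Lemma full_seq_orth n (X : 'I_n -> T) C : full_seq X -> (forall i, orth (X i) C) ->
  tid C = 0.
Proof.
move=> [S [inj [prj [_ _ e]]] hS] hX; apply: orthE.
apply: (hS (fun V => orth V C) (thick_left_orth C)) => m f.
rewrite -[f](tcomp1r tT) -e comp_sumr // big1 // => i _.
by rewrite (tcompA tT) (hX i m (f \c inj i)) comp0l.
Qed.

End Orthogonality.

Section Evaluation.
Variables (k : fieldType) (T : tricat k) (tT : hom_finite_triangulated T).
Implicit Types (X Y Z V W : T).

(** The identity for i = j and zero otherwise: with it, the matrix identities of a
    biproduct make sense without transport between equal indices. *)
Definition tdelta (I : eqType) (W : I -> T) (i j : I) : thom (W i) (W j) :=
  if i =P j is ReflectT e then eq_rect i (fun m => thom (W i) (W m)) (tid (W i)) j e else 0.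
Lemma tdelta_id (I : eqType) (W : I -> T) i : @tdelta I W i i = tid (W i).
Proof. by rewrite /tdelta; case: eqP => // e; rewrite eq_axiomK. Qed.
Lemma tdelta_neq (I : eqType) (W : I -> T) i j : i != j -> @tdelta I W i j = 0.
Proof. by rewrite /tdelta; case: eqP. Qed.

Lemma finite_biproduct (I : finType) (W : I -> T) :
  exists S (inj : forall i, thom (W i) S) (prj : forall i, thom S (W i)),
    [/\ forall i j, prj j \c inj i = tdelta W i j & \sum_i (inj i \c prj i) = tid S].
Proof.
suff H (s : seq I) : uniq s ->
  exists S (inj : forall i, thom (W i) S) (prj : forall i, thom S (W i)),
    [/\ forall i j, i \in s -> j \in s -> prj j \c inj i = tdelta W i j &
       \sum_(i <- s) (inj i \c prj i) = tid S].
  have [S [inj [prj [h1 h2]]]] := H _ (index_enum_uniq I).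
  by exists S, inj, prj; split=> // i j; apply: h1; rewrite mem_index_enum.
elim: s => [_|a s IH /= /andP[as_ us]].
  have [O hO] := zero_object tT; exists O, (fun=> 0), (fun=> 0).
  by split=> //; rewrite big_nil hO.
have [S [inj [prj [h1 h2]]]] := IH us.
have [S' [i1 [i2 [p1 [p2 [e11 e22 e12 e21 e]]]]]] := biproduct tT (W a) S.
exists S', (fun i => if i == a then i1 \c tdelta W i a else i2 \c inj i).
exists (fun i => if i == a then tdelta W a i \c p1 else prj i \c p2); split.
  move=> i j; rewrite !inE; case: (eqVneq i a) => [->|ia] /=;
    case: (eqVneq j a) => [->|ja] //= hi hj.
  - by rewrite !tdelta_id (tcomp1l tT) (tcomp1r tT).
  - rewrite -(tcompA tT) (tcompA tT p2) e21 (comp0l tT) (comp0r tT).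
    by rewrite tdelta_neq // eq_sym.
  - rewrite -(tcompA tT) (tcompA tT p1) e12 (comp0l tT) (comp0r tT).
    by rewrite tdelta_neq.
  - by rewrite -(tcompA tT) (tcompA tT p2) e22 (tcomp1l tT) h1.
rewrite big_cons eqxx !tdelta_id (tcomp1l tT) (tcomp1r tT) -e; congr (_ + _).
rewrite -[i2 in RHS](tcomp1r tT) -h2 (comp_sumr tT) (comp_suml tT) [LHS]big_seq [RHS]big_seq.
apply: eq_bigr => i his; have /negbTE -> : i != a by apply: contraNneq as_ => <-.
by rewrite !(tcompA tT).
Qed.

(** The identity of E is a finite sum of maps through the X[l]; hence E is orthogonal to
    whatever the shifts of X are orthogonal to. *)
Definition finite_evaluation X Y (E : T)
    (iota : forall l : int, {linear thom (tshift l X) Y -> thom (tshift l X) E}) : Prop :=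
  exists (I : finType) (l : I -> int) (b : forall t, thom (tshift (l t) X) Y)
    (p : forall t, thom E (tshift (l t) X)),
    \sum_t iota (l t) (b t) \c p t = tid E.

(** Only the degrees between -N and N contribute, and in each of them a basis of
    Hom(X[l], Y) expresses the tensor product as a power of X[l]. *)
Lemma evaluation_exists X Y :
  exists E iota ev, @is_evaluation k T X Y E iota ev /\ finite_evaluation iota.
Proof.
have [N hN] := hom_bounded tT X Y.
pose ls (s : 'I_(2 * N).+1) : int := s%:Z - N%:Z.
have ls_inj : injective ls by move=> s s'; rewrite /ls => h; apply: ord_inj; lia.
have ls_surj (l : int) : (`|l| <= N)%N -> exists s, ls s = l.
  move=> hl; have h : (`|(l + N%:Z)%R| < (2 * N).+1)%N by lia.
  by exists (Ordinal h); rewrite /ls /=; lia.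
pose Wl l := tshift l X.
have /choice[d hd] := fun s => hom_findim tT (Wl (ls s)) Y.
have /dependent_choice_fun[f hf] : forall s, exists f : {linear 'rV[k]_(d s) -> thom (Wl (ls s)) Y},
    injective f /\ forall x, exists u, x = f u.
  by move=> s; have [f fI h] := hd s; exists f; split => // x; apply/h.
have /dependent_choice_fun[g hg] : forall s, exists g : {linear thom (Wl (ls s)) Y -> 'rV[k]_(d s)},
    forall x, f s (g x) = x.
  move=> s; have /choice[g hg] := (hf s).2.
  have gl : linear g by move=> c y z; apply: (hf s).1; rewrite linearP -!hg.
  by exists (mk_linear gl) => x; rewrite /= -hg.
pose I := {s : 'I_(2 * N).+1 & 'I_(d s)}.
pose l (t : I) := ls (tag t).
pose b (t : I) : thom (Wl (l t)) Y := f (tag t) (delta_mx 0 (tagged t)).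
have [E [inj [prj [h1 h2]]]] := finite_biproduct (fun t : I => Wl (l t)).
(* For h in degree l0 only the summands of that degree contribute. *)
pose io l0 (h : thom (Wl l0) Y) : thom (Wl l0) E :=
  \sum_(t : I) (g (tag t) (h \c tdelta Wl (l t) l0)) 0 (tagged t) *: (inj t \c tdelta Wl l0 (l t)).
have io_lin l0 : linear (@io l0).
  move=> c x y; rewrite /io scaler_sumr -big_split /=; apply: eq_bigr => t _.
  by rewrite (tcompPl tT) linearP !mxE scalerDl scalerA.
pose iota l0 := mk_linear (io_lin l0).
have ioE s h : io (ls s) h =
    \sum_(i < d s) (g s h) 0 i *: (inj (Tagged (fun s => 'I_(d s)) i) : thom (Wl (ls s)) E).
  pose F s0 (i : 'I_(d s0)) : thom (Wl (ls s)) E := (g s0 (h \c tdelta Wl (ls s0) (ls s))) 0 i *: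
    ((inj (Tagged (fun s => 'I_(d s)) i) : thom (Wl (ls s0)) E) \c tdelta Wl (ls s) (ls s0)).
  have -> : io (ls s) h = \sum_s0 \sum_i F s0 i by rewrite sig_big_dep; apply: eq_bigr => -[].
  rewrite /F (bigD1 s) //= [X in _ + X]big1 ?addr0 => [|s' ss'].
    by apply: eq_bigr => i _ /=; rewrite tdelta_id !(tcomp1r tT).
  rewrite big1 // => i _; rewrite (@tdelta_neq _ Wl (ls s) (ls s')) ?(comp0r tT) ?scaler0 //.
  by rewrite (inj_eq ls_inj) eq_sym.
have iob t : io (l t) (b t) = inj t.
  rewrite ioE /b; case: t => s i /=.
  have -> : g s (f s (delta_mx 0 i)) = delta_mx 0 i by apply: (hf s).1; rewrite hg.
  rewrite (bigD1 i) //= mxE !eqxx scale1r big1 ?addr0 // => j ji.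
  by rewrite mxE eqxx (negbTE ji) scale0r.
pose ext Z (phi : forall l0, {linear thom (Wl l0) Y -> thom (Wl l0) Z}) : thom E Z :=
  \sum_(t : I) phi (l t) (b t) \c prj t.
have ext_inj Z phi t : ext Z phi \c inj t = phi (l t) (b t).
  rewrite /ext (comp_suml tT) (bigD1 t) //= -(tcompA tT) h1 tdelta_id (tcomp1r tT).
  rewrite big1 ?addr0 // => t' tt'; rewrite -(tcompA tT) h1 tdelta_neq 1?eq_sym //.
  by rewrite (comp0r tT).
have extE Z phi l0 h : ext Z phi \c io l0 h = phi l0 h.
  have [hl|hl] := leqP `|l0| N; last first.
    by rewrite (hN _ hl h) -[io l0 0]/(iota l0 0) !linear0 (comp0r tT).
  have [s hs] := ls_surj _ hl; rewrite -hs in h *.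
  rewrite ioE (comp_sumr tT) -[in RHS](hg s h) [in RHS]linear_lincomb lincombE linear_sum.
  apply: eq_bigr => i _; rewrite (compZr tT) linearZ; congr (_ *: _).
  exact: (ext_inj Z phi (Tagged (fun s => 'I_(d s)) i)).
pose ev : thom E Y := ext Y (fun=> idfun).
exists E, iota, ev; split; last first.
  by exists I, l, b, prj; rewrite -h2; apply: eq_bigr => t _; rewrite /= iob.
split=> [Z phi|l0 h]; last by rewrite extE.
exists (ext Z phi); split=> [l0|g' hg']; first exact: extE.
rewrite -[g'](tcomp1r tT) -h2 (comp_sumr tT); apply: eq_bigr => t _.
by rewrite (tcompA tT) -iob (hg' (l t)).
Qed.

(** The universal property determines E up to isomorphism, so the decomposition of the
    constructed evaluation object can be carried over to any other. *)
Lemma evaluation_finite X Y E iota ev :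
  @is_evaluation k T X Y E iota ev -> finite_evaluation iota.
Proof.
move=> [hU hE]; have [E0 [iota0 [ev0 [[hU0 hE0] [I [l [b [p hp]]]]]]]] := evaluation_exists X Y.
have [g [hg _]] := hU E0 iota0; have [g0 [hg0 _]] := hU0 E iota.
exists I, l, b, (fun t => p t \c g).
have <- : g0 \c g = tid E.
  have [e [_ he]] := hU E iota.
  rewrite -(he (tid E)) => [|l' h]; last by rewrite (tcomp1l tT).
  by apply/esym/he => l' h; rewrite -(tcompA tT) hg hg0.
rewrite -[g0](tcomp1r tT) -hp (comp_sumr tT) (comp_suml tT).
by apply: eq_bigr => t _; rewrite !(tcompA tT) hg0.
Qed.

Section OneEvaluation.
Variables (X Y E : T) (iota : forall l : int, {linear thom (tshift l X) Y -> thom (tshift l X) E}).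
Variables (ev : thom E Y) (hev : @is_evaluation k T X Y E iota ev).

Lemma evaluation_orthl V : orth V X -> orth V E.
Proof.
move=> hV; apply/(orth_homl tT) => m f; have [I [l [b [p hp]]]] := evaluation_finite hev.
rewrite -[f](tcomp1l tT) -hp (comp_suml tT) big1 // => t _.
have /(orth_homl tT)/(_ m) h : orth V (tshift (l t) X) by exact: orth_shiftr.
by rewrite -(tcompA tT) (h (p t \c f)) (comp0r tT).
Qed.

Lemma evaluation_orthr V : orth X V -> orth E V.
Proof.
move=> hV m f; have [g [hg hg']] := hev.1 (tshift m V) (fun=> \0).
rewrite -(hg' f) ?(hg' 0) // => l h; first by rewrite (comp0l tT).
by apply: orthE => //; apply: orth_shiftl => //; apply: orth_shiftr.
Qed.

(** Since Hom(X[m], X[l]) is k for l = m and zero otherwise, every map X[m] -> E comes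
   from the summand Hom(X[m], Y) (x) X[m] *)
Lemma evaluation_bij m : ghom1 X X -> post_bij (tshift m X) ev.
Proof.
move=> [[f0 f00 hf0] hX].
have id_span (f : thom X X) : exists c, f = c *: tid X.
  have [c0 e0] := hf0 (tid X); have [c ec] := hf0 f.
  exists (c / c0); rewrite e0 scalerA divfK //; apply/eqP => c00; apply: f00.
  by rewrite -[f0](tcomp1r tT) e0 c00 scale0r (comp0r tT).
suff H (f : thom (tshift m X) E) : exists h, f = iota m h.
  split=> [f|g]; last by exists (iota m g); rewrite hev.2.
  by have [h ->] := H f; rewrite hev.2 => ->; rewrite linear0.
have [I [l [b [p hp]]]] := evaluation_finite hev.
have /dependent_choice_fun[h hh] : forall t, exists h, iota (l t) (b t) \c (p t \c f) = iota m h.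
  move=> t; case: (eqVneq (l t) m) (b t) (p t) => [->|lm] bt pt.
    have [a ha] := shm_surj tT (pt \c f); have [c ec] := id_span a.
    by exists (c *: bt); rewrite ha ec linearZ (shm_id tT) (compZr tT) (tcomp1r tT) linearZ.
  exists 0; rewrite linear0 (_ : pt \c f = 0) ?(comp0r tT) //.
  have h : hom0 (tshift m X) (tshift (l t) X).
    rewrite (hom0_shift tT) (hom0_iso_r tT _ (tshiftD tT (l t) (- m) X)).
    by apply: hX; rewrite subr_eq0.
  exact: (h (pt \c f)).
exists (\sum_t h t); rewrite linear_sum -[f in LHS](tcomp1l tT) -hp (comp_suml tT).
by apply: eq_bigr => t _; rewrite -(tcompA tT).
Qed.

End OneEvaluation.

Lemma left_mutationP X Y : is_left_mutation X Y (left_mutation X Y).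
Proof.
rewrite /left_mutation; case: pselect => [e|[]]; first exact: (projT2 (cid e)).
have [E [iota [ev [h _]]]] := evaluation_exists X Y.
by have [L [v [w d]]] := cone_exists tT ev; exists L, E, iota, ev; split=> //; exists v, w.
Qed.

(** The properties of mutation: the triangle E -> Y -> L_X Y has its first term in the
    span of the X[l], so Y and L_X Y look the same to all objects orthogonal to X. *)
Lemma left_mutation_map X Y : exists v : thom Y (left_mutation X Y),
  [/\ ghom1 X X -> orth X (left_mutation X Y),
      forall V, orth V X -> orth V Y -> orth V (left_mutation X Y),
      forall V, orth V X -> post_bij V v &
      forall V, orth X V -> pre_bij V v].
Proof.
have [E [iota [ev [h [v [w d]]]]]] := left_mutationP X Y; exists v; split.
- by move=> hX; apply: (cone_orth tT d) => m; apply: evaluation_bij h m hX.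
- move=> V hVX hVY; apply: (cone_orth tT d) => m.
  have /(orth_homl tT) hE := evaluation_orthl h hVX.
  by move/(orth_homl tT): hVY => hY; split=> [f _|g]; [apply: hE|exists 0; rewrite (comp0r tT) (hY m g)].
- move=> V hV; have hE := evaluation_orthl h hV; split=> [f e|g].
    by have [f' ->] := dist_exact_Y tT d e; rewrite (orthE tT hE f') (comp0r tT).
  by apply: (dist_exact_Z tT d); apply: (hE 1).
- move=> V hV; have hE := evaluation_orthr h hV; split=> [f e|g].
    have [f' ->] := dist_coexact_Z tT d e.
    by rewrite (orthE tT (orth_shiftl tT hE) f') (comp0l tT).
  by apply: (dist_coexact_Y tT d); apply: (orthE tT hE).
Qed.

End Evaluation.

(** * Left dual sequences and the Serre functor *)

Section DualSequence.
Variables (k : fieldType) (T : tricat k) (tT : hom_finite_triangulated T).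
Implicit Types (Y Z V W C : T).

(** An exceptional sequence whose endomorphism algebras are all k. *)
Definition scalar_exceptional_seq n (X : 'I_n -> T) : Prop :=
  (forall i, ghom1 (X i) (X i)) /\ forall i j : 'I_n, (j < i)%N -> orth (X i) (X j).

(** The order of the sequence matters for the first property: mutating further through X_a
    keeps the orthogonality to X_m already achieved only because X_m is orthogonal to X_a. *)
Lemma iterated_mutation_map n (X : 'I_n -> T) (s : seq 'I_n) Z : scalar_exceptional_seq X ->
  pairwise (fun i j : 'I_n => (i < j)%N) s ->
  exists v : thom Z (foldr (@left_mutation k T) Z [seq X m | m <- s]),
  [/\ forall m, m \in s -> orth (X m) (foldr (@left_mutation k T) Z [seq X m | m <- s]),
      forall V, (forall m, m \in s -> orth V (X m)) -> post_bij V v &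
      forall V, (forall m, m \in s -> orth (X m) V) -> pre_bij V v].
Proof.
move=> [hX1 hX2]; elim: s => [_|a s IH /= /andP[/allP as_ /IH[v [v1 v2 v3]]]].
  exists (tid Z); split=> // V _; split=> [f|f].
  - by rewrite (tcomp1l tT).
  - by exists f; rewrite (tcomp1l tT).
  - by rewrite (tcomp1r tT).
  - by exists f; rewrite (tcomp1r tT).
set L := foldr _ _ _ in v v1 v2 v3 *.
have [w [w1 w2 w3 w4]] := left_mutation_map tT (X a) L.
exists (w \c v); split=> [m|V hV|V hV].
- rewrite inE => /predU1P[->|ms]; first exact: w1.
  by apply: w2; [apply/hX2/as_|apply: v1].
- have /w3[i1 s1] : orth V (X a) by apply: hV; rewrite mem_head.
  have /v2[i2 s2] : forall m, m \in s -> orth V (X m).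
    by move=> m ms; apply: hV; rewrite inE ms orbT.
  split=> [f|f]; first by rewrite -(tcompA tT) => /i1/i2.
  by have [g ->] := s1 f; have [h ->] := s2 g; exists h; rewrite (tcompA tT).
- have /w4[i1 s1] : orth (X a) V by apply: hV; rewrite mem_head.
  have /v3[i2 s2] : forall m, m \in s -> orth (X m) V.
    by move=> m ms; apply: hV; rewrite inE ms orbT.
  split=> [f|f]; first by rewrite (tcompA tT) => /i2/i1.
  by have [g ->] := s2 f; have [h ->] := s1 g; exists h; rewrite (tcompA tT).
Qed.

Lemma rev_ord_lt n (i j : 'I_n) : (rev_ord i < rev_ord j)%N = (j < i)%N.
Proof. by rewrite /=; have := ltn_ord i; have := ltn_ord j; lia. Qed.

Section Dual.
Variables (n : nat) (X : 'I_n -> T) (hX : scalar_exceptional_seq X).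

Lemma left_dual_map j : exists v : thom (X (rev_ord j)) (left_dual X j),
  [/\ forall m : 'I_n, (m < rev_ord j)%N -> orth (X m) (left_dual X j),
      forall V, (forall m : 'I_n, (m < rev_ord j)%N -> orth V (X m)) -> post_bij V v &
      forall V, (forall m : 'I_n, (m < rev_ord j)%N -> orth (X m) V) -> pre_bij V v].
Proof.
pose s := [seq m : 'I_n <- enum 'I_n | (m < rev_ord j)%N].
have es m : (m \in s) = (m < rev_ord j)%N by rewrite mem_filter mem_enum andbT.
have ps : pairwise (fun i j : 'I_n => (i < j)%N) s.
  apply: pairwise_filter; rewrite -(pairwise_map (val : 'I_n -> nat) ltn) val_enum_ord.
  rewrite -sorted_pairwise; first exact: iota_ltn_sorted.
  exact: ltn_trans.
have [v [h1 h2 h3]] := iterated_mutation_map (X (rev_ord j)) hX ps.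
exists v; split=> [m hm|V hV|V hV].
- by apply: h1; rewrite es.
- by apply: h2 => m; rewrite es; apply: hV.
- by apply: h3 => m; rewrite es; apply: hV.
Qed.

(** For i before the starting term this is the effect of mutation; for i after it, mutation
    does not change Hom from X_i, which vanishes by exceptionality. *)
Lemma left_dual_orth i j : i != rev_ord j -> orth (X i) (left_dual X j).
Proof.
have [v [h1 h2 h3]] := left_dual_map j.
case: (ltngtP i (rev_ord j)) => [hij _|hij _|/val_inj -> /eqP//]; first exact: h1.
apply/(orth_homl tT) => m.
have hb : post_bij (tshift m (X i)) v.
  by apply: h2 => l hl; apply: (orth_shiftl tT); apply: hX.2; exact: ltn_trans hij.
rewrite /post_bij -[fun f => _]/(postc tT (tshift m (X i)) v : _ -> _) in hb.
move=> f; have [g ->] := hb.2 f.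
have /(orth_homl tT)/(_ m) h : orth (X i) (X (rev_ord j)) by apply: hX.2.
by rewrite (h g) linear0.
Qed.

(** Mutation through earlier terms does not change Hom from X_(rev_ord j), so this is
    graded End of that object. *)
Lemma left_dual_ghom1 j : ghom1 (X (rev_ord j)) (left_dual X j).
Proof.
have [v [h1 h2 h3]] := left_dual_map j.
have hb m : hom_bij (postc tT (tshift m (X (rev_ord j))) v).
  by apply: h2 => l hl; apply: (orth_shiftl tT); apply: hX.2.
have hb0 : hom_bij (postc tT (X (rev_ord j)) v) by apply: h2 => l hl; apply: hX.2.
have /(ghom1_homl tT)[e1 e2] := hX.1 (rev_ord j).
apply/(ghom1_homl tT); split; first by apply/(hom_bij1 hb0).
by move=> m m0; apply/(hom_bij0 (hb m)); apply: e2.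
Qed.

(** Maps from a term of the dual to another are maps from its starting term, which the two
    preceding lemmas compute. *)
Lemma left_dual_scalar_exceptional : scalar_exceptional_seq (left_dual X).
Proof.
split=> [j|j' j jj'].
  have [v [h1 h2 h3]] := left_dual_map j.
  have hb m : hom_bij (prec tT (tshift m (left_dual X j)) v).
    by apply: h3 => l hl; apply: (orth_shiftr tT); apply: h1.
  have hb0 : hom_bij (prec tT (left_dual X j) v) by apply: h3.
  have [e1 e2] := left_dual_ghom1 j.
  by split; [apply/(hom_bij1 hb0)|move=> m m0; apply/(hom_bij0 (hb m)); apply: e2].
have [v [h1 h2 h3]] := left_dual_map j'.
have lt : (rev_ord j' < rev_ord j)%N by rewrite rev_ord_lt.
move=> m.
have hb : hom_bij (prec tT (tshift m (left_dual X j)) v).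
  apply: h3 => l hl; apply: (orth_shiftr tT); apply: left_dual_orth.
  by apply/eqP => e; move: (ltn_trans hl lt); rewrite e ltnn.
by apply/(hom_bij0 hb); apply: left_dual_orth; apply/eqP => e; move: lt; rewrite e ltnn.
Qed.

(** By induction on i: X_i and the corresponding dual term differ by a cone built from
    earlier X_l. *)
Lemma left_dual_generates C :
  (forall j, orth (left_dual X j) C) -> forall i, orth (X i) C.
Proof.
move=> hC i; have [r] := ubnP (nat_of_ord i); elim: r i => // r IH i ir m.
have [v [h1 h2 h3]] := left_dual_map (rev_ord i); rewrite rev_ordK in v h1 h2 h3.
have hb : hom_bij (prec tT (tshift m C) v).
  apply: h3 => l hl; apply: (orth_shiftr tT); apply: IH.
  exact: leq_trans hl ir.
by apply/(hom_bij0 hb); apply: hC.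
Qed.

End Dual.

Section Serre.
Variable S : serre_functor T.

(** The functionals on Hom(W, S V) are all zero, and functionals separate points. *)
Lemma serre_hom0 V W : hom0 V W -> hom0 W (S V).
Proof.
move=> h g; apply: contrapT => g0; have [n dn] := hom_findim tT W (S V).
have [phi hphi] := separating_functional dn g0.
have [f hf] := serre_dual_surj phi; apply: hphi; rewrite -hf (h f).
have := serre_dual_linear (s := S) (-1) f f g.
by rewrite scaleN1r addNr (h f) mulN1r addNr.
Qed.

Lemma serre_hom1 V W : hom1 V W -> hom1 W (S V).
Proof.
move=> [f f0 hf].
have dual0 g : serre_dual S (0 : thom V W) g = 0.
  have := serre_dual_linear (s := S) (-1) f f g.
  by rewrite scaleN1r addNr mulN1r addNr.
have inj (g : thom W (S V)) : serre_dual S f g = 0 -> g = 0.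
  move=> e; apply: contrapT => g0; have [n dn] := hom_findim tT W (S V).
  have [phi hphi] := separating_functional dn g0.
  have [f' hf'] := serre_dual_surj phi; apply: hphi; rewrite -hf'.
  have [c ->] := hf f'; rewrite -[c *: f]addr0 serre_dual_linear e.
  by rewrite mulr0 dual0 addr0.
have [g hg] : exists g, serre_dual S f g <> 0.
  apply: contrapT => h; apply: f0; apply: (serre_dual_inj (s := S)) => g.
  by rewrite dual0; apply: contrapT => h'; apply: h; exists g.
exists g => [e|g']; first by apply: hg; rewrite e linear0.
exists (serre_dual S f g' / serre_dual S f g); apply/eqP; rewrite -subr_eq0; apply/eqP/inj.
by rewrite linearB linearZ /= -[_ *: _]/(_ * _) divfK ?subrr //; apply/eqP.
Qed.

Lemma serre_orth V W : orth V W -> orth W (S V).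
Proof. by move=> h; apply/(orth_homl tT) => m; apply: serre_hom0. Qed.
Lemma serre_ghom1 V W : ghom1 V W -> ghom1 W (S V).
Proof.
move=> [h1 h2]; apply/(ghom1_homl tT); split=> [|m m0]; first exact: serre_hom1.
by apply: serre_hom0; apply: h2.
Qed.

(** Both objects have graded Hom from the terms Y_m of the first dual equal to k in
    degree 0 for one m and zero for the others; a comparison map has a cone orthogonal
    to the generators Y_m. *)
Theorem serre_left_dual2 n (X : 'I_n -> T) : full_seq X -> scalar_exceptional_seq X ->
  forall i, isomorphic (S (X i)) (left_dual (left_dual X) i).
Proof.
move=> fX hX i; have hY := left_dual_scalar_exceptional hX; set Y := left_dual X in hY *.
set W := S (X i); set Z := left_dual Y i.
have YW m : m != rev_ord i -> orth (Y m) W.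
  move=> mi; apply: serre_orth; apply: left_dual_orth => //.
  by apply: contraNneq mi => ->; rewrite rev_ordK.
have YiW : ghom1 (Y (rev_ord i)) W.
  by apply: serre_ghom1; have := left_dual_ghom1 hX (rev_ord i); rewrite rev_ordK.
have [v [h1 h2 h3]] := left_dual_map hY i.
have YZ m : m != rev_ord i -> orth (Y m) Z by exact: left_dual_orth.
have YiZ : ghom1 (Y (rev_ord i)) Z by exact: left_dual_ghom1.
have [[phi phi0 hphi] YiW0] := YiW.
(* Z is obtained from Y_i by mutations through objects that are left orthogonal to W. *)
have [psi hpsi] : exists psi, phi = psi \c v.
  apply: (h3 W _).2 => m mi; apply: YW.
  by apply/eqP => e; move: mi; rewrite e ltnn.
have [C [a [b d]]] := cone_exists tT psi.
apply: (iso_sym (iso_of_zero_cone tT d _)).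
apply: (full_seq_orth tT fX); apply: (left_dual_generates hX) => m.
apply: (cone_orth tT d) => l; have [->|mi] := eqVneq m (rev_ord i); last first.
  have /(orth_homl tT)/(_ l) z1 := YZ m mi; have /(orth_homl tT)/(_ l) z2 := YW m mi.
  by split=> [f _|g]; [apply: z1|exists 0; rewrite (z2 g) (comp0r tT)].
have /(ghom1_homl tT)[[e e0 he] YZl] := YiZ; have /(ghom1_homl tT)[_ YWl] := YiW.
have [->|l0] := eqVneq l 0; last first.
  by split=> [f _|g]; [apply: YZl|exists 0; rewrite (YWl l l0 g) (comp0r tT)].
have [p [q [pq qp]]] := tshift0 tT (Y (rev_ord i)).
(* In degree 0 both sides are lines, and psi is nonzero on a generator. *)
have pe : psi \c e <> 0.
  move=> pe0; apply: phi0; have [c ec] := he v.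
  by rewrite hpsi ec (compZr tT) pe0 scaler0.
split=> [f f0|g].
  have [c ec] := he (f \c q).
  have : f \c q \c p = 0.
    rewrite ec; suff -> : c = 0 by rewrite scale0r (comp0l tT).
    apply/eqP/negPn/negP => c0; apply: pe; rewrite -(scalerK c0 (psi \c e)).
    by rewrite -(compZr tT) -ec (tcompA tT) f0 (comp0l tT) scaler0.
  by rewrite -(tcompA tT) pq (tcomp1r tT).
have [c ec] := hphi (g \c q); have [c' ec'] := hphi (psi \c e).
have c'0 : c' != 0 by apply/eqP => h; apply: pe; rewrite ec' h scale0r.
exists ((c / c') *: (e \c p)).
rewrite (compZr tT) (tcompA tT) ec' (compZl tT) scalerA divfK // -(compZl tT) -ec.
by rewrite -(tcompA tT) pq (tcomp1r tT).
Qed.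

End Serre.
End DualSequence.

(** * The homotopy category: composition and shift *)

Section Complexes.
Variables (k : fieldType) (A : algType k).
Implicit Types X Y Z W : bcomplex A.

Lemma sgnscaleE n (M : lmodType A) (x : M) : ((-1) ^+ n : k)%:A *: x = (-1) ^+ n *: x.
Proof.
congr (_ *: _); rewrite -signr_odd -[in RHS]signr_odd; case: (odd n).
  by rewrite !expr1 scaleN1r.
by rewrite !expr0 scale1r.
Qed.

Lemma dif_shiftE m X i j (x : cshift m X i) :
  dif (cshift m X) i j x = (-1) ^+ `|m|%N *: dif X (i + m) (j + m) x.
Proof. by rewrite /= /kscale_fun sgnscaleE. Qed.

Lemma gcast_dif X a a' b b' x : a = a' -> b = b' ->
  gcast X b b' (dif X a b x) = dif X a' b' (gcast X a a' x).
Proof. by move=> <- <-; rewrite !gcast_id. Qed.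
Lemma gcast_chain X Y (f : chain X Y) a b x : gcast Y a b (f a x) = f b (gcast X a b x).
Proof.
case: (eqVneq a b) => [<-|/eqP n]; first by rewrite !gcast_id.
by rewrite !gcast_neq // linear0.
Qed.
Lemma gcast_comp (C : int -> lmodType A) a b c x : a = b ->
  gcast C b c (gcast C a b x) = gcast C a c x.
Proof. by move=> <-; rewrite gcast_id. Qed.

(** Every degree is of the form j + 1; at degree j + 1 the homotopy formula only involves
   the indices j, j + 1 and j + 1 + 1, and no transport between equal degrees. *)
Lemma nullhomotopicP X Y (f : chain X Y) : nullhomotopic f <->
  exists s : forall i j, {linear X i -> Y j}, forall j x,
    f (j + 1) x = dif Y j (j + 1) (s (j + 1) j x)
      + s (j + 1 + 1) (j + 1) (dif X (j + 1) (j + 1 + 1) x).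
Proof.
have e (s : forall i j, {linear X i -> Y j}) (j : int) :
  (forall x, f (j + 1) x = dif Y j (j + 1) (s (j + 1) j x)
      + s (j + 1 + 1) (j + 1) (dif X (j + 1) (j + 1 + 1) x)) <->
  (forall x, f (j + 1) x = dif Y (j + 1 - 1) (j + 1) (s (j + 1) (j + 1 - 1) x)
      + s (j + 1 + 1) (j + 1) (dif X (j + 1) (j + 1 + 1) x)).
  by rewrite addrK.
split=> -[s hs]; exists s; first by move=> j; apply/(e s) => x; apply: hs.
by move=> i; rewrite -[i](subrK 1); apply/(e s) => x; apply: hs.

Qed.

(** Counterpart of [nullhomotopicP] for the construction of chain maps. *)
Lemma chain_of_succ X Y (t : forall j, {linear X (j + 1) -> Y (j + 1)}) :
  (forall j x, t (j + 1) (dif X (j + 1) (j + 1 + 1) x) = dif Y (j + 1) (j + 1 + 1) (t j x)) ->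
  exists h : chain X Y, forall j, h (j + 1) =1 t j.
Proof.
move=> ht.
have [g hg] : exists g : forall i, {linear X i -> Y i}, forall j, g (j + 1) =1 t j.
  have /dependent_choice_fun[g hg] : forall i, exists g : {linear X i -> Y i},
      forall j (e : j + 1 = i) x, g (gcast X (j + 1) i x) = gcast Y (j + 1) i (t j x).
    move=> i; rewrite -[i](subrK 1); exists (t (i - 1)) => j e x.
    by have ej : j = i - 1 by [apply: (addIr 1); rewrite e]; subst j; rewrite !gcast_id.
  exists g => j x; have := hg _ j erefl x; by rewrite !gcast_id.
have comm i j x : g j (dif X i j x) = dif Y i j (g i x).
  case: (eqVneq j (i + 1)) => [->|n]; last by rewrite !dif_shape // linear0.
  by move: x; rewrite -[i](subrK 1) => x; rewrite !hg.
by exists (Chain comm).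
Qed.

Lemma chainE (X Y : bcomplex A) (f g : chain X Y) i (x : X i) : (f - g) i x = f i x - g i x.
Proof. by []. Qed.

Lemma kclassP X Y (q : khom X Y) : exists f, q = kclass f.
Proof. by exists (krepr q); rewrite kreprK. Qed.
Lemma kclass0 X Y : kclass (0 : chain X Y) = 0.
Proof. by apply: (addrI (kclass 0)); rewrite -kclassD !addr0. Qed.
Lemma kclass_eq0 X Y (f : chain X Y) : kclass f = 0 <-> nullhomotopic f.
Proof. by rewrite -kclass0 kclass_eq subr0. Qed.
Lemma kclassZ' X Y c (f : chain X Y) : kclass (c *: f) = c *: kclass f.
Proof. exact: kclassZ. Qed.
Lemma kclass_linear X Y : linear (@kclass k A X Y).
Proof. by move=> c f g; rewrite kclassD kclassZ'. Qed.
Definition kclassl X Y : {linear chain X Y -> khom X Y} := mk_linear (@kclass_linear X Y).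

Lemma kcompA X Y Z W (h : khom Z W) (g : khom Y Z) (f : khom X Y) :
  kcomp h (kcomp g f) = kcomp (kcomp h g) f.
Proof.
have [f' ->] := kclassP f; have [g' ->] := kclassP g; have [h' ->] := kclassP h.
by rewrite !kcompE; congr kclass; apply: chain_ext.
Qed.
Lemma kcomp1l X Y (f : khom X Y) : kcomp (kclass (chain_id Y)) f = f.
Proof.
by have [f' ->] := kclassP f; rewrite kcompE; congr kclass; apply: chain_ext.
Qed.
Lemma kcomp1r X Y (f : khom X Y) : kcomp f (kclass (chain_id X)) = f.
Proof.
by have [f' ->] := kclassP f; rewrite kcompE; congr kclass; apply: chain_ext.
Qed.
Lemma kcompPl X Y Z c (g g' : khom Y Z) (f : khom X Y) :
  kcomp (c *: g + g') f = c *: kcomp g f + kcomp g' f.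
Proof.
have [f' ->] := kclassP f; have [h ->] := kclassP g; have [h' ->] := kclassP g'.
by rewrite -kclass_linear !kcompE -kclass_linear; congr kclass; apply: chain_ext.
Qed.
Lemma kcompPr X Y Z c (g : khom Y Z) (f f' : khom X Y) :
  kcomp g (c *: f + f') = c *: kcomp g f + kcomp g f'.
Proof.
have [g' ->] := kclassP g; have [h ->] := kclassP f; have [h' ->] := kclassP f'.
rewrite -kclass_linear !kcompE -kclass_linear; congr kclass; apply: chain_ext => i x.
by rewrite /= /kscale_fun linearD linearZ.
Qed.

Lemma nullhomotopic_shift m X Y (f : chain X Y) :
  nullhomotopic f -> nullhomotopic (chain_shift m f).
Proof.
move=> [s hs]; exists (fun i j => kscale ((-1) ^+ `|m|%N) (s (i + m) (j + m))) => i x.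
rewrite !dif_shiftE /= /kscale_fun !sgnscaleE !linearZ_LR /= !scalerA.
have -> : (-1) ^+ `|m|%N * (-1) ^+ `|m|%N = 1 :> A by rewrite -expr2 sqrr_sign.
by rewrite !scale1r hs (addrAC i m (-1)) (addrAC i m 1).
Qed.

Lemma chain_shift_linear m X Y : linear (@chain_shift k A m X Y).
Proof. by move=> c f g; apply: chain_ext. Qed.

Definition kshift_fun m X Y (q : khom X Y) : khom (cshift m X) (cshift m Y) :=
  kclass (chain_shift m (krepr q)).
Lemma kshiftE m X Y (f : chain X Y) : kshift_fun m (kclass f) = kclass (chain_shift m f).
Proof.
apply/kclass_eq; rewrite -scaleN1r addrC -chain_shift_linear.
apply: nullhomotopic_shift; rewrite scaleN1r addrC.
by apply/kclass_eq; rewrite kreprK.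
Qed.
Lemma kshift_is_linear m X Y : linear (@kshift_fun m X Y).
Proof.
move=> c f g; have [f' ->] := kclassP f; have [g' ->] := kclassP g.
by rewrite -kclass_linear !kshiftE chain_shift_linear kclass_linear.
Qed.
Definition kshift m X Y : {linear khom X Y -> khom (cshift m X) (cshift m Y)} :=
  mk_linear (@kshift_is_linear m X Y).

Lemma kshift_id m X : kshift m X X (kclass (chain_id X)) = kclass (chain_id (cshift m X)).
Proof. by rewrite /= kshiftE; congr kclass; apply: chain_ext. Qed.
Lemma kshift_comp m X Y Z (g : khom Y Z) (f : khom X Y) :
  kshift m X Z (kcomp g f) = kcomp (kshift m Y Z g) (kshift m X Y f).
Proof.
have [f' ->] := kclassP f; have [g' ->] := kclassP g.
by rewrite /= kcompE !kshiftE kcompE; congr kclass; apply: chain_ext.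
Qed.

Lemma sign_absz (m l : int) : (-1) ^+ `|(m + l)%R|%N = (-1) ^+ `|m|%N * (-1) ^+ `|l|%N :> A.
Proof. by rewrite -exprD -signr_odd -[RHS]signr_odd; congr (_ ^+ _); congr nat_of_bool; lia. Qed.

Lemma shiftD_index (m l i : int) : i + l + m = i + (m + l).
Proof. by rewrite -addrA (addrC l). Qed.

Lemma dif_shift2E (m l : int) X i j (x : cshift l (cshift m X) i) :
  dif (cshift l (cshift m X)) i j x =
    (-1) ^+ `|l|%N *: ((-1) ^+ `|m|%N *: dif X (i + l + m) (j + l + m) x).
Proof. by rewrite dif_shiftE; congr (_ *: _); rewrite dif_shiftE. Qed.

Program Definition shiftD_fwd m l X : chain (cshift l (cshift m X)) (cshift (m + l) X) :=
  @Chain k A (cshift l (cshift m X)) (cshift (m + l) X)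
    (fun i => gcast X (i + l + m) (i + (m + l))) _.
Next Obligation.
move=> m l X i j x; rewrite dif_shift2E dif_shiftE.
rewrite !linearZ_LR /= (gcast_dif _ (shiftD_index _ _ _) (shiftD_index _ _ _)) scalerA.
by rewrite sign_absz -!exprD addnC.
Qed.
Program Definition shiftD_bwd m l X : chain (cshift (m + l) X) (cshift l (cshift m X)) :=
  @Chain k A (cshift (m + l) X) (cshift l (cshift m X))
    (fun i => gcast X (i + (m + l)) (i + l + m)) _.
Next Obligation.
move=> m l X i j x; rewrite dif_shift2E dif_shiftE.
rewrite !linearZ_LR /= (gcast_dif _ (esym (shiftD_index _ _ _)) (esym (shiftD_index _ _ _))) scalerA.
by rewrite sign_absz -!exprD addnC.
Qed.

Lemma strict_iso X Y (f : chain X Y) (g : chain Y X) :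
  (forall i x, g i (f i x) = x) -> (forall i x, f i (g i x) = x) ->
  isomorphic (X : Kb A) Y.
Proof.
move=> h1 h2; exists (kclass f), (kclass g); rewrite /= !kcompE.
by split; congr kclass; apply: chain_ext.
Qed.

Lemma kb_shiftD m l X : isomorphic (cshift l (cshift m X) : Kb A) (cshift (m + l) X).
Proof.
apply: (@strict_iso _ _ (shiftD_fwd m l X) (shiftD_bwd m l X)) => i x /=.
  by rewrite gcast_comp ?gcast_id ?shiftD_index.
by rewrite gcast_comp ?gcast_id ?shiftD_index.
Qed.

Program Definition shift0_fwd X : chain (cshift 0 X) X :=
  @Chain k A (cshift 0 X) X (fun i => gcast X (i + 0) i) _.
Next Obligation.
by move=> X i j x; rewrite dif_shiftE expr0 scale1r (gcast_dif _ (addr0 i) (addr0 j)).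
Qed.
Program Definition shift0_bwd X : chain X (cshift 0 X) :=
  @Chain k A X (cshift 0 X) (fun i => gcast X i (i + 0)) _.
Next Obligation.
move=> X i j x; rewrite dif_shiftE expr0 scale1r.
by rewrite (gcast_dif _ (esym (addr0 i)) (esym (addr0 j))).
Qed.
Lemma kb_shift0 X : isomorphic (cshift 0 X : Kb A) X.
Proof.
apply: (@strict_iso _ _ (shift0_fwd X) (shift0_bwd X)) => i x /=.
  by rewrite gcast_comp ?gcast_id ?addr0.
by rewrite gcast_comp ?gcast_id ?addr0.
Qed.

End Complexes.

Section Complexes.
Variables (k : fieldType) (A : algType k).
Implicit Types X Y Z W : bcomplex A.

Lemma kcomp0r X Y Z (g : khom Y Z) : kcomp g (0 : khom X Y) = 0.
Proof. by have := kcompPr (-1) g 0 (0 : khom X Y); rewrite scaleN1r !addNr scaleN1r addNr. Qed.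
Lemma kcomp0l X Y Z (f : khom X Y) : kcomp (0 : khom Y Z) f = 0.
Proof. by have := kcompPl (-1) 0 (0 : khom Y Z) f; rewrite scaleN1r !addNr scaleN1r addNr. Qed.

Section ShiftCancel.
Variables (m l : int) (eml : m + l = 0).

Lemma shiftK_index (i : int) : i + l + m = i.
Proof. by rewrite shiftD_index eml addr0. Qed.

Lemma sign_shiftK : (-1) ^+ `|l|%N * (-1) ^+ `|m|%N = 1 :> A.
Proof. by rewrite -sign_absz addrC eml expr0. Qed.

Program Definition shiftK_fwd X : chain (cshift l (cshift m X)) X :=
  @Chain k A (cshift l (cshift m X)) X (fun i => gcast X (i + l + m) i) _.
Next Obligation.
move=> X i j x; rewrite dif_shift2E !linearZ_LR /= scalerA sign_shiftK scale1r.
by rewrite (gcast_dif _ (shiftK_index _) (shiftK_index _)).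
Qed.
Program Definition shiftK_bwd X : chain X (cshift l (cshift m X)) :=
  @Chain k A X (cshift l (cshift m X)) (fun i => gcast X i (i + l + m)) _.
Next Obligation.
move=> X i j x; rewrite dif_shift2E scalerA sign_shiftK scale1r.
by rewrite (gcast_dif _ (esym (shiftK_index _)) (esym (shiftK_index _))).
Qed.

Lemma shiftK_fwdK X :
  kcomp (kclass (shiftK_bwd X)) (kclass (shiftK_fwd X)) = kclass (chain_id _).
Proof.
rewrite kcompE; congr kclass; apply: chain_ext => i x /=.
by rewrite gcast_comp ?gcast_id ?shiftK_index.
Qed.
Lemma shiftK_bwdK X :
  kcomp (kclass (shiftK_fwd X)) (kclass (shiftK_bwd X)) = kclass (chain_id _).
Proof.
rewrite kcompE; congr kclass; apply: chain_ext => i x /=.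
by rewrite gcast_comp ?gcast_id ?shiftK_index.
Qed.

Lemma shiftK_natural X Y (f : khom X Y) :
  kcomp f (kclass (shiftK_fwd X)) =
  kcomp (kclass (shiftK_fwd Y)) (kshift l _ _ (kshift m _ _ f)).
Proof.
have [f' ->] := kclassP f; rewrite /= !kshiftE !kcompE; congr kclass.
by apply: chain_ext => i x /=; rewrite gcast_chain.
Qed.

Lemma kshift_injK X Y : injective (kshift m X Y).
Proof.
move=> f g e.
suff : kcomp (f - g) (kclass (shiftK_fwd X)) = 0.
  move=> /(congr1 (fun h => kcomp h (kclass (shiftK_bwd X)))).
  rewrite -kcompA shiftK_bwdK kcomp1r kcomp0l => h.
  by apply/eqP; rewrite -subr_eq0 h.
by rewrite shiftK_natural linearB e subrr linear0 kcomp0r.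
Qed.
End ShiftCancel.

Lemma kshift_inj m X Y : injective (kshift m X Y).
Proof. exact: (kshift_injK (subrr m)). Qed.

(** The preimage is the shift back of g, conjugated by the cancellation isomorphisms; its
    shift is g because shifting it once more gives the shift of g. *)
Lemma kshift_surj m X Y (g : khom (cshift m X) (cshift m Y)) :
  exists f, g = kshift m X Y f.
Proof.
have e := subrr m.
pose f := kcomp (kclass (shiftK_fwd e Y)) (kcomp (kshift (- m) _ _ g) (kclass (shiftK_bwd e X))).
exists f; apply: (@kshift_inj (- m)).
have := shiftK_natural e f.
rewrite {1}/f -!kcompA shiftK_fwdK kcomp1r.
move=> /(congr1 (fun h => kcomp (kclass (shiftK_bwd e Y)) h)).
by rewrite !kcompA !shiftK_fwdK !kcomp1l.
Qed.

(** * Zero object, biproducts and cones *)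
Program Definition zero_complex : bcomplex A :=
  @BComplex k A (fun _ => 'rV[A]_0) (fun i j => \0) _ _ _ _ _.
Next Obligation. by []. Qed.
Next Obligation. by []. Qed.
Next Obligation. by exists 0%N => i _ x; apply/rowP => -[]. Qed.
Next Obligation.
by move=> i; exists 0%N, (fun=> 0) => x; exists (fun=> 0); rewrite big_ord0; apply/rowP => -[].
Qed.
Next Obligation.
move=> i M N p f _; exists \0 => x.
by rewrite (_ : x = 0) ?linear0 //; apply/rowP => -[].
Qed.

Section Sum.
Variables X Y : bcomplex A.
Definition csum_dif_fun i j (z : (X i * Y i)%type) : (X j * Y j)%type :=
  (dif X i j z.1, dif Y i j z.2).
Lemma csum_dif_linear i j : linear (@csum_dif_fun i j).
Proof. by move=> a u v; congr (_, _); rewrite /= linearP. Qed.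
Program Definition csum : bcomplex A :=
  @BComplex k A (fun i => (X i * Y i)%type) (fun i j => mk_linear (@csum_dif_linear i j))
    _ _ _ _ _.
Next Obligation. by move=> i j [x y] h /=; congr (_, _); rewrite /= dif_shape. Qed.
Next Obligation. by move=> i j l [x y] /=; congr (_, _); rewrite /= dif_dif. Qed.
Next Obligation.
have [b hb] := cob_bounded X; have [c hc] := cob_bounded Y.
by exists (b + c)%N => i hi [x y]; congr (_, _); [apply: hb|apply: hc]; lia.
Qed.
Next Obligation. by move=> i; apply: fg_pair; apply: cob_fg. Qed.
Next Obligation. by move=> i; apply: projective_pair; apply: cob_proj. Qed.

Lemma pair0l_linear (U V : lmodType A) : linear (fun y : V => (0, y) : (U * V)%type).
Proof. by move=> a u v; congr (_, _); rewrite /= scaler0 addr0. Qed.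
Lemma pair0r_linear (U V : lmodType A) : linear (fun x : U => (x, 0) : (U * V)%type).
Proof. by move=> a u v; congr (_, _); rewrite /= scaler0 addr0. Qed.

Program Definition csum_in1 : chain X csum :=
  @Chain k A X csum (fun i => mk_linear (@pair0r_linear (X i) (Y i))) _.
Next Obligation. by move=> i j x /=; congr (_, _); rewrite /= linear0. Qed.
Program Definition csum_in2 : chain Y csum :=
  @Chain k A Y csum (fun i => mk_linear (@pair0l_linear (X i) (Y i))) _.
Next Obligation. by move=> i j x /=; congr (_, _); rewrite /= linear0. Qed.
Program Definition csum_pr1 : chain csum X := @Chain k A csum X (fun i => fst) _.
Next Obligation. by []. Qed.
Program Definition csum_pr2 : chain csum Y := @Chain k A csum Y (fun i => snd) _.
Next Obligation. by []. Qed.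
End Sum.

Lemma kb_biproduct (X Y : Kb A) : exists (S : Kb A) (i1 : thom X S) (i2 : thom Y S)
      (p1 : thom S X) (p2 : thom S Y),
    [/\ p1 \c i1 = tid X, p2 \c i2 = tid Y, p1 \c i2 = 0, p2 \c i1 = 0 &
        i1 \c p1 + i2 \c p2 = tid S].
Proof.
exists (csum X Y), (kclass (csum_in1 X Y)), (kclass (csum_in2 X Y)),
  (kclass (csum_pr1 X Y)), (kclass (csum_pr2 X Y)).
rewrite /= !kcompE -!kclass0 -kclassD.
split; congr kclass; apply: chain_ext => i //= x.
by case: x => x y; congr (_, _); rewrite /= ?addr0 ?add0r.
Qed.

Lemma kb_zero : exists O : Kb A, tid O = 0.
Proof.
exists zero_complex; rewrite /= -kclass0; congr kclass.
by apply: chain_ext => i x; apply/rowP => -[].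
Qed.

Lemma kb_cone X Y (u : khom X Y) : exists (Z : bcomplex A) v w, @kdist k A X Y Z u v w.
Proof.
have [f ->] := kclassP u.
exists (cone f), (kclass (cone_inj f)), (kclass (cone_prj f)).
exists X, Y, f, (chain_id X), (chain_id X), (kclass (chain_id Y)), (kclass (chain_id Y)),
  (kclass (chain_id (cone f))), (kclass (chain_id (cone f))).
have e : chain_shift 1 (chain_id X) = chain_id (cshift 1 X) by apply: chain_ext.
by rewrite e !kcomp1l !kcomp1r.
Qed.

End Complexes.

(** * Exactness of the triangles of the homotopy category *)

(** Stated for variables: in the goals where they are used, rewriting with associativity or
    commutativity would also reach the integer degrees, on which types depend. *)
Section ZmodIdentities.
Variables (V : zmodType) (a b c d : V).
Lemma zmod_eqN : 0 = - a + b -> b = a.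
Proof. by move/esym/eqP; rewrite addrC subr_eq0 => /eqP. Qed.
Lemma zmod_addKr : a + b + c - a = b + c.
Proof. by rewrite addrC -addrA addKr. Qed.
Lemma zmod_subKl : - a + b + c - b = c - a.
Proof. by rewrite addrAC addrK addrC. Qed.
Lemma zmod_subKC : a + (b - a) = b.
Proof. by rewrite addrC subrK. Qed.
Lemma zmod_addNKC : - a + b + a = b.
Proof. by rewrite addrAC addNr add0r. Qed.
Lemma zmod_addKm : a + (b + c) - b = a + c.
Proof. by rewrite -addrA [b + c - b]addrAC subrr add0r. Qed.
Lemma zmod_homotopy : a + (b + c) - (a - d) = b + (d + c).
Proof. by rewrite opprB addrC addrA subrK addrCA. Qed.
End ZmodIdentities.

Section Triangles.
Variables (k : fieldType) (A : algType k).
Implicit Types X Y Z W : bcomplex A.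

(** The exactness properties of a triangle, gathered because they are invariant under
    isomorphism of triangles and easy to check for mapping cones. *)
Record exact_triangle X Y Z (u : khom X Y) (v : khom Y Z) (w : khom Z (cshift 1 X)) : Prop :=
  ExactTriangle {
  et_vu : kcomp v u = 0;
  et_uw : kcomp (kshift 1 X Y u) w = 0;
  et_Y : forall W (h : khom W Y), kcomp v h = 0 -> exists h', h = kcomp u h';
  et_Z : forall W (h : khom W Z), kcomp w h = 0 -> exists h', h = kcomp v h';
  et_X1 : forall W (h : khom W (cshift 1 X)), kcomp (kshift 1 X Y u) h = 0 ->
    exists h', h = kcomp w h';
  et_coY : forall W (h : khom Y W), kcomp h u = 0 -> exists h', h = kcomp h' v;
  et_coZ : forall W (h : khom Z W), kcomp h v = 0 -> exists h', h = kcomp h' w }.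

Section Cone.
Variables (X Y : bcomplex A) (f : chain X Y).
Notation C := (cone f).

Lemma dif_coneE i j (z : C i) : dif C i j z =
  (- dif X (i + 1) (j + 1) z.1, gcast Y (i + 1) j (f (i + 1) z.1) + dif Y i j z.2).
Proof. by []. Qed.
Lemma dif_coneS j (z : C j) : dif C j (j + 1) z =
  (- dif X (j + 1) (j + 1 + 1) z.1, f (j + 1) z.1 + dif Y j (j + 1) z.2).
Proof. by rewrite dif_coneE gcast_id. Qed.
Lemma dif_shift1 Z i j (x : Z (i + 1)) : dif (cshift 1 Z) i j x = - dif Z (i + 1) (j + 1) x.
Proof. by rewrite dif_shiftE expr1 scaleN1r. Qed.

(** The homotopy is the inclusion of X as the shifted component of the cone. *)
Lemma cone_inj_f : kcomp (kclass (cone_inj f)) (kclass f) = 0.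
Proof.
rewrite kcompE; apply/kclass_eq0/nullhomotopicP.
have l i j : linear (fun x : X i => (gcast X i (j + 1) x, 0) : C j).
  by move=> a u v; congr (_, _); rewrite /= ?linearP // scaler0 addr0.
exists (fun i j => mk_linear (@l i j)) => j x.
rewrite dif_coneS /= !gcast_id linear0 addr0.
by congr (_, _); rewrite /= ?addNr ?addr0.
Qed.

(** The homotopy is the projection of the cone to Y. *)
Lemma f_cone_prj : kcomp (kshift 1 X Y (kclass f)) (kclass (cone_prj f)) = 0.
Proof.
rewrite /= kshiftE kcompE; apply/kclass_eq0/nullhomotopicP.
exists (fun i j => gcast Y i (j + 1) \o snd : {linear C i -> cshift 1 Y j}) => j x.
rewrite dif_shift1 dif_coneS /= !gcast_id.
by rewrite addrCA addNr addr0.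
Qed.

(** A homotopy to zero has a component in X, which is a chain map, and a component in Y,
    which is a homotopy. *)
Lemma cone_exact_Y W (h : khom W Y) : kcomp (kclass (cone_inj f)) h = 0 ->
  exists h', h = kcomp (kclass f) h'.
Proof.
have [g ->] := kclassP h; rewrite kcompE => /kclass_eq0/nullhomotopicP[s hs].
have hs1 j x : (s (j + 1 + 1) (j + 1) (dif W (j + 1) (j + 1 + 1) x)).1
    = dif X (j + 1) (j + 1 + 1) (s (j + 1) j x).1.
  by have := congr1 fst (hs j x); rewrite dif_coneS /= => /zmod_eqN.
have hs2 j x : g (j + 1) x = f (j + 1) (s (j + 1) j x).1 +
    dif Y j (j + 1) (s (j + 1) j x).2 + (s (j + 1 + 1) (j + 1) (dif W (j + 1) (j + 1 + 1) x)).2.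
  by have := congr1 snd (hs j x); rewrite dif_coneS.
have [h' hh'] := @chain_of_succ k A W X
  (fun j => fst \o s (j + 1) j : {linear _ -> _}) hs1.
exists (kclass h'); rewrite kcompE; apply/kclass_eq/nullhomotopicP.
exists (fun i j => snd \o s i j : {linear W i -> Y j}) => j x.
by rewrite chainE /= hh' hs2 /= zmod_addKr.
Qed.

(** The homotopy corrects the X-component of h to zero; the remaining Y-component is the
    chain map sought. *)
Lemma cone_exact_Z W (h : khom W C) : kcomp (kclass (cone_prj f)) h = 0 ->
  exists h', h = kcomp (kclass (cone_inj f)) h'.
Proof.
have [g ->] := kclassP h; rewrite kcompE => /kclass_eq0/nullhomotopicP[s hs].
have hs1 j x : (g (j + 1) x).1 = - dif X (j + 1) (j + 1 + 1) (s (j + 1) j x) +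
    s (j + 1 + 1) (j + 1) (dif W (j + 1) (j + 1 + 1) x).
  by have := hs j x; rewrite dif_shift1.
have gl j : linear (fun x => (g (j + 1) x).2 - f (j + 1) (s (j + 1) j x)).
  by move=> a u v; rewrite !linearP /= addrACA -scalerDr.
have [h' hh'] : exists h' : chain W Y, forall j, h' (j + 1) =1 mk_linear (gl j).
  apply: chain_of_succ => j x /=.
  rewrite (cmap_comm g) dif_coneS /= hs1 !linearD !linearN /=.
  by rewrite (cmap_comm f) zmod_subKl.
have l i j : linear (fun x : W i => (s i j x, 0) : C j).
  by move=> a u v; congr (_, _); rewrite /= ?linearP // scaler0 addr0.
exists (kclass h'); rewrite kcompE; apply/kclass_eq/nullhomotopicP.
exists (fun i j => mk_linear (@l i j)) => j x.
rewrite chainE dif_coneS /= hh' /= linear0 addr0.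
rewrite [LHS]surjective_pairing; congr (_, _) => /=.
  by rewrite subr0 hs1.
by rewrite opprB [RHS]addr0 zmod_subKC.
Qed.

(** The homotopy supplies the missing Y-component of a lift to the cone. *)
Lemma cone_exact_X1 W (h : khom W (cshift 1 X)) :
  kcomp (kshift 1 X Y (kclass f)) h = 0 -> exists h', h = kcomp (kclass (cone_prj f)) h'.
Proof.
have [g ->] := kclassP h; rewrite /= kshiftE kcompE => /kclass_eq0/nullhomotopicP[s hs].
have hs1 j x : f (j + 1 + 1) (g (j + 1) x) = - dif Y (j + 1) (j + 1 + 1) (s (j + 1) j x) +
    s (j + 1 + 1) (j + 1) (dif W (j + 1) (j + 1 + 1) x).
  by have := hs j x; rewrite dif_shift1.
have l j : linear (fun x : W (j + 1) => (g (j + 1) x, s (j + 1) j x) : C (j + 1)).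
  by move=> a u v; congr (_, _); rewrite /= linearP.
have [h' hh'] : exists h' : chain W C, forall j, h' (j + 1) =1 mk_linear (l j).
  apply: chain_of_succ => j x; rewrite dif_coneS /=; congr (_, _).
    by rewrite (cmap_comm g) dif_shift1.
  by rewrite hs1 zmod_addNKC.
exists (kclass h'); rewrite kcompE; congr kclass; apply: chain_ext => i.
by rewrite -[i](subrK 1) => x /=; rewrite hh'.
Qed.

(** The homotopy is the missing X-component of an extension to the cone. *)
Lemma cone_coexact_Y W (h : khom Y W) : kcomp h (kclass f) = 0 ->
  exists h', h = kcomp h' (kclass (cone_inj f)).
Proof.
have [g ->] := kclassP h; rewrite kcompE => /kclass_eq0/nullhomotopicP[s hs].
have l j : linear (fun z : C j => s (j + 1) j z.1 + g j z.2 : W j).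
  by move=> a u v; rewrite !linearP /= scalerDr addrACA.
have comm i j x : mk_linear (l j) (dif C i j x) = dif W i j (mk_linear (l i) x).
  case: (eqVneq j (i + 1)) => [->|n]; last by rewrite !dif_shape // linear0.
  rewrite dif_coneS /= !linearD !linearN /= (cmap_comm g) addrA; congr (_ + _).
  by rewrite -[g _ (f _ _)]/((chain_comp g f) (i + 1) x.1) hs addrCA addNr addr0.
exists (kclass (Chain comm)); rewrite kcompE; congr kclass; apply: chain_ext => i x /=.
by rewrite linear0 add0r.
Qed.

(** The homotopy corrects h to zero on Y, so that it factors through the projection. *)
Lemma cone_coexact_Z W (h : khom C W) : kcomp h (kclass (cone_inj f)) = 0 ->
  exists h', h = kcomp h' (kclass (cone_prj f)).
Proof.
have [g ->] := kclassP h; rewrite kcompE => /kclass_eq0/nullhomotopicP[s hs].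
have hs1 j y : g (j + 1) (0, y) = dif W j (j + 1) (s (j + 1) j y) +
  s (j + 1 + 1) (j + 1) (dif Y (j + 1) (j + 1 + 1) y) by exact: hs.
have gD j x y : g j (x, y) = g j (x, 0) + g j (0, y).
  by rewrite -linearD; congr (g j _); congr (_, _); rewrite /= ?addr0 ?add0r.
have l i : linear (fun x : cshift 1 X i => g i (x, 0) - s (i + 1) i (f (i + 1) x) : W i).
  move=> a u v; have -> : (a *: u + v, 0) = a *: ((u, 0) : C i) + (v, 0) :> C i.
    by congr (_, _); rewrite /= scaler0 addr0.
  by rewrite !linearP /= addrACA -scalerDr.
have comm i j x : mk_linear (l j) (dif (cshift 1 X) i j x) = dif W i j (mk_linear (l i) x).
  case: (eqVneq j (i + 1)) => [->|n]; last by rewrite !dif_shape // linear0.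
  rewrite dif_shift1 linearB /= -(cmap_comm g) dif_coneS /= linear0 addr0 [in RHS]gD hs1 !linearN /=.
  by rewrite -(cmap_comm f) opprK zmod_addKm.
exists (kclass (Chain comm)); rewrite kcompE; apply/kclass_eq/nullhomotopicP.
exists (fun i j => s i j \o snd : {linear C i -> W j}) => j [x y].
rewrite chainE dif_coneS /= gD hs1 [s _ _ (_ + _)]linearD.
by rewrite zmod_homotopy.
Qed.

Lemma cone_exact_triangle :
  exact_triangle (kclass f) (kclass (cone_inj f)) (kclass (cone_prj f)).
Proof.
split; [exact: cone_inj_f|exact: f_cone_prj|exact: cone_exact_Y|exact: cone_exact_Z
  |exact: cone_exact_X1|exact: cone_coexact_Y|exact: cone_coexact_Z].
Qed.

End Cone.

Lemma exact_triangle_iso X Y Z X' Y' Z' u v w u' v' w'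
    (a : khom X X') (a' : khom X' X) (b : khom Y Y') (b' : khom Y' Y)
    (c : khom Z Z') (c' : khom Z' Z) :
  kcomp a' a = kclass (chain_id X) -> kcomp a a' = kclass (chain_id X') ->
  kcomp b' b = kclass (chain_id Y) -> kcomp b b' = kclass (chain_id Y') ->
  kcomp c' c = kclass (chain_id Z) -> kcomp c c' = kclass (chain_id Z') ->
  kcomp b u = kcomp u' a -> kcomp c v = kcomp v' b ->
  kcomp (kshift 1 _ _ a) w = kcomp w' c ->
  exact_triangle u' v' w' -> @exact_triangle X Y Z u v w.
Proof.
move=> a'a aa' b'b bb' c'c cc' bu cv aw [e1 e2 e3 e4 e5 e6 e7].
have Sa'a : kcomp (kshift 1 _ _ a') (kshift 1 _ _ a) = kclass (chain_id _).
  by rewrite -kshift_comp a'a kshift_id.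
have Saa' : kcomp (kshift 1 _ _ a) (kshift 1 _ _ a') = kclass (chain_id _).
  by rewrite -kshift_comp aa' kshift_id.
have Sb'b : kcomp (kshift 1 _ _ b') (kshift 1 _ _ b) = kclass (chain_id _).
  by rewrite -kshift_comp b'b kshift_id.
have bu' : u = kcomp b' (kcomp u' a) by rewrite -bu kcompA b'b kcomp1l.
have cv' : v = kcomp c' (kcomp v' b) by rewrite -cv kcompA c'c kcomp1l.
have aw' : w = kcomp (kshift 1 _ _ a') (kcomp w' c) by rewrite -aw kcompA Sa'a kcomp1l.
have ua' : kcomp u a' = kcomp b' u' by rewrite bu' -!kcompA aa' kcomp1r.
have vb' : kcomp v b' = kcomp c' v' by rewrite cv' -!kcompA bb' kcomp1r.
have wc' : kcomp w c' = kcomp (kshift 1 _ _ a') w' by rewrite aw' -!kcompA cc' kcomp1r.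
have Sbu : kcomp (kshift 1 _ _ b) (kshift 1 _ _ u) = kcomp (kshift 1 _ _ u') (kshift 1 _ _ a).
  by rewrite -!kshift_comp bu.
have Sub : kshift 1 _ _ u = kcomp (kshift 1 _ _ b') (kcomp (kshift 1 _ _ u') (kshift 1 _ _ a)).
  by rewrite -Sbu kcompA Sb'b kcomp1l.
split.
- by rewrite cv' -!kcompA bu (kcompA v') e1 kcomp0l kcomp0r.
- by rewrite Sub -!kcompA aw (kcompA _ w') e2 kcomp0l kcomp0r.
- move=> W h vh; have [h' eh] : exists h', kcomp b h = kcomp u' h'.
    by apply: e3; rewrite kcompA -cv -kcompA vh kcomp0r.
  by exists (kcomp a' h'); rewrite kcompA ua' -kcompA -eh kcompA b'b kcomp1l.
- move=> W h wh; have [h' eh] : exists h', kcomp c h = kcomp v' h'.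
    by apply: e4; rewrite kcompA -aw -kcompA wh kcomp0r.
  by exists (kcomp b' h'); rewrite kcompA vb' -kcompA -eh kcompA c'c kcomp1l.
- move=> W h uh; have [h' eh] : exists h', kcomp (kshift 1 _ _ a) h = kcomp w' h'.
    by apply: e5; rewrite kcompA -Sbu -kcompA uh kcomp0r.
  by exists (kcomp c' h'); rewrite kcompA wc' -kcompA -eh kcompA Sa'a kcomp1l.
- move=> W h hu; have [h' eh] : exists h', kcomp h b' = kcomp h' v'.
    by apply: e6; rewrite -kcompA -ua' kcompA hu kcomp0l.
  by exists (kcomp h' c); rewrite -kcompA cv kcompA -eh -kcompA b'b kcomp1r.
- move=> W h hv; have [h' eh] : exists h', kcomp h c' = kcomp h' w'.
    by apply: e7; rewrite -kcompA -vb' kcompA hv kcomp0l.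
  by exists (kcomp h' (kshift 1 _ _ a)); rewrite -kcompA aw kcompA -eh -kcompA c'c kcomp1r.
Qed.

Lemma kdist_exact X Y Z u v w : @kdist k A X Y Z u v w -> exact_triangle u v w.
Proof.
move=> [X' [Y' [f [a [a' [b [b' [c [c' [[h1 h2] [h3 h4] [h5 h6] [h7 h8 h9]]]]]]]]]]].
apply: (exact_triangle_iso h1 h2 h3 h4 h5 h6 h7 h8 _ (cone_exact_triangle f)).
by rewrite /= kshiftE.
Qed.

End Triangles.

(** * Families of linear maps *)

Section MoreDimension.
Variable k : fieldType.
Implicit Types V W : lmodType k.

Lemma embed_has_dim V W (f : {linear V -> W}) (P : V -> Prop) N : subspace P ->
  (forall x, P x -> f x = 0 -> x = 0) -> has_dim (fun _ : W => True) N ->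
  exists n, has_dim P n.
Proof.
move=> sP fI dW; apply: (bounded_has_dim (N := N) sP) => r h hI hP.
apply: (free_le_dim (f := f \o h : {linear _ -> _}) _ _ dW) => // u v /= e.
apply/eqP; rewrite -subr_eq0; apply/eqP/hI; rewrite linear0; apply: fI => //.
by rewrite !linearB /= e subrr.
Qed.

Lemma has_dim_rV n : has_dim (fun _ : 'rV[k]_n => True) n.
Proof. by exists idfun => // x; split=> // _; exists x. Qed.

Lemma finite_span V (I : finType) (F : I -> V) :
  (forall x, exists c : I -> k, x = \sum_i c i *: F i) ->
  exists n, has_dim (fun _ : V => True) n.
Proof.
move=> h; pose f := lincomb (fun t : 'I_#|I| => F (enum_val t)).
have [a [b [_ db _]]] := rank_nullity f (has_dim_rV #|I|).
exists b; apply: has_dim_ext db => x; split=> // _; have [c ->] := h x.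
exists (\row_t c (enum_val t)) => //; rewrite lincombE.
under [RHS]eq_bigr do rewrite mxE.
by rewrite (big_enum_val (A := I) (fun i => c i *: F i)).
Qed.
End MoreDimension.

Section Families.
Variables (k : fieldType) (A : algType k).

(** M as a k-space. A synonym, so that it can carry its own module structure. *)
Definition restr (M : lmodType A) : Type := M.
HB.instance Definition _ M := GRing.Zmodule.on (restr M).
Definition restr_scale (M : lmodType A) (c : k) (x : restr M) : restr M := c%:A *: (x : M).
Lemma restr_scaleA M a b (x : restr M) : restr_scale a (restr_scale b x) = restr_scale (a * b) x.
Proof. by rewrite /restr_scale scalerA mulr_algl scalerA. Qed.
Lemma restr_scale1 M : left_id 1 (@restr_scale M).
Proof. by move=> x; rewrite /restr_scale !scale1r. Qed.
Lemma restr_scaleDr M : right_distributive (@restr_scale M) +%R.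
Proof. by move=> c x y; rewrite /restr_scale scalerDr. Qed.
Lemma restr_scaleDl M (x : restr M) : {morph (@restr_scale M)^~ x : a b / a + b}.
Proof. by move=> a b; rewrite /restr_scale !scalerDl. Qed.
HB.instance Definition _ M := GRing.Zmodule_isLmodule.Build k (restr M)
  (@restr_scaleA M) (@restr_scale1 M) (@restr_scaleDr M) (@restr_scaleDl M).
Lemma restrZ (M : lmodType A) c (x : restr M) : c *: x = c%:A *: (x : M).
Proof. by []. Qed.

Section LFam.
Variables (I : Type) (U V : I -> lmodType A).
(** A family of maps indexed by I serves at once for Hom of two modules (I = unit) and for
    the terms of the graded endomorphism complex (I = int). *)
Record lfam := LFam { lf :> forall i, {linear U i -> V i} }.
Lemma lfam_ext (f g : lfam) : (forall i x, f i x = g i x) -> f = g.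
Proof.
case: f g => [f] [g] h; congr LFam; apply: functional_extensionality_dep => i.
by apply: linear_ext => x; apply: h.
Qed.
HB.instance Definition _ := gen_eqMixin lfam.
HB.instance Definition _ := gen_choiceMixin lfam.
Definition lfam_zero := LFam (fun i => \0).
Definition lfam_opp (f : lfam) := LFam (fun i => \- f i).
Definition lfam_add (f g : lfam) := LFam (fun i => f i \+ g i).
Definition lfam_scale (c : k) (f : lfam) := LFam (fun i => kscale c (f i)).
Lemma lfam_addA : associative lfam_add.
Proof. by move=> f g h; apply: lfam_ext => i x /=; rewrite addrA. Qed.
Lemma lfam_addC : commutative lfam_add.
Proof. by move=> f g; apply: lfam_ext => i x /=; rewrite addrC. Qed.
Lemma lfam_add0 : left_id lfam_zero lfam_add.
Proof. by move=> f; apply: lfam_ext => i x /=; rewrite add0r. Qed.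
Lemma lfam_addN : left_inverse lfam_zero lfam_opp lfam_add.
Proof. by move=> f; apply: lfam_ext => i x /=; rewrite addNr. Qed.
HB.instance Definition _ := GRing.isZmodule.Build lfam lfam_addA lfam_addC lfam_add0 lfam_addN.
Lemma lfam_scaleA a b (f : lfam) : lfam_scale a (lfam_scale b f) = lfam_scale (a * b) f.
Proof.
apply: lfam_ext => i x; rewrite /= /kscale_fun /= scalerA.
by rewrite mulr_algl scalerA.
Qed.
Lemma lfam_scale1 : left_id 1 lfam_scale.
Proof. by move=> f; apply: lfam_ext => i x; rewrite /= /kscale_fun !scale1r. Qed.
Lemma lfam_scaleDr : right_distributive lfam_scale +%R.
Proof. by move=> c f g; apply: lfam_ext => i x; rewrite /= /kscale_fun -scalerDr. Qed.
Lemma lfam_scaleDl (f : lfam) : {morph lfam_scale^~ f : a b / a + b}.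
Proof. by move=> a b; apply: lfam_ext => i x; rewrite /= /kscale_fun !scalerDl. Qed.
HB.instance Definition _ := GRing.Zmodule_isLmodule.Build k lfam
  lfam_scaleA lfam_scale1 lfam_scaleDr lfam_scaleDl.

Lemma lfamE (c : k) (f g : lfam) i x : (c *: f + g) i x = c%:A *: f i x + g i x.
Proof. by []. Qed.
Lemma lfamB (f g : lfam) i x : (f - g) i x = f i x - g i x.
Proof. by []. Qed.
End LFam.

Definition lhom (P M : lmodType A) := @lfam unit (fun _ => P) (fun _ => M).
Definition to_lhom (P M : lmodType A) (f : {linear P -> M}) : lhom P M :=
  @LFam unit (fun _ => P) (fun _ => M) (fun _ => f).

Section Window.
Variables (U V : int -> lmodType A) (N : nat) (h : int -> nat).
Hypothesis hU : forall i, (N < `|i|)%N -> forall x : U i, x = 0.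
Hypothesis hh : forall i, has_dim (fun _ : lhom (U i) (V i) => True) (h i).

(** Zero in all degrees other than j, as gcast vanishes there. *)
Definition single j (f : lhom (U j) (V j)) : lfam U V :=
  LFam (fun i => gcast V j i \o f tt \o gcast U i j).

Lemma single_linear j : linear (@single j).
Proof.
move=> c f g; apply: lfam_ext => i x; rewrite lfamE /= /kscale_fun.
by rewrite linearP.
Qed.

(** The maps vanishing in degrees at least r - N have one more summand for each r. *)
Lemma lfam_has_dim :
  has_dim (fun _ : lfam U V => True) (\sum_(t < (2 * N).+1) h (t%:Z - N%:Z)).
Proof.
pose Q (r : nat) (f : lfam U V) := forall i : int, (r%:Z - N%:Z <= i) -> forall x, f i x = 0.
suff H r : has_dim (Q r) (\sum_(t < r) h (t%:Z - N%:Z)).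
  apply: has_dim_ext (H (2 * N).+1) => f; split=> // _ i hi x.
  by rewrite (hU _ x) ?linear0 //; lia.
elim: r => [|r IH].
  rewrite big_ord0; apply: has_dim0 => f; split=> [hf|-> //].
  apply: lfam_ext => i x; have [hi|hi] := leP (0%:Z - N%:Z) i; first exact: hf.
  by rewrite (hU _ x) ?linear0 //; lia.
rewrite big_ord_recr /=; set j := r%:Z - N%:Z.
have [G GI hG] := hh j.
pose g := (mk_linear (@single_linear j)) \o G : {linear _ -> _}.
have gE u i x : g u i x = gcast V j i (G u tt (gcast U i j x)) by [].
have g0 u i x : j <> i -> g u i x = 0 by move=> ne; rewrite gE gcast_neq.
apply: (has_dim_ext _ (has_dim_add (g := g) IH _)) => [f|u hu].
  split=> [[p [v [hp ->]]] i hi x|hf].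
    by rewrite -[p]scale1r lfamE hp ?scaler0 ?add0r ?g0 //; rewrite ?/j; lia.
  have [v ev] : exists v, to_lhom (f j) = G v by apply/hG.
  exists (f - g v), v; rewrite subrK; split=> // i hi x; rewrite lfamB; move: x.
  case: (eqVneq j i) => [<-|/eqP ne] x; first by rewrite gE -ev /= !gcast_id subrr.
  by rewrite g0 // hf ?subrr //; move: ne hi; rewrite /j; lia.
apply: GI; rewrite linear0; apply: lfam_ext => -[] x.
have := hu j; rewrite lexx => /(_ isT x); by rewrite gE !gcast_id.
Qed.
End Window.

End Families.

(** * Composition series over a split basic algebra *)

(** The radical is nilpotent and the quotient by it a product of copies of k; sb_val v is
    the projection of A to the v-th copy. *)
Record split_basic (k : fieldType) (A : algType k) := SplitBasic {
  sb_vertex : finType;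
  sb_e : sb_vertex -> A;
  sb_val : sb_vertex -> A -> k;
  sb_valP : forall v c a b, sb_val v (c *: a + b) = c * sb_val v a + sb_val v b;
  sb_valM : forall v a b, sb_val v (a * b) = sb_val v a * sb_val v b;
  sb_val_e : forall v w, sb_val v (sb_e w) = (v == w)%:R;
  sb_sum : \sum_v sb_e v = 1;
  sb_idem : forall v, sb_e v * sb_e v = sb_e v;
  sb_orth : forall v w, v != w -> sb_e v * sb_e w = 0;
  sb_nil : exists m, forall s : seq A, size s = m ->
    (forall a, a \in s -> forall v, sb_val v a = 0) -> foldr *%R 1 s = 0 }.

Section DualBasis.
Variables (k : fieldType) (A : algType k).

(** Lift the identity of P through a free module. *)
Lemma dual_basis (P : lmodType A) : finitely_generated P -> projective P ->
  exists n (g : 'I_n -> P) (phi : 'I_n -> {linear P -> A^o}),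
    forall x, x = \sum_i phi i x *: g i.
Proof.
move=> [n [g hg]] pP; exists n, g.
have pl : linear (fun u : 'rV[A]_n => \sum_i u 0 i *: g i).
  move=> a u v; rewrite scaler_sumr -big_split /=; apply: eq_bigr => i _.
  by rewrite !mxE scalerDl scalerA.
have [|h hh] := pP _ _ (mk_linear pl) idfun.
  move=> y; have [c ->] := hg y; exists (\row_i c i).
  by apply: eq_bigr => i _; rewrite mxE.
have hl i : linear (fun x => h x 0 i : A^o) by move=> a x y; rewrite linearP !mxE.
by exists (fun i => mk_linear (hl i)) => x; rewrite -[LHS]hh.
Qed.

Lemma scale_central (M : lmodType A) (a : A) (c : k) (x : M) :
  a *: (c%:A *: x) = c%:A *: (a *: x).
Proof. by rewrite !scalerA mulr_algl mulr_algr. Qed.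
Lemma scalar_mulA (M : lmodType A) (c d : k) (x : M) :
  (c * d)%:A *: x = c%:A *: (d%:A *: x).
Proof. by rewrite [RHS]scalerA mulr_algl scalerA. Qed.
End DualBasis.

Section FiniteDim.
Variables (k : fieldType) (A : falgType k).

Lemma restr_findim (M : lmodType A) : finitely_generated M ->
  exists r, has_dim (fun _ : restr M => True) r.
Proof.
move=> [n [g hg]]; pose b := vbasis {:A}.
apply: (@finite_span _ _ ('I_n * 'I_(\dim {:A}))%type
  (fun t => (b`_t.2 *: g t.1 : restr M))) => x.
have [c ->] := hg x; exists (fun t => coord b t.2 (c t.1)).
rewrite -(pair_bigA _ (fun i j => coord b j (c i) *: (b`_j *: g i : restr M))) /=.
apply: eq_bigr => i _; rewrite {1}(coord_vbasis (memvf (c i))) scaler_suml.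
by apply: eq_bigr => j _; rewrite restrZ scalerA mulr_algl.
Qed.

Lemma lhom_findim (P M : lmodType A) : finitely_generated P -> finitely_generated M ->
  exists r, has_dim (fun _ : lhom P M => True) r.
Proof.
move=> [n [g hg]] /restr_findim[r dM].
have [f fI hf] := dM; have /choice[c hc] : forall x : restr M, exists u, x = f u.
  by move=> x; apply/hf.
have cl : linear c by move=> a x y; apply: fI; rewrite -hc linearP -!hc.
pose F (h : lhom P M) : 'M[k]_(n, r) := \matrix_(i, j) c (h tt (g i)) 0 j.
have Fl : linear F.
  move=> a h h'; apply/matrixP => i j; rewrite !mxE.
  by rewrite lfamE -restrZ cl !mxE.
apply: (@embed_has_dim _ _ _ (mxvec \o mk_linear Fl : {linear _ -> _}) _ (n * r)) => //.
- move=> h _ /= /(congr1 vec_mx); rewrite mxvecK linear0 => /matrixP e.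
  apply: lfam_ext => -[] x; have [a ->] := hg x.
  rewrite !linear_sum; apply: eq_bigr => i _; rewrite !linearZ /=.
  suff -> : h tt (g i) = 0 by [].
  have := hc (h tt (g i)); rewrite (_ : c _ = 0) ?linear0 //.
  by apply/rowP => j; have := e i j; rewrite !mxE.
- exact: has_dim_rV.
Qed.
End FiniteDim.

Section HomDimension.
Variables (k : fieldType) (A : falgType k) (sb : split_basic A).
Notation Vx := (sb_vertex sb).
Notation e := (@sb_e _ _ sb).
Notation val_ := (@sb_val _ _ sb).

Definition in_radical (a : A) : Prop := forall v, val_ v a = 0.

Lemma val0 l : val_ l 0 = 0.
Proof. by have := sb_valP (s := sb) l (-1) 0 0; rewrite scaler0 addr0 mulN1r addNr. Qed.
Lemma val1 l : val_ l 1 = 1.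
Proof.
have := sb_val_e l l; rewrite eqxx => h; rewrite -[LHS]mulr1 -[X in _ * X]h -sb_valM.
by rewrite mul1r.
Qed.

(** The l-th character kills the first factor and the other characters kill e_l. *)
Lemma sb_val_sub l a : in_radical ((a - (val_ l a)%:A) * e l).
Proof.
move=> v; rewrite sb_valM sb_val_e; case: eqVneq => [->|_]; last by rewrite mulr0.
rewrite mulr1 addrC -scaleNr sb_valP val1.
by rewrite mulr1 addNr.
Qed.

Definition subrep (M : lmodType A) (N : M -> Prop) : Prop :=
  N 0 /\ forall a x y, N x -> N y -> N (a *: x + y).

Lemma subrepZ (M : lmodType A) (N : M -> Prop) a x : subrep N -> N x -> N (a *: x).
Proof. by move=> [h0 h] hx; rewrite -[_ *: _]addr0; apply: h. Qed.
Lemma subrepD (M : lmodType A) (N : M -> Prop) x y : subrep N -> N x -> N y -> N (x + y).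
Proof. by move=> [h0 h] hx hy; rewrite -[x]scale1r; apply: h. Qed.
Lemma subrepB (M : lmodType A) (N : M -> Prop) x y : subrep N -> N x -> N y -> N (x - y).
Proof. by move=> sN hx hy; rewrite -scaleN1r addrC; apply: sN.2. Qed.
Lemma subrep_sum (M : lmodType A) (N : M -> Prop) (I : finType) (F : I -> M) :
  subrep N -> (forall i, N (F i)) -> N (\sum_i F i).
Proof. by move=> sN hF; apply: big_ind => //; [case: sN|move=> x y; exact: subrepD]. Qed.

(** Multiplying y by elements of the radical must end in N; the last vector outside N,
    projected by a suitable idempotent, spans a simple submodule of M / N. *)
Lemma socle_exists (M : lmodType A) (N : M -> Prop) y : subrep N -> ~ N y ->
  exists x l, [/\ ~ N x, e l *: x = x & forall a, N (a *: x - (val_ l a)%:A *: x)].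
Proof.
move=> sN Ny.
have [y' Ny' hy'] : exists2 y', ~ N y' & forall j, in_radical j -> N (j *: y').
  apply: contrapT => H.
  have step z : ~ N z -> exists2 j, in_radical j & ~ N (j *: z).
    move=> Nz; apply: contrapT => h; apply: H; exists z => // j hj.
    by apply: contrapT => h'; apply: h; exists j.
  have [m hm] := sb_nil sb.
  suff [s [ss hs hN]] : exists s, [/\ size s = m, forall a, a \in s -> in_radical a &
      ~ N (foldr *%R 1 s *: y)].
    by apply: hN; rewrite hm // scale0r; case: sN.
  elim: (m) => [|r [s [ss hs hN]]]; first by exists [::]; rewrite scale1r.
  have [j hj hjN] := step _ hN; exists (j :: s); split; rewrite /= ?ss -?scalerA //.
  by move=> a; rewrite inE => /predU1P[->|/hs].
have [l hl] : exists l, ~ N (e l *: y').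
  apply: contrapT => h; apply: Ny'; rewrite -[y']scale1r -(sb_sum sb) scaler_suml.
  by apply: subrep_sum => // l; apply: contrapT => h'; apply: h; exists l.
exists (e l *: y'), l; split=> [//||a]; first by rewrite scalerA sb_idem.
by rewrite -scalerBl scalerA; apply/hy'/sb_val_sub.
Qed.

(** The component e_l M, which is Hom(A e_l, M). *)
Definition vertex_part (M : lmodType A) l (x : restr M) : Prop := e l *: (x : M) = x.
(** Linear maps from P to the simple module of the vertex l, written without the module. *)
Definition simple_map (P : lmodType A) l (g : P -> k^o) : Prop :=
  forall a x y, g (a *: x + y) = val_ l a * g x + g y.

Lemma vertex_part_subspace M l : subspace (@vertex_part M l).
Proof.
split=> [|c x y hx hy]; first exact: scaler0.
by rewrite /vertex_part restrZ scalerDr scale_central hx hy.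
Qed.
Lemma simple_map_subspace (P : lmodType A) l : subspace (@simple_map P l).
Proof.
split=> [a x y|c f g hf hg a x y].
  by rewrite -[(0 : P -> k^o) _]/(0 : k) -[(0 : P -> k^o) x]/(0 : k) -[(0 : P -> k^o) y]/(0 : k) mulr0 addr0.
have E z : (c *: f + g) z = c * f z + g z by [].
by rewrite !E hf hg !mulrDr addrACA mulrCA.
Qed.

Lemma simple_map_sum (P : lmodType A) l (g : P -> k^o) (I : finType) (a : I -> A) (x : I -> P) :
  simple_map l g ->
  g (\sum_i a i *: x i) = \sum_i val_ l (a i) * g (x i).
Proof.
move=> hg; have g0 : g 0 = 0.
  by have /eqP := hg 1 0 0; rewrite scale1r addr0 val1 mul1r -subr_eq0 opprD addNKr oppr_eq0 => /eqP.
apply: (big_rec2 (fun u v => g u = v)) => // i y1 y2 _ h.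
by rewrite hg h.
Qed.

Lemma simple_map_findim (P : lmodType A) l : finitely_generated P -> exists p, has_dim (@simple_map P l) p.
Proof.
move=> [n [g hg]].
have Fl : linear (fun f : P -> k^o => \row_i f (g i) : 'rV[k]_n).
  by move=> c f f'; apply/rowP => i; rewrite !mxE.
apply: (@embed_has_dim _ _ _ (mk_linear Fl) _ n (@simple_map_subspace P l)).
  move=> f hf /rowP h; apply/funext => x; have [c ->] := hg x.
  rewrite (simple_map_sum _ _ hf) big1 // => i _.
  by have := h i; rewrite /= !mxE => ->; rewrite mulr0.
exact: has_dim_rV.
Qed.
Lemma vertex_part_findim M l : finitely_generated M -> exists q, has_dim (@vertex_part M l) q.
Proof. by move=> /restr_findim[r dM]; apply: (sub_has_dim (@vertex_part_subspace M l) _ dM). Qed.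

Section Growth.
Variables (P M : lmodType A) (p : Vx -> nat).
Hypotheses (fgP : finitely_generated P) (prP : projective P).
Hypothesis (hp : forall l, has_dim (@simple_map P l) (p l)).

Definition hom_into (N : M -> Prop) (f : lhom P M) : Prop := forall x, N (f tt x).

Definition dim_formula (N : M -> Prop) : Prop :=
  exists q : Vx -> nat, (forall l, has_dim (fun x : restr M => N x /\ vertex_part l x) (q l)) /\
    has_dim (hom_into N) (\sum_l p l * q l).

(** Let N' = N + k x with N' / N simple of type l. Then e_l gains one dimension and, as P
    is projective, Hom(P, N') / Hom(P, N) is Hom(P, N' / N); the dual basis gives the
    lifting explicitly. *)
Lemma dim_formula_grow (N : M -> Prop) x l : subrep N -> ~ N x -> e l *: x = x ->
  (forall a, N (a *: x - (val_ l a)%:A *: x)) ->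
  dim_formula N -> dim_formula (fun y => exists z (c : k), N z /\ y = z + c%:A *: x).
Proof.
move=> sN Nx ex hx [q [hq hH]].
have kN z : N z -> forall c : k, N (c%:A *: z) by move=> hz c; apply: subrepZ.
have Nc (c : k) : N (c%:A *: x) -> c = 0.
  move=> h; apply/eqP/negPn/negP => c0; apply: Nx.
  have -> : x = (c^-1)%:A *: (c%:A *: x).
    by rewrite scalerA mulr_algl scalerA mulVf // !scale1r.
  exact: kN.
exists (fun l' => (q l' + (l' == l))%N); split.
  move=> l'; case: eqVneq => [->|ll'].
    have Nx' : ~ (N x /\ vertex_part l x) by case.
    apply: has_dim_ext (has_dim_add1 (x := x : restr M) (hq l) Nx') => y; split.
      move=> [z [c [[hz ez] ->]]]; split; first by exists z, c.
      by rewrite /vertex_part restrZ scalerDr scale_central ez ex.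
    move=> [[z [c [hz ->]]] ey]; exists (e l *: z), c; split.
      by split; [apply: subrepZ|rewrite /vertex_part scalerA sb_idem].
    by move: ey; rewrite /vertex_part scalerDr scale_central ex => ->.
  rewrite addn0; apply: has_dim_ext (hq l') => y; split.
    by move=> [hy ey]; split=> //; exists y, 0; rewrite scale0r scale0r addr0.
  move=> [[z [c [hz ey0]]] ey]; split=> //; rewrite -ey ey0 scalerDr scale_central.
  by rewrite -ex scalerA sb_orth // scale0r scaler0 addr0; apply: subrepZ.
have [n [g [phi hphi]]] := dual_basis fgP prP.
have [G GI hG] := hp l.
have GP u : simple_map l (G u) by apply/hG; exists u.
have liftl u : linear (fun y : P => \sum_i (phi i y : A) *: ((G u (g i))%:A *: x)).
  move=> a y z; rewrite scaler_sumr -big_split /=; apply: eq_bigr => i _.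
  rewrite linearP scalerDl [in RHS]scalerA; congr (_ + _).
pose L u : lhom P M := to_lhom (mk_linear (liftl u)).
have Ll : linear L.
  move=> c u v; apply: lfam_ext => -[] y; rewrite lfamE /= scaler_sumr -big_split /=.
  apply: eq_bigr => i _; rewrite linearP -scale_central -scalerDr; congr (_ *: _).
  rewrite -[(c *: G u + G v) _]/(c * G u (g i) + G v (g i)) 2!scalerDl; congr (_ + _).
  by rewrite scalar_mulA.
have L_mod u y : N (L u tt y - (G u y)%:A *: x).
  rewrite [X in G u X]hphi (simple_map_sum _ _ (GP u)) /= 2!scaler_suml -sumrB.
  apply: subrep_sum => // i; rewrite mulrC scalar_mulA scale_central.
  by rewrite -scalerBr; apply: kN.
have -> : (\sum_l' p l' * (q l' + (l' == l)) = \sum_l' p l' * q l' + p l)%N.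
  under eq_bigr do rewrite mulnDr; rewrite big_split /=; congr addn.
  by rewrite (bigD1 l) //= eqxx muln1 big1 ?addn0 // => i /negbTE ->; rewrite muln0.
apply: (has_dim_ext _ (has_dim_add (g := mk_linear Ll) hH _)) => [f|u hu].
  split=> [[f' [u [hf' ->]]] y|hf].
    exists (f' tt y + (L u tt y - (G u y)%:A *: x)), (G u y); split.
      by apply: subrepD => //; apply: L_mod.
    by rewrite -[LHS]/(f' tt y + L u tt y) addrA subrK.
  have /choice[c hc] : forall y, exists c : k, N (f tt y - c%:A *: x).
    by move=> y; have [z [c [hz ->]]] := hf y; exists c; rewrite addrK.
  have cc : simple_map l (c : P -> k^o).
    move=> a y z; apply/eqP; rewrite -subr_eq0; apply/eqP/Nc.
    have tr u v w : N (u - v) -> N (v - w) -> N (u - w).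
      by move=> h1 h2; rewrite -(subrK v u) -addrA; apply: subrepD.
    rewrite 2!scalerBl 2!scalerDl; apply: (tr _ (f tt (a *: y + z))).
      by rewrite -opprB -scaleN1r; apply: subrepZ.
    apply: (tr _ (a *: ((c y)%:A *: x) + (c z)%:A *: x)).
      rewrite linearP opprD addrACA -scalerBr; apply: subrepD => //.
      exact: subrepZ.
    rewrite opprD addrACA subrr addr0 mulrC scalar_mulA.
    by rewrite scale_central -scalerBr; apply: kN.
  have /hG[u eu] := cc; exists (f - L u), u; rewrite subrK; split=> // y.
  have -> : (f - L u) tt y = (f tt y - (c y)%:A *: x) - (L u tt y - (G u y)%:A *: x).
    by rewrite lfamB -eu opprB addrA subrK.
  exact: subrepB.
apply: GI; rewrite linear0; apply/funext => y; apply: Nc.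
have -> : (G u y)%:A *: x = L u tt y - (L u tt y - (G u y)%:A *: x) by rewrite subKr.
by apply: subrepB => //; apply: hu.
Qed.

Lemma subrep_grow (N : M -> Prop) x l : subrep N ->
  (forall a, N (a *: x - (val_ l a)%:A *: x)) ->
  subrep (fun y => exists z (c : k), N z /\ y = z + c%:A *: x).
Proof.
move=> sN hx; split; first by exists 0, 0; rewrite scale0r scale0r addr0; split=> //; case: sN.
move=> a _ _ [z [c [hz ->]]] [z' [c' [hz' ->]]].
exists (a *: z + z' + c%:A *: (a *: x - (val_ l a)%:A *: x)), (c * val_ l a + c'); split.
  by apply: subrepD => //; [apply: sN.2|apply: subrepZ].
rewrite scalerDr scale_central scalerBr 2!scalerDl scalar_mulA addrA.
rewrite [a *: z + z' + _]addrA [in RHS]addrA subrK; congr (_ + _).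
by rewrite addrAC.
Qed.

(** Add simple factors until the submodule is all of M. *)
Lemma hom_dim : finitely_generated M ->
  exists q : Vx -> nat, (forall l, has_dim (@vertex_part M l) (q l)) /\
    has_dim (fun _ : lhom P M => True) (\sum_l p l * q l).
Proof.
move=> /restr_findim[r dM].
suff [q [hq hH]] : dim_formula (fun _ => True).
  exists q; split=> [l|]; first by apply: has_dim_ext (hq l) => x; split=> [[]|].
  by apply: has_dim_ext hH => f; split.
suff H s (N : M -> Prop) a : subrep N -> has_dim (N : restr M -> Prop) a -> (r <= a + s)%N ->
    dim_formula N -> dim_formula (fun _ => True).
  have s0 : subrep (fun x : M => x = 0).
    by split=> // b x y -> ->; rewrite scaler0 addr0.
  apply: (H r _ 0%N s0) => //; first exact: (has_dim0 (V := restr M)).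
  exists (fun=> 0%N); split=> [l|].
    by apply: has_dim0 => x; split=> [[-> _]|-> ]//; split=> //; apply: scaler0.
  rewrite big1 => [|l _]; last by rewrite muln0.
  apply: has_dim0 => f; split=> [h|-> x //]; apply: lfam_ext => -[] x; exact: h.
elim: s N a => [|s IH] N a sN dN ras hN.
  have full y : N y.
    apply: contrapT => Ny; have := has_dim_add1 dN Ny.
    by move=> /(has_dim_le (Q := fun _ => True))/(_ dM) => h; have := h (fun _ _ => I); lia.
  have [q [hq hH]] := hN; exists q; split=> [l|].
    by apply: has_dim_ext (hq l) => x; split=> -[_ hx].
  by apply: has_dim_ext hH => f; split=> // _ x.
case: (pselect (forall y, N y)) => [full|/existsNP[y Ny]].
  have [q [hq hH]] := hN; exists q; split=> [l|].
    by apply: has_dim_ext (hq l) => x; split=> -[_ hx].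
  by apply: has_dim_ext hH => f; split=> // _ x.
have [x [l [Nx ex hx]]] := socle_exists sN Ny.
apply: (IH _ (a + 1)%N (subrep_grow sN hx)).
- exact: has_dim_add1 dN Nx.
- by rewrite -addnA add1n.
- exact: (dim_formula_grow sN Nx ex hx hN).
Qed.

End Growth.
End HomDimension.

(** * Euler characteristics and divisibility *)

Section Division.
Variables (k : fieldType) (R V : lmodType k) (act : R -> V -> V) (null : R -> Prop) (d : nat).
Hypothesis actPr : forall r, linear (act r).
Variables (rho : {linear 'rV[k]_d -> R}) (d_gt0 : (0 < d)%N).
Hypotheses (rho_inj : forall u, null (rho u) -> u = 0)
  (rho_surj : forall r, exists u, null (r - rho u)).
Hypotheses (act_comp : forall r r', exists r'', forall v, act r (act r' v) = act r'' v).
Variables (Z B : V -> Prop) (z b : nat).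
Hypotheses (dZ : has_dim Z z) (dB : has_dim B b) (BZ : forall v, B v -> Z v).
Hypothesis actPl : forall v, Z v -> linear (act^~ v).
Hypotheses (actZ : forall r v, Z v -> Z (act r v)) (actB : forall r v, B v -> B (act r v)).
Hypothesis null_act : forall r v, null r -> Z v -> B (act r v).
Hypothesis null_inv : forall r, ~ null r ->
  exists r', forall v, Z v -> B (act r' (act r v) - v).

(** Modulo B, every nonzero x of Z generates under R a copy of R / null, of dimension d, and
    these orbits are linearly independent as long as each x is outside the previous span. *)
Lemma division_dvd : exists h, z = (b + d * h)%N.
Proof.
have sZ := has_dim_subspace dZ.
suff H s (W : V -> Prop) w : has_dim W w -> (forall v, B v -> W v) -> (forall v, W v -> Z v) ->
    (forall r v, W v -> W (act r v)) -> (z <= w + s)%N -> exists h, z = (w + d * h)%N.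
  by apply: (H z B b dB) => //; rewrite leq_addl.
elim: s W w => [|s IH] W w dW BW WZ actW zws.
  exists 0%N; rewrite muln0 addn0; apply/eqP; rewrite eqn_leq (has_dim_le WZ dW dZ) andbT.
  by rewrite addn0 in zws.
case: (pselect (forall v, Z v -> W v)) => [ZW|/existsNP[x /not_implyP[Zx Wx]]].
  by exists 0%N; rewrite muln0 addn0; apply: (has_dim_uniq dZ); apply: has_dim_ext dW => v; split; auto.
have sW := has_dim_subspace dW.
(* The enlarged subspace is W + R x. *)
pose g := mk_linear (actPl Zx) \o rho : {linear _ -> _}.
have gE u : g u = act (rho u) x by [].
have gW u : W (g u) -> u = 0.
  move=> hu; apply: rho_inj; apply: contrapT => nu; have [r' hr'] := null_inv nu.
  apply: Wx; have -> : x = act r' (act (rho u) x) - (act r' (act (rho u) x) - x) by rewrite subKr.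
  by apply: (subspaceB sW); [apply/actW|apply/BW/hr'].
have dW' := has_dim_add dW gW.
set W' := fun y => _ in dW'.
have W'E y : W' y <-> exists p v, W p /\ y = p + g v by [].
have [||||h ->] := IH W' (w + d)%N dW'.
- by move=> v hv; apply/W'E; exists v, 0; rewrite linear0 addr0; split=> //; apply: BW.
- move=> v /W'E[p [u [hp ->]]]; apply: (subspaceD sZ); first exact: WZ.
  by rewrite gE; apply: actZ.
- move=> r v /W'E[p [u [hp ->]]]; have [r'' hr''] := act_comp r (rho u).
  have [u'' hu''] := rho_surj r''; apply/W'E.
  exists (act r p + act (r'' - rho u'') x), u''; split.
    by apply: (subspaceD sW); [apply: actW|apply/BW/null_act].
  have -> : act r (p + g u) = act r p + act r (g u) := linearD (mk_linear (actPr r)) p (g u).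
  have -> : g u'' = act r'' x - act (r'' - rho u'') x.
    by rewrite -(linearB (mk_linear (actPl Zx))) /= subKr.
  by rewrite gE hr'' -addrA subrKC.
- by lia.
by exists h.+1; rewrite mulnS addnA.
Qed.
End Division.

(** * Alternating sums *)

(** The terms are indexed by -N, ..., N and the sign is positive at -N. *)
Definition altsum (N : nat) (f : int -> int) : int :=
  \sum_(t < (2 * N).+1) (-1) ^+ t * f (t%:Z - N%:Z).

Lemma altsum_rev N f : altsum N (fun i => f (- i)) = altsum N f.
Proof.
rewrite /altsum (reindex_inj rev_ord_inj) /=; apply: eq_bigr => t _.
have h := ltn_ord t; congr (_ * f _); last by lia.
by rewrite -signr_odd -[RHS]signr_odd; congr (_ ^+ _); congr nat_of_bool; lia.
Qed.

Lemma alternating_telescope (u : nat -> int) r :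
  \sum_(t < r) (-1) ^+ t * (u t + u t.+1) = u 0%N - (-1) ^+ r * u r.
Proof.
elim: r => [|r IH]; first by rewrite big_ord0 expr0 mul1r subrr.
rewrite big_ord_recr /= IH exprS mulN1r mulNr opprK mulrDr.
by rewrite addrA subrK.
Qed.

(** A complex and its cohomology have the same Euler characteristic: c_i is the dimension of
    the complex, z_i and beta_i those of cycles and of the image in degree i + 1, and
    h_i that of the cohomology in degree i + 1. *)
Lemma altsum_euler (c z beta h : int -> nat) N :
  (forall i, c i = (z i + beta i)%N) -> (forall i, z (i + 1) = (beta i + h i)%N) ->
  (forall i, (N <= `|i|)%N -> c i = 0%N) ->
  altsum N (fun i => (c i)%:Z) = altsum N (fun i => (h (i - 1))%:Z).
Proof.
move=> hc hz c0.
(* The boundary terms of the telescoping sum. *)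
have b0 : beta N%:Z = 0%N by have := hc N%:Z; rewrite c0 ?absz_nat //; lia.
have b1 : beta (- N%:Z - 1) = 0%N.
  have := hz (- N%:Z - 1); rewrite subrK; have := hc (- N%:Z); rewrite c0; last by lia.
  by lia.
apply/eqP; rewrite -subr_eq0 /altsum -sumrB; apply/eqP.
pose u (t : nat) : int := (beta (t%:Z - N%:Z - 1))%:Z.
transitivity (\sum_(t < (2 * N).+1) (-1) ^+ t * (u t + u t.+1)).
  apply: eq_bigr => t _; rewrite -mulrBr; congr (_ * _).
  have := hz (t%:Z - N%:Z - 1); rewrite subrK hc => ->; rewrite /u.
  have -> : t.+1%:Z - N%:Z - 1 = t%:Z - N%:Z by lia.
  by lia.
rewrite alternating_telescope /u.
have -> : 0%:Z - N%:Z - 1 = - N%:Z - 1 by lia.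
have -> : (2 * N).+1%:Z - N%:Z - 1 = N%:Z by lia.
by rewrite b0 b1 mulr0 subrr.
Qed.

Lemma altsum_shift (f : int -> int) N t : (t <= 2 * N)%N ->
  (forall i, (N < `|i|)%N -> f i = 0) ->
  altsum (2 * N + 2) (fun m => f (t%:Z - N%:Z + m)) = (-1) ^+ t * altsum N f.
Proof.
move=> ht f0; rewrite /altsum; set a := (2 * N + 2 - t)%N.
pose F (s : nat) : int := (-1) ^+ s * f (t%:Z - N%:Z + (s%:Z - (2 * N + 2)%N%:Z)).
rewrite -(big_mkord xpredT F) (@big_cat_nat _ _ _ a) //=; last by rewrite /a; lia.
rewrite [X in X + _]big_nat_cond [X in X + _]big1 ?add0r; last first.
  by move=> s; rewrite /a => hs; rewrite /F f0 ?mulr0 //; lia.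
rewrite (@big_cat_nat _ _ _ (a + (2 * N).+1)%N) /=; [|by lia|by rewrite /a; lia].
rewrite [X in _ + X]big_nat_cond [X in _ + X]big1 ?addr0; last first.
  by move=> s; rewrite /a => hs; rewrite /F f0 ?mulr0 //; lia.
rewrite -{1}[a]add0n big_addn addKn big_mkord mulr_sumr; apply: eq_bigr => u _.
rewrite /F mulrA -exprD; congr (_ * f _); last by rewrite /a; lia.
by rewrite -signr_odd -[RHS]signr_odd; congr (_ ^+ _); congr nat_of_bool; rewrite /a; lia.
Qed.

(** The sum over m, for fixed t, runs over the whole support of q; this requires the window
    to be twice as wide, and 2 N + 2 is chosen even to fix the sign. *)
Lemma altsum_convolution (L : finType) (p q : int -> L -> nat) N :
  (forall i l, (N < `|i|)%N -> q i l = 0%N) ->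
  altsum (2 * N + 2) (fun m => (\sum_(t < (2 * N).+1) \sum_l
      p (t%:Z - N%:Z)%R l * q (t%:Z - N%:Z + m)%R l)%N%:Z) =
  \sum_l altsum N (fun i => (p i l)%:Z) * altsum N (fun i => (q i l)%:Z).
Proof.
move=> q0.
transitivity (\sum_(t < (2 * N).+1) \sum_l (p (t%:Z - N%:Z) l)%:Z *
   altsum (2 * N + 2) (fun m => (q (t%:Z - N%:Z + m) l)%:Z)).
  rewrite /altsum; under eq_bigr => s _.
    rewrite -natz natr_sum mulr_sumr.
    under eq_bigr => t _ do rewrite natr_sum mulr_sumr.
    over.
  rewrite exchange_big; apply: eq_bigr => t _ /=.
  rewrite exchange_big; apply: eq_bigr => l _ /=.
  by rewrite mulr_sumr; apply: eq_bigr => s _; rewrite natrM !natz mulrCA.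
rewrite exchange_big; apply: eq_bigr => l _ /=; rewrite [in RHS]/altsum mulr_suml.
apply: eq_bigr => t _; rewrite (@altsum_shift (fun i => (q i l)%:Z)).
- by rewrite mulrA [_ * (-1) ^+ _]mulrC.
- by have := ltn_ord t; lia.
- by move=> i hi; rewrite q0.
Qed.

Lemma altsum_mul N (d : nat) (h : int -> nat) :
  exists w : int, altsum N (fun i => (d * h i)%N%:Z) = d%:Z * w.
Proof.
exists (altsum N (fun i => (h i)%:Z)); rewrite /altsum mulr_sumr; apply: eq_bigr => t _.
by rewrite PoszM mulrCA.
Qed.

(** * Euler characteristic of the graded endomorphisms of a complex *)

Lemma has_dim_inj (k : fieldType) (V W : lmodType k) (f : {linear V -> W})
    (P : V -> Prop) (Q : W -> Prop) n :
  (forall x, f x = 0 -> x = 0) -> (forall y, Q y <-> image_of f P y) ->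
  has_dim P n -> has_dim Q n.
Proof.
move=> fI hQ [g gI hg]; exists (f \o g : {linear _ -> _}) => [u v /= e|y].
  by apply: gI; apply/eqP; rewrite -subr_eq0; apply/eqP/fI; rewrite linearB e subrr.
rewrite hQ; split=> [[x /hg[u ->] ->]|[u ->]]; first by exists u.
by exists (g u) => //; apply/hg; exists u.
Qed.

Section HomFinite.
Variables (k : fieldType) (A : falgType k).
Implicit Types X Y : bcomplex A.

Definition chain_lfam_fun X Y (f : chain X Y) : lfam (cob X) (cob Y) := LFam (cmap f).
Lemma chain_lfam_is_linear X Y : linear (@chain_lfam_fun X Y).
Proof. by move=> c f g; apply: lfam_ext. Qed.
Definition chain_lfam X Y : {linear chain X Y -> lfam (cob X) (cob Y)} :=
  mk_linear (@chain_lfam_is_linear X Y).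
Lemma chain_lfam_inj X Y (f : chain X Y) : chain_lfam X Y f = 0 -> f = 0.
Proof.
move=> e; apply: chain_ext => i x.
by have := congr1 (fun g : lfam (cob X) (cob Y) => g i x) e.
Qed.

Lemma chain_findim X Y : exists n, has_dim (fun _ : chain X Y => True) n.
Proof.
have [N hN] := cob_bounded X.
have /choice[h hh] : forall i, exists n, has_dim (fun _ : lhom (X i) (Y i) => True) n.
  by move=> i; apply: lhom_findim; apply: cob_fg.
apply: (embed_has_dim (f := chain_lfam X Y) _ _ (lfam_has_dim hN hh)) => // f _.
exact: chain_lfam_inj.
Qed.

Lemma khom_findim X Y : exists n, has_dim (fun _ : khom X Y => True) n.
Proof.
have [n dn] := chain_findim X Y; have [a [b [_ db _]]] := rank_nullity (kclassl X Y) dn.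
exists b; apply: has_dim_ext db => q; split=> // _.
by have [f ->] := kclassP q; exists f.
Qed.

(** The degrees in which X and Y are nonzero become disjoint after a large shift. *)
Lemma khom_bounded X Y : exists N : nat, forall l : int, (N < `|l|)%N ->
  forall f : khom (cshift l X) Y, f = 0.
Proof.
have [b hb] := cob_bounded X; have [c hc] := cob_bounded Y.
exists (b + c)%N => l hl q; have [f ->] := kclassP q; rewrite -kclass0; congr kclass.
apply: chain_ext => i x; rewrite [RHS](_ : _ = 0) //.
case: (ltnP c `|i|) => hi; first exact: hc.
by rewrite (hb (i + l) _ x) ?linear0 //; lia.
Qed.

Definition kb_triangulated : hom_finite_triangulated (Kb A).
Proof.
refine (@HomFiniteTriangulated k (Kb A) (@kshift k A) _ _ _ _ _ _ _ _ _ _ _ _ _ _ _ _ _ _ _ _ _ _ _).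
- exact: kcompA.
- exact: kcomp1l.
- exact: kcomp1r.
- exact: kcompPl.
- exact: kcompPr.
- exact: kshift_id.
- exact: kshift_comp.
- exact: kshift_inj.
- exact: kshift_surj.
- exact: kb_shift0.
- exact: kb_shiftD.
- exact: khom_findim.
- exact: khom_bounded.
- exact: kb_zero.
- exact: kb_biproduct.
- exact: kb_cone.
- by move=> X Y Z u v w /kdist_exact[].
- by move=> X Y Z u v w /kdist_exact[].
- by move=> X Y Z u v w /kdist_exact[].
- by move=> X Y Z u v w /kdist_exact[].
- by move=> X Y Z u v w /kdist_exact[].
- by move=> X Y Z u v w /kdist_exact[].
- by move=> X Y Z u v w /kdist_exact[].
Defined.

End HomFinite.

Lemma scale_sum_central (k : fieldType) (A : algType k) (M : lmodType A) (s : A) (c : k)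
    (a a' b b' : M) :
  s *: (c%:A *: a + a') + (c%:A *: b + b') = c%:A *: (s *: a + b) + (s *: a' + b').
Proof. by rewrite !scalerDr scale_central addrACA. Qed.

Lemma gcast_inj (k : fieldType) (A : algType k) (C : int -> lmodType A) a b :
  a = b -> injective (gcast C a b).
Proof. by move=> <- x y; rewrite !gcast_id. Qed.

Section EulerForm.
Variables (k : fieldType) (A : falgType k) (X : bcomplex A).

(** Composing d s + s d with d on either side gives d s d. *)
Lemma homotopy_chain (Y : bcomplex A) (s : forall i j, {linear X i -> Y j}) :
  exists f : chain X Y, forall j x, f (j + 1) x = dif Y j (j + 1) (s (j + 1) j x)
      + s (j + 1 + 1) (j + 1) (dif X (j + 1) (j + 1 + 1) x).
Proof.
have l j : linear (fun x : X (j + 1) => dif Y j (j + 1) (s (j + 1) j x)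
      + s (j + 1 + 1) (j + 1) (dif X (j + 1) (j + 1 + 1) x)).
  by move=> a u v; rewrite !linearP addrACA -scalerDr.
have [f hf] : exists f : chain X Y, forall j, f (j + 1) =1 mk_linear (l j).
  apply: chain_of_succ => j x /=.
  by rewrite dif_dif linear0 addr0 linearD dif_dif add0r.
by exists f => j x; rewrite hf.
Qed.

Definition graded_hom (m : int) := lfam (cob X) (fun i => X (i + m)).

(** The sign makes the kernel consist of the chain maps X -> X[m], and gcast identifies
    X (i + 1 + m) with X (i + (m + 1)). *)
Definition graded_dif_fun (m : int) (f : graded_hom m) : graded_hom (m + 1) :=
  LFam (fun i => kscale ((-1) ^+ `|(m + 1)%R|%N) (dif X (i + m) (i + (m + 1)) \o f i)
    \+ (gcast X (i + 1 + m) (i + (m + 1)) \o f (i + 1) \o dif X i (i + 1))).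

Lemma graded_difE m (f : graded_hom m) i (x : X i) : graded_dif_fun f i x =
  (-1) ^+ `|(m + 1)%R|%N *: dif X (i + m) (i + (m + 1)) (f i x) +
  gcast X (i + 1 + m) (i + (m + 1)) (f (i + 1) (dif X i (i + 1) x)).
Proof. by rewrite /= /kscale_fun sgnscaleE. Qed.

Lemma graded_dif_linear m : linear (@graded_dif_fun m).
Proof.
move=> c f g; apply: lfam_ext => i x; rewrite lfamE !graded_difE !lfamE.
by rewrite !linearP scale_sum_central.
Qed.
Definition graded_dif m : {linear graded_hom m -> graded_hom (m + 1)} :=
  mk_linear (@graded_dif_linear m).

Lemma graded_dif_ker m (f : graded_hom m) :
  graded_dif m f = 0 <-> exists g : chain X (cshift m X), f = chain_lfam _ _ g.
Proof.
have sgn : (-1) ^+ `|(m + 1)%R|%N = - (-1) ^+ `|m|%N :> A.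
  by rewrite sign_absz expr1 mulrN1.
have idx i : i + 1 + m = i + (m + 1) by rewrite -addrA (addrC 1).
have key i (x : X i) : graded_dif_fun f i x = 0 <->
    f (i + 1) (dif X i (i + 1) x) = dif (cshift m X) i (i + 1) (f i x).
  rewrite graded_difE sgn scaleNr dif_shiftE.
  have -> : (-1) ^+ `|m|%N *: dif X (i + m) (i + (m + 1)) (f i x) =
      gcast X (i + 1 + m) (i + (m + 1)) ((-1) ^+ `|m|%N *: dif X (i + m) (i + 1 + m) (f i x)).
    by rewrite linearZ /= (gcast_dif _ erefl (idx i)) gcast_id.
  split=> [/esym/zmod_eqN/gcast_inj|->]; last by rewrite addNr.
  by apply.
split=> [h|[g e]].
  have comm i j (x : X i) : f j (dif X i j x) = dif (cshift m X) i j (f i x).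
    case: (eqVneq j (i + 1)) => [->|n]; last by rewrite !dif_shape // linear0.
    by apply/key; rewrite -[LHS]/(graded_dif m f i x) h.
  by exists (@Chain k A X (cshift m X) f comm); apply: lfam_ext.
apply: lfam_ext => i x; apply/key; rewrite e; exact: (cmap_comm g).
Qed.

Lemma graded_dif_image m (f : graded_hom (m + 1)) :
  image_of (graded_dif m) (fun _ => True) f <->
  exists g : chain X (cshift (m + 1) X), nullhomotopic g /\ f = chain_lfam _ _ g.
Proof.
have idx (i : int) : i + 1 + m = i + (m + 1) by rewrite -addrA (addrC 1).
split=> [[h _ ->]|[g [/nullhomotopicP[s hs] ->]]].
  pose s i j : {linear X i -> cshift (m + 1) X j} := gcast X (i + m) (j + (m + 1)) \o h i.
  have [g hg] := homotopy_chain s; exists g; split; first by apply/nullhomotopicP; exists s.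
  apply: lfam_ext => i; rewrite -[i](subrK 1) => x.
  rewrite -[LHS]/(graded_dif_fun h _ x) -[RHS]/(g _ x) hg graded_difE dif_shiftE /s /=.
  by rewrite -(gcast_dif _ (idx _) erefl) gcast_id.
have /dependent_choice_fun[h hh] : forall i, exists h : {linear X i -> X (i + m)},
    forall j (e : i = j + 1) x,
      h x = gcast X (j + (m + 1)) (i + m) (s i j x).
  move=> i; exists (gcast X (i - 1 + (m + 1)) (i + m) \o s i (i - 1)) => j e x.
  by have -> : j = i - 1; rewrite ?e ?addrK.
exists (LFam h : graded_hom m) => //; apply: lfam_ext => i; rewrite -[i](subrK 1).
move: (i - 1) => j x.
rewrite -[RHS]/(graded_dif_fun _ _ x) -[LHS]/(g _ x) hs graded_difE dif_shiftE /=.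
rewrite (hh _ _ erefl) (hh _ _ erefl) -(gcast_dif _ (esym (idx _)) erefl) gcast_id.
by rewrite gcast_comp ?gcast_id.
Qed.

(** Kernel and image of graded_dif are the chain maps to a shift of X and the
    null-homotopic ones among them, and khom is the quotient. *)
Lemma graded_hom_dim m z n h :
  has_dim (fun f : graded_hom (m + 1) => True /\ graded_dif (m + 1) f = 0) z ->
  has_dim (image_of (graded_dif m) (fun _ => True)) n ->
  has_dim (fun _ : khom X (cshift (m + 1) X) => True) h -> z = (n + h)%N.
Proof.
move=> dz dn dh; set Y := cshift (m + 1) X in dh.
have [y dy] := chain_findim X Y.
have ez : y = z.
  apply: (has_dim_uniq _ dz).
  apply: (has_dim_inj (f := chain_lfam X Y) (@chain_lfam_inj _ _ _ _) _ dy) => f.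
  split=> [[_ /graded_dif_ker[g ->]]|[g _ ->]]; first by exists g.
  by split=> //; apply/graded_dif_ker; exists g.
have [a [b [da db e]]] := rank_nullity (kclassl X Y) dy.
have -> : h = b.
  apply: (has_dim_uniq dh); apply: has_dim_ext db => q; split=> // _.
  by have [f ->] := kclassP q; exists f.
have -> : n = a.
  apply: (has_dim_uniq dn).
  apply: (has_dim_inj (f := chain_lfam X Y) (@chain_lfam_inj _ _ _ _) _ da) => f.
  rewrite graded_dif_image; split=> [[g [/kclass_eq0 hg ->]]|[g [_ hg] ->]].
    by exists g.
  by exists g; split=> //; apply/kclass_eq0.
by rewrite -ez e.
Qed.

End EulerForm.

(** * Cohomology as a module over a division algebra *)

Section Endomorphisms.
Variables (k : fieldType) (A : falgType k) (sb : split_basic A) (X : bcomplex A).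
Notation Vx := (sb_vertex sb).

Lemma restr_map_linear (M M' : lmodType A) (f : {linear M -> M'}) :
  linear (f : restr M -> restr M').
Proof. by move=> c x y; rewrite !restrZ linearP. Qed.
Definition restr_map (M M' : lmodType A) (f : {linear M -> M'}) : {linear restr M -> restr M'} :=
  mk_linear (restr_map_linear f).

Lemma precomp_linear (P P' : lmodType A) (f : {linear P -> P'}) :
  linear (fun g : P' -> k^o => (g \o f : P -> k^o)).
Proof. by []. Qed.
Definition precomp (P P' : lmodType A) (f : {linear P -> P'}) :
  {linear (P' -> k^o) -> (P -> k^o)} := mk_linear (precomp_linear f).

Section Divisibility.
Hypothesis End_division : forall f : khom X X, f <> 0 -> is_iso (f : @thom k (Kb A) X X).
Variables (d : nat) (d_gt0 : (0 < d)%N).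
Hypothesis dE : has_dim (fun _ : khom X X => True) d.

(** D only acts up to homotopy; rho chooses chain maps that represent a basis of D. *)
Lemma lift_endomorphisms : exists rho : {linear 'rV[k]_d -> chain X X},
  (forall u, nullhomotopic (rho u) -> u = 0) /\
  (forall r, exists u, nullhomotopic (r - rho u)).
Proof.
have [h hI hh] := dE.
have [||rho [_ hr]] := @lift_lincomb _ _ _ (kclassl X X) (fun _ => True) d h; first by split.
  by move=> u; have [f ->] := kclassP (h u); exists f.
exists rho; split=> [u /kclass_eq0 e|r].
  by apply: hI; rewrite linear0 -hr -e.
have [u eu'] : exists u, kclass r = h u by apply/hh.
by exists u; apply/kclass_eq; rewrite eu' -hr.
Qed.

Lemma endomorphism_inverse (r : chain X X) : ~ nullhomotopic r ->
  exists r' : chain X X, nullhomotopic (chain_comp r' r - chain_id X) /\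
    nullhomotopic (chain_comp r r' - chain_id X).
Proof.
move=> nr; have [|g [h1 h2]] := @End_division (kclass r); first by move/kclass_eq0.
have [r' e] := kclassP g; rewrite e in h1 h2; rewrite /= !kcompE in h1 h2.
by exists r'; split; apply/kclass_eq.
Qed.

Lemma vertex_part_dif l i j (x : X i) : vertex_part (sb := sb) l (x : restr (X i)) ->
  vertex_part (sb := sb) l (dif X i j x : restr (X j)).
Proof. by rewrite /vertex_part -linearZ /= => ->. Qed.

(** D acts on the cohomology of e_l X by composition. *)
Lemma vertex_part_cohomology l j z b :
  has_dim (fun x : restr (X (j + 1)) => vertex_part (sb := sb) l x /\
    restr_map (dif X (j + 1) (j + 1 + 1)) x = 0) z ->
  has_dim (image_of (restr_map (dif X j (j + 1))) (@vertex_part k A sb (X j) l)) b ->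
  exists h, z = (b + d * h)%N.
Proof.
move=> dz db; have [rho [rho1 rho2]] := lift_endomorphisms.
have null_act (r : chain X X) (v : X (j + 1)) : nullhomotopic r ->
    vertex_part (sb := sb) l (v : restr _) /\ dif X (j + 1) (j + 1 + 1) v = 0 ->
    image_of (restr_map (dif X j (j + 1))) (@vertex_part k A sb (X j) l) (r (j + 1) v).
  move=> /nullhomotopicP[s hs] [ev dv]; exists (s (j + 1) j v).
    by rewrite /vertex_part -linearZ /= ev.
  by rewrite /= hs dv linear0 addr0.
apply: (@division_dvd _ (chain X X) (restr (X (j + 1))) (fun r v => r (j + 1) v)
  (@nullhomotopic k A X X) d _ rho d_gt0 rho1 rho2 _ _ _ z b dz db) => //.
- by move=> r c x y; rewrite !restrZ linearP.
- by move=> r r'; exists (chain_comp r r').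
- move=> v [x ex ->]; split; first exact: vertex_part_dif.
  by rewrite /= dif_dif.
- move=> r v [ev dv]; split; first by rewrite /vertex_part -linearZ /= ev.
  by rewrite /= -cmap_comm -[dif _ _ _ v]/(restr_map (dif X _ _) v) dv linear0.
- move=> r v [x ex ->]; exists (r j x); last by rewrite /= cmap_comm.
  by rewrite /vertex_part -linearZ /= ex.
- move=> r /endomorphism_inverse[r' [hr' _]]; exists r' => v hv.
  exact: (null_act _ v hr' hv).
Qed.

Lemma simple_map_comp l (P P' : lmodType A) (f : {linear P -> P'}) (g : P' -> k^o) :
  simple_map (sb := sb) l g -> simple_map (sb := sb) l (g \o f).
Proof. by move=> hg a x y; rewrite /= linearP hg. Qed.

Lemma simple_map_0 l (P : lmodType A) (g : P -> k^o) : simple_map (sb := sb) l g -> g 0 = 0.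
Proof. by move=> cg; have := simple_map_sum (I := 'I_0) (fun=> 0) (fun=> 0) cg; rewrite !big_ord0. Qed.

(** D acts on the cohomology of Hom(X, S_l) by precomposition. *)
Lemma simple_map_cohomology l j z b :
  has_dim (fun g : X (j + 1) -> k^o => simple_map (sb := sb) l g /\ precomp (dif X j (j + 1)) g = 0) z ->
  has_dim (image_of (precomp (dif X (j + 1) (j + 1 + 1))) (@simple_map k A sb (X (j + 1 + 1)) l)) b ->
  exists h, z = (b + d * h)%N.
Proof.
move=> dz db; have [rho [rho1 rho2]] := lift_endomorphisms.
have null_act (r : chain X X) (g : X (j + 1) -> k^o) : nullhomotopic r ->
    simple_map (sb := sb) l g /\ precomp (dif X j (j + 1)) g = 0 ->
    image_of (precomp (dif X (j + 1) (j + 1 + 1))) (@simple_map k A sb (X (j + 1 + 1)) l) (g \o r (j + 1)).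
  move=> /nullhomotopicP[s hs] [cg dg]; exists (g \o s (j + 1 + 1) (j + 1)).
    exact: simple_map_comp.
  apply/funext => x; rewrite /= hs -[dif X j _ _]scale1r cg.
  have -> : g (dif X j (j + 1) (s (j + 1) j x)) = 0 by exact: (congr1 (fun u => u (s (j + 1) j x)) dg).
  by rewrite mulr0 add0r.
have simple_mapB (r : chain X X) (g : X (j + 1) -> k^o) : simple_map (sb := sb) l g ->
    (g \o r (j + 1)) - g = g \o (r - chain_id X) (j + 1).
  move=> cg; apply/funext => x.
  have e : (r - chain_id X) (j + 1) x = -1 *: x + r (j + 1) x by rewrite scaleN1r [RHS]addrC.
  rewrite [RHS](congr1 g e) cg.
  have -> : sb_val (s := sb) l (-1) = -1.
    by have := sb_valP (s := sb) l (-1) 1 0; rewrite addr0 scaleN1r val0 val1 addr0 mulr1.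
  by rewrite mulN1r [RHS]addrC.
apply: (@division_dvd _ (chain X X) (X (j + 1) -> k^o) (fun r g => g \o r (j + 1))
  (@nullhomotopic k A X X) d _ rho d_gt0 rho1 rho2 _ _ _ z b dz db) => //.
- by move=> r r'; exists (chain_comp r' r).
- move=> v [g cg ->]; split; first exact: simple_map_comp.
  apply/funext => x; rewrite /= dif_dif; exact: (simple_map_0 cg).
- move=> v [cg _] c r r'; apply/funext => x.
  rewrite -[LHS]/(v (c%:A *: r (j + 1) x + r' (j + 1) x)) cg; congr (_ * _ + _).
  by rewrite -[c%:A]addr0 sb_valP val0 val1 mulr1 addr0.
- move=> r v [cg dv]; split; first exact: simple_map_comp.
  apply/funext => x; rewrite /= cmap_comm.
  exact: (congr1 (fun u => u (r j x)) dv).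
- move=> r v [g cg ->]; exists (g \o r (j + 1 + 1)); first exact: simple_map_comp.
  by apply/funext => x; rewrite /= cmap_comm.
- move=> r /endomorphism_inverse[r' [_ hr']]; exists r' => v hv.
  have := null_act _ v hr' hv; rewrite -simple_mapB; last by case: hv.
  by move=> e; exact: e.
Qed.

End Divisibility.
End Endomorphisms.

(** * Exceptional complexes have scalar endomorphisms *)

Section EndomorphismField.
Variables (k : fieldType) (A : falgType k) (sb : split_basic A) (X : bcomplex A).
Notation Vx := (sb_vertex sb).

Section Divisibility.
Hypothesis End_division : forall f : khom X X, f <> 0 -> is_iso (f : @thom k (Kb A) X X).
Variables (d : nat) (d_gt0 : (0 < d)%N).
Hypothesis dE : has_dim (fun _ : khom X X => True) d.

Lemma vertex_part_altsum l N (q : int -> nat) : (forall i, has_dim (@vertex_part k A sb (X i) l) (q i)) ->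
  (forall i, (N <= `|i|)%N -> q i = 0%N) -> exists w, altsum N (fun i => (q i)%:Z) = d%:Z * w.
Proof.
move=> dq q0.
have /choice[z /choice[b hzb]] : forall i, exists z b,
    [/\ has_dim (fun x : restr (X i) => vertex_part (sb := sb) l x /\ restr_map (dif X i (i + 1)) x = 0) z,
        has_dim (image_of (restr_map (dif X i (i + 1))) (@vertex_part k A sb (X i) l)) b &
        q i = (z + b)%N] by move=> i; exact: rank_nullity.
have /choice[h hh] : forall i, exists h, z (i + 1) = (b i + d * h)%N.
  move=> i; have [dz _ _] := hzb (i + 1); have [_ db _] := hzb i.
  exact: (vertex_part_cohomology End_division d_gt0 dE dz db).
rewrite (@altsum_euler q z b (fun i => d * h i)%N) //; first exact: altsum_mul d (fun i => h (i - 1)).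
by move=> i; case: (hzb i).
Qed.

Lemma simple_map_altsum l N (p : int -> nat) : (forall i, has_dim (@simple_map k A sb (X i) l) (p i)) ->
  (forall i, (N <= `|i|)%N -> p i = 0%N) -> exists w, altsum N (fun i => (p i)%:Z) = d%:Z * w.
Proof.
move=> dp p0.
have /choice[z /choice[b hzb]] : forall j, exists z b,
    [/\ has_dim (fun g : X (j + 1) -> k^o => simple_map (sb := sb) l g /\ precomp (dif X j (j + 1)) g = 0) z,
        has_dim (image_of (precomp (dif X j (j + 1))) (@simple_map k A sb (X (j + 1)) l)) b &
        p (j + 1) = (z + b)%N] by move=> i; exact: rank_nullity.
have /choice[h hh] : forall j, exists h, z j = (b (j + 1)%R + d * h)%N.
  move=> j; have [dz _ _] := hzb j; have [_ db _] := hzb (j + 1).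
  exact: (simple_map_cohomology End_division d_gt0 dE dz db).
(* Precomposition lowers the degree, so the complex is read backwards. *)
rewrite -altsum_rev (@altsum_euler (fun i => p (- i)) (fun i => z (- i - 1)) (fun i => b (- i - 1))
  (fun i => d * h (- (i + 1) - 1)%R)%N).
- exact: (altsum_mul N d (fun i => h (- (i - 1 + 1) - 1))).
- by move=> i; have [_ _ <-] := hzb (- i - 1); rewrite subrK.
- by move=> i; rewrite hh; congr (b _ + _)%N; lia.
- by move=> i hi; apply: p0; rewrite abszN.
Qed.
End Divisibility.

(** The Euler characteristic of the graded endomorphism complex is d, because X is
    exceptional, and a sum of products of two multiples of d. *)
Theorem exceptional_hom1 : exceptional (X : Kb A) -> hom1 (X : Kb A) X.
Proof.
move=> [Xm X0 Xdiv]; have [d dE] := khom_findim X X.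
have d_gt0 : (0 < d)%N.
  rewrite lt0n; apply/eqP => d0; apply: X0; move: dE; rewrite d0 => -[f _ hf].
  by have [u ->] := (hf (tid (X : Kb A))).1 I; rewrite (_ : u = 0) ?linear0 //; apply/rowP => -[].
suff d1 : d = 1%N.
  move: dE; rewrite d1 => -[f fI hf]; exists (f (const_mx 1)).
    move=> e; have /rowP/(_ 0) : const_mx 1 = 0 :> 'rV[k]_1 by apply: fI; rewrite e linear0.
    by rewrite !mxE => /eqP; rewrite oner_eq0.
  move=> g; have [u ->] : exists u, g = f u by apply/hf.
  exists (u 0 0); rewrite -linearZ; congr (f _); apply/rowP => i.
  by rewrite ord1 !mxE mulr1.
(* The Euler characteristic needs a window on whose ends the complex vanishes. *)
have [N0 hN0] := cob_bounded X; pose N := N0.+1.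
have /choice[p hp] : forall i, exists p : Vx -> nat, forall l, has_dim (@simple_map k A sb (X i) l) (p l).
  by move=> i; apply: (@dependent_choice_fun _ (fun _ => nat)
    (fun l n => has_dim (@simple_map k A sb (X i) l) n)) => l;
    apply: simple_map_findim; apply: cob_fg.
have /choice[q hq] : forall i, exists q : Vx -> nat, forall l, has_dim (@vertex_part k A sb (X i) l) (q l).
  by move=> i; apply: (@dependent_choice_fun _ (fun _ => nat)
    (fun l n => has_dim (@vertex_part k A sb (X i) l) n)) => l;
    apply: vertex_part_findim; apply: cob_fg.
have zX i : (N <= `|i|)%N -> forall x : X i, x = 0 by move=> hi; apply: hN0; exact: hi.
have p0 i l : (N <= `|i|)%N -> p i l = 0%N.
  move=> hi; apply: (has_dim_uniq (hp i l)); apply: has_dim0 => g; split=> [cg|->].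
    by apply/funext => x; rewrite (zX i hi x); apply: (simple_map_0 cg).
  by case: (@simple_map_subspace k A sb (X i) l).
have q0 i l : (N <= `|i|)%N -> q i l = 0%N.
  move=> hi; apply: (has_dim_uniq (hq i l)); apply: has_dim0 => x; split=> [_|->].
    exact: zX.
  by case: (@vertex_part_subspace k A sb (X i) l).
have dhom i j : has_dim (fun _ : lhom (X i) (X j) => True) (\sum_l p i l * q j l).
  have [q' [hq' hl]] := hom_dim (@cob_fg k A X i) (@cob_proj k A X i) (hp i) (@cob_fg k A X j).
  by under eq_bigr => l _ do rewrite (has_dim_uniq (hq j l) (hq' l)).
pose g (m : int) := (\sum_(t < (2 * N).+1) \sum_l
  p (t%:Z - N%:Z)%R l * q (t%:Z - N%:Z + m)%R l)%N.
have dg m : has_dim (fun _ : graded_hom X m => True) (g m).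
  apply: (@lfam_has_dim k A (cob X) (fun i => X (i + m)) N (fun i => \sum_l p i l * q (i + m)%R l)%N).
    by move=> i hi; apply: zX; exact: ltnW.
  by move=> i; exact: dhom.
have /choice[z /choice[b hzb]] : forall m, exists z b,
    [/\ has_dim (fun f : graded_hom X m => True /\ graded_dif X m f = 0) z,
        has_dim (image_of (graded_dif X m) (fun _ => True)) b & g m = (z + b)%N].
  by move=> m; apply: rank_nullity.
have /choice[e he] : forall m, exists e, has_dim (fun _ : khom X (cshift m X) => True) e.
  by move=> m; apply: khom_findim.
have em m : m != 0 -> e m = 0%N.
  move=> m0; apply: (has_dim_uniq (he m)); apply: has_dim0 => f; split=> // _.
  exact: (Xm m m0 f).
have e0 : e 0 = d.
  have [phi [phi1 phi2]] := iso_post (kb_triangulated A) (X : Kb A) (kb_shift0 X).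
  apply: (has_dim_uniq _ dE); apply: (has_dim_inj (f := phi) phi1 _ (he 0)) => f.
  by split=> // _; have [f' ->] := phi2 f; exists f'.
pose M := (2 * N + 2)%N.
(* Only the cohomology in degree 0 survives, and its sign is positive as M is even. *)
have E1 : altsum M (fun m => (g m)%:Z) = d%:Z.
  rewrite (@altsum_euler g z b (fun m => e (m + 1))).
  - have hM : (M < (2 * M).+1)%N by lia.
    rewrite /altsum (bigD1 (Ordinal hM)) //= subrr sub0r addNr e0 big1 ?addr0.
      by rewrite -signr_odd (_ : odd M = false) ?expr0 ?mul1r //; rewrite /M; lia.
    move=> t /eqP tM; rewrite em ?mulr0 // subrK; apply/eqP => h; apply: tM.
    by apply: val_inj => /=; lia.
  - by move=> m; case: (hzb m).
  - move=> m; have [dz _ _] := hzb (m + 1); have [_ db _] := hzb m.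
    exact: (graded_hom_dim dz db (he (m + 1))).
  - move=> m hm; rewrite /g big1 // => t _; rewrite big1 // => l _.
    by rewrite q0 ?muln0 //; have := ltn_ord t; rewrite /M in hm; lia.
have E2 : d%:Z = \sum_l altsum N (fun i => (p i l)%:Z) * altsum N (fun i => (q i l)%:Z).
  rewrite -E1 /M; apply: (@altsum_convolution _ p q N) => i l hi; apply: q0; exact: ltnW.
have /choice[w hw] : forall l, exists w, altsum N (fun i => (p i l)%:Z) = d%:Z * w.
  by move=> l; apply: (simple_map_altsum Xdiv d_gt0 dE (l := l)) => // i; exact: p0.
have /choice[w' hw'] : forall l, exists w, altsum N (fun i => (q i l)%:Z) = d%:Z * w.
  by move=> l; apply: (vertex_part_altsum Xdiv d_gt0 dE (l := l)) => // i; exact: q0.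
have E3 : d%:Z * 1 = d%:Z * (d%:Z * \sum_l w l * w' l).
  rewrite mulr1 {1}E2 !mulr_sumr; apply: eq_bigr => l _.
  by rewrite hw hw' -!mulrA; congr (_ * _); rewrite mulrCA.
have dn0 : d%:Z != 0 by lia.
have := mulfI dn0 E3 => /(congr1 absz); rewrite abszM => /esym/eqP.
by rewrite muln_eq1 => /andP[/eqP].
Qed.

End EndomorphismField.

(** * Path algebras modulo admissible ideals *)

Section PathAlgebraSplit.
Variables (k : fieldType) (Q : quiver).
Notation kQ := (pathalg k Q).

Definition trivial_path (v : vertex Q) : qpath Q := exist _ (v, [::]) isT.

Lemma trivial_pathP (p : qpath Q) : plen p = 0%N -> exists v, p = trivial_path v.
Proof.
case: p => -[v s] hs; rewrite /plen /= => /size0nil e; exists v; apply: val_inj.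
by rewrite /= e.
Qed.

Lemma vertex_elt_subproof (v : vertex Q) :
  (fun p : qpath Q => (p == trivial_path v)%:R : k) \in @fsuppb k Q.
Proof.
apply/asboolP; exists 1%N => p; case: eqP => // ->; by rewrite /plen.
Qed.
Definition vertex_elt v : kQ := PathAlg (vertex_elt_subproof v).

Lemma pathalgE (c : k) (x y : kQ) p : (c *: x + y) p = c * x p + y p.
Proof. by []. Qed.
Lemma pathalgM (x y : kQ) p :
  (x * y) p = \sum_(i < (plen p).+1) x (ptake i p) * y (pdrop i p).
Proof. by []. Qed.

Lemma pathalg_sum (I : finType) (F : I -> kQ) p : (\sum_i F i) p = \sum_i F i p.
Proof. by apply: (big_morph (fun x : kQ => x p)). Qed.

Lemma pathalgM0 (x y : kQ) v : (x * y) (trivial_path v) = x (trivial_path v) * y (trivial_path v).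
Proof.
rewrite pathalgM /plen /= big_ord1 pdrop0; congr (x _ * _); exact: val_inj.
Qed.

Lemma vertex_eltE v w : vertex_elt w (trivial_path v) = (v == w)%:R.
Proof.
rewrite /=; congr (_%:R); congr nat_of_bool; apply/eqP/eqP => [e|-> //].
by have := congr1 (fun p : qpath Q => (val p).1) e.
Qed.
Lemma vertex_elt_pos w (p : qpath Q) : (0 < plen p)%N -> vertex_elt w p = 0.
Proof. by move=> hp /=; case: eqP => // e; move: hp; rewrite e. Qed.

Lemma vertex_sum : \sum_v vertex_elt v = 1.
Proof.
apply: pathalgP => p; rewrite pathalg_sum -[RHS]/((plen p == 0%N)%:R).
case: (posnP (plen p)) => [/trivial_pathP[v ->]|hp].
  rewrite (bigD1 v) // vertex_eltE eqxx big1 => [|w wv]; first exact: addr0.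
  by rewrite vertex_eltE eq_sym (negPf wv).
by rewrite big1 => [|v _]; [case: (plen p) hp|rewrite vertex_elt_pos].
Qed.

Lemma vertex_mul v w : vertex_elt v * vertex_elt w = (v == w)%:R *: vertex_elt v.
Proof.
apply: pathalgP => p; rewrite -[RHS]/((v == w)%:R * vertex_elt v p).
case: (posnP (plen p)) => [/trivial_pathP[u ->]|hp].
  rewrite pathalgM0 !vertex_eltE; case: (eqVneq u v) => [->|]; last by rewrite mul0r mulr0.
  by rewrite mul1r mulr1.
rewrite (vertex_elt_pos v hp) mulr0 pathalgM big1 // => i _.
case: (posnP i) => [->|i0]; first by rewrite pdrop0 (vertex_elt_pos w hp) mulr0.
rewrite vertex_elt_pos ?mul0r // plen_take.
by rewrite leq_min i0.
Qed.

Lemma arrow_ideal_powM (x y : kQ) n : arrow_ideal_pow 1 x -> arrow_ideal_pow n y ->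
  arrow_ideal_pow n.+1 (x * y).
Proof.
move=> hx hy p hp; rewrite pathalgM big1 // => i _.
case: (posnP i) => [->|i0]; first by rewrite hx ?mul0r // plen_take min0n.
by rewrite hy ?mulr0 // plen_drop; have := ltn_ord i; lia.
Qed.

(** The coefficient of the trivial path at v is well defined on A because the relations have
    length at least two, and the radical is spanned by the arrows. *)
Lemma presented_split_basic (A : algType k) (I : kQ -> Prop) :
  admissible I -> presented_by A I -> inhabited (split_basic A).
Proof.
move=> [_ [m _ [hm h2]]] [phi [phi1 phiM phiS phiK]].
(* lam v a is read off any preimage of a in the path algebra. *)
have /choice[sec hsec] := phiS.
pose lam v a := sec a (trivial_path v).
have lamE x v : lam v (phi x) = x (trivial_path v).
  have /phiK/h2 h : phi (sec (phi x) - x) = 0 by rewrite linearB hsec subrr.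
  have := h (trivial_path v) isT; rewrite -scaleN1r addrC pathalgE mulN1r addrC => /eqP.
  by rewrite subr_eq0 => /eqP.
have lamP v c a b : lam v (c *: a + b) = c * lam v a + lam v b.
  by rewrite -(hsec a) -(hsec b) -linearP !lamE.
have lamM v a b : lam v (a * b) = lam v a * lam v b.
  by rewrite -(hsec a) -(hsec b) -phiM !lamE pathalgM0.
split; apply: (@SplitBasic k A (vertex Q) (fun v => phi (vertex_elt v)) lam) => //.
- by move=> v w; rewrite lamE vertex_eltE.
- by rewrite -linear_sum vertex_sum.
- by move=> v; rewrite -phiM vertex_mul eqxx scale1r.
- by move=> v w vw; rewrite -phiM vertex_mul (negbTE vw) scale0r linear0.
exists m => s hs hJ.
have [y [-> hy]] : exists y, foldr *%R 1 s = phi y /\ arrow_ideal_pow (size s) y.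
  elim: s {hs} hJ => [|a s IH] hJ; first by exists 1.
  have [y [e hy]] : exists y, foldr *%R 1 s = phi y /\ arrow_ideal_pow (size s) y.
    by apply: IH => b bs; apply: hJ; rewrite inE bs orbT.
  exists (sec a * y); split; first by rewrite phiM hsec /= e.
  apply: arrow_ideal_powM => // p; rewrite ltnS leqn0 => /eqP/trivial_pathP[v ->].
  by apply: hJ; rewrite mem_head.
by apply/phiK/hm; rewrite -hs.
Qed.

End PathAlgebraSplit.

Theorem theorem6 (k : fieldType) (A : falgType k) (hA : gentle A)
  (hfull : exists (m : nat) (Y : 'I_m -> Kb A), full_exceptional_seq Y)
  (S : serre_functor (Kb A))
  (n : nat) (X : 'I_n -> Kb A) (hX : full_exceptional_seq X) :
  forall i : 'I_n, isomorphic (S (X i)) (left_dual (left_dual X) i).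
Proof.
case: hA => _ [Q [I [gI pA]]].
have [sb] := presented_split_basic (gentle_admissible gI) pA.
case: hX => [[excX orthX] fullX].
apply: (serre_left_dual2 (kb_triangulated A) S fullX); split=> [i|i j ji].
  by split; [apply: (exceptional_hom1 sb); apply: excX|case: (excX i)].
exact: orthX.
Qed.
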